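(* Let $K$ be a field which is neither locally finite nor of characteristic $2$, and suppose that $G_K$ is finitely generated as a topological group. Then for every elliptic curve $E/K$ such that $E[2](K)\cong(\mathbb{Z}/2\mathbb{Z})^2$, the rank of $E$ over $K$ is infinite.
   Context: For a field $K$, fix a separable closure $K^{\mathrm{sep}}$ and let $G_K:=\operatorname{Gal}(K^{\mathrm{sep}}/K)$ with its profinite topology. A field is locally finite if each of its finitely generated subfields is finite (equivalently, it is an algebraic extension of a finite field). $E[2](K)$ is the group of $K$-rational $2$-torsion points of $E$. The rank of $E$ over $K$ is $\dim_{\mathbb{Q}}(E(K)\otimes_{\mathbb{Z}}\mathbb{Q})$. *)

(* Defs.v *)
From HB Require Import structures.
From mathcomp Require Import all_boot all_order all_algebra all_field.
From mathcomp Require Import boolp classical_sets functions cardinality.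
From mathcomp Require Import topology.
From mathcomp Require Import ring.

Set Implicit Arguments.
Unset Strict Implicit.
Unset Printing Implicit Defensive.

Import GRing.Theory.
Local Open Scope classical_set_scope.
Local Open Scope ring_scope.

Definition is_subfield (K : fieldType) (F : set K) : Prop :=
  GRing.divring_closed [in F].

Definition generated_subfield (K : fieldType) (s : seq K) : set K :=
  smallest (@is_subfield K) [set` s].

Definition locally_finite (K : fieldType) : Prop :=
  forall s : seq K, finite_set (generated_subfield s).

Definition separable_algebraic (K L : fieldType) (iota : {rmorphism K -> L})
    (x : L) : Prop :=
  exists p : {poly K}, [/\ p \is monic, irreducible_poly p,
    root (map_poly iota p) x & separable_poly p].

Definition separably_closed (L : fieldType) : Prop :=
  forall p : {poly L}, separable_poly p -> (1 < size p)%N ->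
    exists x, root p x.

Definition is_separable_closure (K L : fieldType) (iota : {rmorphism K -> L}) :
    Prop :=
  (forall x, separable_algebraic iota x) /\ separably_closed L.

Record galois (K L : fieldType) (iota : {rmorphism K -> L}) := Galois {
  gal_fun :> L -> L;
  gal_zmod : zmod_morphism gal_fun;
  gal_monoid : GRing.monoid_morphism gal_fun;
  gal_bij : bijective gal_fun;
  gal_fix : forall a, gal_fun (iota a) = iota a
}.

Section GaloisGroup.
Variables (K L : fieldType) (iota : {rmorphism K -> L}).
Local Notation G := (galois iota).

HB.instance Definition _ := gen_eqMixin G.
HB.instance Definition _ := gen_choiceMixin G.

HB.instance Definition _ (g : G) :=
  GRing.isZmodMorphism.Build L L g (gal_zmod g).
HB.instance Definition _ (g : G) :=
  GRing.isMonoidMorphism.Build L L g (gal_monoid g).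

Lemma galoisP (g h : G) : g =1 h -> g = h.
Proof.
case: g h => [f fB fM fbij fK] [f' fB' fM' fbij' fK'] /= /funext ff'.
by case: _ / ff' in fB' fM' fbij' fK' *; congr Galois; exact: Prop_irrelevance.
Qed.

Fact gal_one_bij : bijective (@id L).
Proof. by exists id. Qed.

Definition gal_one : G :=
  @Galois K L iota id (fun _ _ => erefl) (erefl, fun _ _ => erefl)
    gal_one_bij (fun _ => erefl).

Section Mul.
Variables g h : G.

Fact gal_mul_zmod : zmod_morphism (g \o h).
Proof. by move=> x y; rewrite /= !rmorphB. Qed.
Fact gal_mul_monoid : GRing.monoid_morphism (g \o h).
Proof. by split=> [|x y]; rewrite /= ?rmorph1 ?rmorphM. Qed.
Fact gal_mul_fix a : (g \o h) (iota a) = iota a.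
Proof. by rewrite /= !gal_fix. Qed.

Definition gal_mul : G :=
  Galois gal_mul_zmod gal_mul_monoid (bij_comp (gal_bij g) (gal_bij h))
    gal_mul_fix.

End Mul.

Section Inv.
Variable g : G.

Fact gal_inverse : {h : L -> L | cancel g h /\ cancel h g}.
Proof. by apply: cid; case: (gal_bij g) => h gK hK; exists h. Qed.

Definition gal_inv_fun : L -> L := sval gal_inverse.

Fact gal_inv_funK : cancel g gal_inv_fun.
Proof. exact: (svalP gal_inverse).1. Qed.
Fact gal_funK : cancel gal_inv_fun g.
Proof. exact: (svalP gal_inverse).2. Qed.
Fact gal_inv_zmod : zmod_morphism gal_inv_fun.
Proof.
by move=> x y; apply: (can_inj gal_inv_funK); rewrite rmorphB /= !gal_funK.
Qed.
Fact gal_inv_monoid : GRing.monoid_morphism gal_inv_fun.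
Proof.
by split=> [|x y]; apply: (can_inj gal_inv_funK);
  rewrite ?rmorph1 ?rmorphM /= !gal_funK.
Qed.
Fact gal_inv_bij : bijective gal_inv_fun.
Proof. by exists g; [exact: gal_funK | exact: gal_inv_funK]. Qed.
Fact gal_inv_fix a : gal_inv_fun (iota a) = iota a.
Proof. by apply: (can_inj gal_inv_funK); rewrite gal_funK gal_fix. Qed.

Definition gal_inv : G :=
  Galois gal_inv_zmod gal_inv_monoid gal_inv_bij gal_inv_fix.

End Inv.

Fact gal_mulA : associative gal_mul.
Proof. by move=> g h k; apply: galoisP. Qed.
Fact gal_mul1 : left_id gal_one gal_mul.
Proof. by move=> g; apply: galoisP. Qed.
Fact gal_1mul : right_id gal_one gal_mul.
Proof. by move=> g; apply: galoisP. Qed.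
Fact gal_mulV : left_inverse gal_one gal_inv gal_mul.
Proof. by move=> g; apply: galoisP; exact: gal_inv_funK. Qed.
Fact gal_Vmul : right_inverse gal_one gal_inv gal_mul.
Proof. by move=> g; apply: galoisP; exact: gal_funK. Qed.

HB.instance Definition _ :=
  isGroup.Build G gal_mulA gal_mul1 gal_1mul gal_mulV gal_Vmul.

(* [fun h => {in s, h =1 g}] is the coset g Gal(L/K(s)); when L/K is algebraic,
   the K(s) are exactly the finite subextensions of L/K. *)
Definition krull_open (U : set G) : Prop :=
  forall g, U g -> exists s : seq L, forall h : G, {in s, h =1 g} -> U h.

Fact krull_openT : krull_open setT.
Proof. by move=> g _; exists [::]. Qed.

Fact krull_openI : setI_closed krull_open.
Proof.
move=> U V oU oV g [/oU[s sU] /oV[t tV]]; exists (s ++ t) => h hg; split.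
  by apply: sU => x xs; apply: hg; rewrite mem_cat xs.
by apply: tV => x xt; apply: hg; rewrite mem_cat xt orbT.
Qed.

Fact krull_open_bigU (I : Type) (f : I -> set G) :
  (forall i, krull_open (f i)) -> krull_open (\bigcup_i f i).
Proof.
move=> of_ g [i _ /of_[s sf]]; exists s => h hg.
by exists i => //; exact: sf.
Qed.

HB.instance Definition _ :=
  isOpenTopological.Build G krull_openT krull_openI krull_open_bigU.

End GaloisGroup.

Definition generated_subgroup (G : groupType) (s : seq G) : set G :=
  smallest (fun H : set G => group_closed [in H]) [set` s].

Definition topologically_finitely_generated (K L : fieldType)
    (iota : {rmorphism K -> L}) : Prop :=
  exists s : seq (galois iota), closure (generated_subgroup s) = setT.

Record weierstrass (K : fieldType) := Weierstrass {
  w_a1 : K; w_a2 : K; w_a3 : K; w_a4 : K; w_a6 : K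
}.

Section Weierstrass.
Variables (K : fieldType) (W : weierstrass K).
Local Notation a1 := (w_a1 W).
Local Notation a2 := (w_a2 W).
Local Notation a3 := (w_a3 W).
Local Notation a4 := (w_a4 W).
Local Notation a6 := (w_a6 W).

Definition discriminant : K :=
  let b2 := a1 ^+ 2 + 4 * a2 in
  let b4 := 2 * a4 + a1 * a3 in
  let b6 := a3 ^+ 2 + 4 * a6 in
  let b8 := a1 ^+ 2 * a6 + 4 * a2 * a6 - a1 * a3 * a4 + a2 * a3 ^+ 2
            - a4 ^+ 2 in
  - (b2 ^+ 2 * b8) - 8 * b4 ^+ 3 - 27 * b6 ^+ 2 + 9 * b2 * b4 * b6.

(* [None] is the point at infinity. *)
Definition on_curve (P : option (K * K)) : bool :=
  if P is Some (x, y) then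
    y ^+ 2 + a1 * x * y + a3 * y == x ^+ 3 + a2 * x ^+ 2 + a4 * x + a6
  else true.

Definition coord_opp (P : option (K * K)) : option (K * K) :=
  if P is Some (x, y) then Some (x, - y - a1 * x - a3) else None.

(* Third intersection point, reflected, of the cubic with the line of slope l
   through (x1, y1) and a point of abscissa x2. *)
Definition coord_line (l x1 y1 x2 : K) : option (K * K) :=
  let x3 := l ^+ 2 + a1 * l - a2 - x1 - x2 in
  coord_opp (Some (x3, l * (x3 - x1) + y1)).

Definition coord_add (P Q : option (K * K)) : option (K * K) :=
  match P, Q with
  | None, _ => Q
  | _, None => P
  | Some (x1, y1), Some (x2, y2) =>
    if x1 != x2 then coord_line ((y2 - y1) / (x2 - x1)) x1 y1 x2
    else if P == coord_opp Q then None
    else coord_line ((3 * x1 ^+ 2 + 2 * a2 * x1 + a4 - a1 * y1)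
                     / (2 * y1 + a1 * x1 + a3)) x1 y1 x1
  end.

Lemma on_curve_opp P : on_curve P -> on_curve (coord_opp P).
Proof.
case: P => [[x y]|] //= /eqP e; apply/eqP; rewrite -e; ring.
Qed.

Lemma on_curve_add P Q : on_curve P -> on_curve Q -> on_curve (coord_add P Q).
Proof.
case: P Q => [[x1 y1]|] [[x2 y2]|] // c1 c2; rewrite /coord_add.
case: ifPn => [x12|/negPn/eqP x12].
  apply: on_curve_opp; move: c1 c2 => /= /eqP c1 /eqP c2.
  have d : x2 - x1 != 0 by rewrite subr_eq0 eq_sym.
  set l := _ / _; have y2E : y2 = l * (x2 - x1) + y1 by rewrite divfK // subrK.
  apply/eqP/subr0_eq/(mulfI d); rewrite mulr0.
  set x3 := (_ - x1 - x2).
  pose g x y := y ^+ 2 + a1 * x * y + a3 * y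
                - (x ^+ 3 + a2 * x ^+ 2 + a4 * x + a6).
  have g1 : g x1 y1 = 0 by rewrite /g c1 subrr.
  have g2 : g x2 y2 = 0 by rewrite /g c2 subrr.
  transitivity (g x1 y1 * (x2 - x3) + g x2 y2 * (x3 - x1)).
    by rewrite /g y2E /x3; ring.
  by rewrite g1 g2 !mul0r addr0.
case: ifPn => // nopp; apply: on_curve_opp.
move: c1 c2 nopp => /= /eqP c1 /eqP c2; rewrite -x12 in c2 *.
move=> nopp.
have y12 : y1 = y2.
  have : (y1 - y2) * (y1 - (- y2 - a1 * x1 - a3)) = 0.
    transitivity (y1 ^+ 2 + a1 * x1 * y1 + a3 * y1
                  - (y2 ^+ 2 + a1 * x1 * y2 + a3 * y2)); first ring.
    by rewrite c1 c2 subrr.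
  move/eqP; rewrite mulf_eq0 !subr_eq0 => /orP[/eqP //|/eqP y1E].
  by rewrite -y1E eqxx in nopp.
have d : 2 * y1 + a1 * x1 + a3 != 0.
  apply: contraNneq nopp => d0; rewrite -y12; apply/eqP; congr (Some (_, _)).
  by apply/subr0_eq; rewrite -d0; ring.
set l := _ / _.
have lE : l * (2 * y1 + a1 * x1 + a3)
          = 3 * x1 ^+ 2 + 2 * a2 * x1 + a4 - a1 * y1 by rewrite divfK.
apply/eqP/subr0_eq; set x3 := l ^+ 2 + a1 * l - a2 - x1 - x1.
transitivity ((y1 ^+ 2 + a1 * x1 * y1 + a3 * y1
                - (x1 ^+ 3 + a2 * x1 ^+ 2 + a4 * x1 + a6))
  + (l * (2 * y1 + a1 * x1 + a3)
     - (3 * x1 ^+ 2 + 2 * a2 * x1 + a4 - a1 * y1)) * (x3 - x1)).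
  by rewrite /x3; ring.
by rewrite c1 lE !subrr mul0r addr0.
Qed.

End Weierstrass.

(* Every elliptic curve over K has such a Weierstrass model, unique up to a change
   of coordinates over K which preserves the group law. *)
Record elliptic_curve (K : fieldType) := EllipticCurve {
  ec_eqn :> weierstrass K;
  ec_smooth : discriminant ec_eqn != 0
}.

Definition ec_point (K : fieldType) (E : elliptic_curve K) : Type :=
  {P : option (K * K) | on_curve E P}.

Section Points.
Variables (K : fieldType) (E : elliptic_curve K).

HB.instance Definition _ := Choice.on (ec_point E).

Definition point_zero : ec_point E := exist _ None isT.
Definition point_opp (P : ec_point E) : ec_point E :=
  exist _ (coord_opp E (val P)) (on_curve_opp (valP P)).
Definition point_add (P Q : ec_point E) : ec_point E :=
  exist _ (coord_add E (val P) (val Q)) (on_curve_add (valP P) (valP Q)).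

HB.instance Definition _ := GRing.hasAdd.Build (ec_point E) point_add.
HB.instance Definition _ := GRing.hasZero.Build (ec_point E) point_zero.
HB.instance Definition _ := GRing.hasOpp.Build (ec_point E) point_opp.

End Points.

Definition has_full_two_torsion (K : fieldType) (E : elliptic_curve K) : Prop :=
  exists f : {additive ('Z_2 * 'Z_2)%type -> ec_point E},
    injective f /\ range f = [set P | P *+ 2 = 0].

(* (V, tau) is A (x)_Z Q, characterized by the universal property of extension
   of scalars along Z -> Q.  It only involves the addition and the zero of A, so
   that no proof of the group axioms is needed to state it for A = E(K). *)
Definition is_tensor_rat (A : baseAddUMagmaType) (V : lmodType rat)
    (tau : {additive A -> V}) : Prop :=
  forall (W : lmodType rat) (f : {additive A -> W}),
    exists g : {linear V -> W}, g \o tau =1 f /\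
      forall h : {linear V -> W}, h \o tau =1 f -> h =1 g.

Definition finite_dimensional (V : lmodType rat) : Prop :=
  exists (n : nat) (f : {linear V -> 'rV[rat]_n}), bijective f.

(* A (x)_Z Q is unique up to isomorphism, so the choice of (V, tau) does not
   matter; the existential asserts that it exists. *)
Definition infinite_rank (A : baseAddUMagmaType) : Prop :=
  exists (V : lmodType rat) (tau : {additive A -> V}),
    is_tensor_rat tau /\ ~ finite_dimensional V.

(* Main.v *)
(* Since G_K is generated by finitely many g, the group K* / K*^2 is finite: the class
   of d is determined by the signs g(sqrt d) / sqrt d.  On the other hand K contains a
   field F with infinitely many square classes and a valuation of odd residue
   characteristic p which is nontrivial on F, and both properties survive when
   finitely many elements of K are adjoined to F.  Write E as
   y^2 = x (x - a) (x - b), and let F contain a, b and the coordinates of the finitely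
   many points of E[p](K).  Some h in F is a square in K but not in F.

   Colour F* by K* / K*^2 and by a quadratic character of F* which is nontrivial at h.
   A theorem of Brauer's type (a monochromatic progression together with its step, here
   multiplied by h) gives q, r in F such that q, q - r a and q - r b all have the colour
   of h r.  Then x = q / r is the abscissa of a point P = (x, y) of E(K) with x in F and
   y not in F, and x can be taken of large absolute value, so that P lies in the formal
   group.  If k P is in E(F), then it lies also in the quadratic twist, hence
   2 k P = 0.  But then the order of P is divisible by p, because the formal group has
   no torsion prime to p, so that a multiple of P is a point of order p which lies in
   E(F) and, by the same argument, is killed by 2: contradiction.  Therefore P is
   independent of E(F), and one repeats the construction over F(y). *)

From HB Require Import structures.
From mathcomp Require Import all_boot all_order all_algebra all_field.
From mathcomp Require Import boolp classical_sets functions cardinality.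
From mathcomp Require Import topology.
From mathcomp Require Import ring zify.
Require Import Defs.

Set Implicit Arguments.
Unset Strict Implicit.
Unset Printing Implicit Defensive.

Import GRing.Theory Num.Theory.

(** * The Hales-Jewett theorem *)

(** The cubic f has odd degree. If q, q - r a and q - r b all have the class of h r, then f(q / r)
    has the class of h^3, that is of h: a square in K, but not in F, where the character detects h.
    This is why the step is multiplied by h. F has infinitely many square classes, so a colouring by
    all of them is impossible; one character at h is the finite substitute. The points are sought
    over a small F because K itself has finitely many square classes, whereas the valuation is put
    on all of K, since the ordinates leave F: hence Chevalley's theorem. The prime p is odd so that
    a point killed by 2 and by p vanishes, and so that finiteness of E[p](K) can be tested against
    the point (0, 0) of order 2. Colourings are arbitrary, so each combinatorial statement must give
    a finite test set before the colouring is known; Brauer's induction recurses on such sets. The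
    type [ec_point] carries an addition without axioms. Associativity is proved for the Legendre
    model by sending a point to an ideal class of K[X, Y] / (Y^2 - f), and only the rank is
    transported back. *)

Definition subst_word (T : Type) (u : seq (option T)) (t : T) : seq T :=
  map (odflt t) u.

Lemma subst_word_cat (T : Type) (u v : seq (option T)) t :
  subst_word (u ++ v) t = subst_word u t ++ subst_word v t.
Proof. exact: map_cat. Qed.

Lemma subst_word_Some (T : Type) (w : seq T) t : subst_word (map Some w) t = w.
Proof. by rewrite /subst_word -map_comp map_id. Qed.

Section HalesJewett.
Variable T : finType.
Implicit Types (A : seq T) (u : seq (option T)).

(** A combinatorial line: [None] marks the moving coordinates, and one is required so that the line
    is not a single point. *)
Definition line_of_size n u := (size u == n) && (None \in u).

(** Only letters of [A] are substituted, while the fixed coordinates range over [T]; the alphabet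
    can thus grow by induction inside one type of words. *)
Definition hales_jewett_property A := forall C : finType, exists n,
  forall c : seq T -> C, exists u, line_of_size n u /\
    {in A &, forall a b, c (subst_word u a) = c (subst_word u b)}.

Section ColourFocusing.
Variables (a : T) (A : seq T) (b0 : T) (C : finType).
Hypothesis b0A : b0 \in A.

Definition mono_line n (c : seq T -> C) := exists u, line_of_size n u /\
  {in a :: A &, forall x y, c (subst_word u x) = c (subst_word u y)}.

(** The lines meet in the focus [w] at the letter [a]: as soon as [w] takes one of their colours,
    the line of that colour becomes monochromatic on [a :: A]. *)
Definition focused n (c : seq T -> C) w (us : seq (seq (option T))) :=
  [/\ size w = n,
      {in us, forall u, [/\ line_of_size n u, subst_word u a = w &
         {in A, forall b, c (subst_word u b) = c (subst_word u b0)}]} &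
      uniq [seq c (subst_word u b0) | u <- us]].

(** Words are split in two. A prefix is coloured by the whole colouring that it induces on suffixes,
    which the property for [A] makes constant along a line [v]; focused lines of suffixes come from
    the induction on [m]. *)
Lemma colour_focusing m : hales_jewett_property A -> exists n,
  forall c : seq T -> C, mono_line n c \/
    exists w us, size us = m /\ focused n c w us.
Proof.
move=> hjA; elim: m => [|m [n IHn]].
  by exists 0 => c; right; exists [::], [::].
have [n' hn'] := hjA {ffun n.-tuple T -> C}.
exists (n' + n) => c.
pose c' v := [ffun w : n.-tuple T => c (v ++ w)].
have [v [/andP[/eqP sv Nv] hv]] := hn' c'.
have vE x w : x \in A -> size w = n ->
    c (subst_word v x ++ w) = c (subst_word v b0 ++ w).
  move=> xA /eqP sw; have /ffunP/(_ (Tuple sw)) := hv _ _ xA b0A.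
  by rewrite !ffunE.
have svx x : size (subst_word v x) = n' by rewrite size_map.
case: (IHn (fun w => c (subst_word v b0 ++ w))) => [[u [/andP[/eqP su Nu] hu]]|].
  left; exists (map Some (subst_word v b0) ++ u); split.
    by rewrite /line_of_size size_cat size_map svx su eqxx mem_cat Nu orbT.
  by move=> x y xA yA; rewrite !subst_word_cat !subst_word_Some; exact: hu.
move=> [w [us [sus [sw hus uus]]]].
(* If the old focus has the colour of a line [u], that line extends to [a]. Otherwise its colour is
   new, and [v ++ map Some w] becomes a further line. *)
have [/mapP[u uus' cw]|wN] :=
    boolP (c (subst_word v b0 ++ w) \in
             [seq c (subst_word v b0 ++ subst_word u b0) | u <- us]).
  have [/andP[/eqP su Nu] ua ub] := hus _ uus'.
  left; exists (map Some (subst_word v b0) ++ u); split.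
    by rewrite /line_of_size size_cat size_map svx su eqxx mem_cat Nu orbT.
  suff h x : x \in a :: A -> c (subst_word (map Some (subst_word v b0) ++ u) x)
      = c (subst_word v b0 ++ subst_word u b0).
    by move=> x y /h-> /h->.
  rewrite subst_word_cat subst_word_Some inE => /predU1P[->|/ub //].
  by rewrite ua.
(* The old lines move diagonally: [v] and [u] vary together, so at [a] all lines reach the same new
   focus. *)
right; exists (subst_word v a ++ w).
exists ((v ++ map Some w) :: [seq v ++ u | u <- us]); split.
  by rewrite /= size_map sus.
split; first by rewrite size_cat svx sw.
  move=> u'; rewrite inE => /predU1P[->|/mapP[u uus' ->]].
    split.
    - by rewrite /line_of_size size_cat size_map sv sw eqxx mem_cat Nv.
    - by rewrite subst_word_cat subst_word_Some.
    - move=> b bA; rewrite !subst_word_cat !subst_word_Some; exact: vE.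
  have [/andP[/eqP su Nu] ua ub] := hus _ uus'; split.
  - by rewrite /line_of_size size_cat sv su eqxx mem_cat Nv.
  - by rewrite subst_word_cat ua.
  - move=> b bA; rewrite !subst_word_cat vE ?ub //.
    by rewrite size_map su.
rewrite map_cons subst_word_cat subst_word_Some cons_uniq -map_comp.
rewrite (@eq_map _ _ _ (fun u => c (subst_word v b0 ++ subst_word u b0))) ?wN //.
by move=> u; rewrite /= subst_word_cat.
Qed.

End ColourFocusing.

Theorem hales_jewett A : hales_jewett_property A.
Proof.
elim: A => [|a [|b0 A] IHA] C.
- by exists 1 => c; exists [:: None]; split.
- exists 1 => c; exists [:: None]; split=> // x y.
  by rewrite !inE => /eqP-> /eqP->.
(* More focused lines than colours cannot exist, which leaves the first alternative. *)
have [n hn] := colour_focusing a C (mem_head b0 A) #|C|.+1 IHA.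
exists n => c; case: (hn c) => [//|[w [us [sus [_ _ /card_uniqP]]]]].
by rewrite size_map sus => eqC; have := max_card [in [seq c (subst_word u b0) | u <- us]]; rewrite eqC ltnn.
Qed.

End HalesJewett.

Local Open Scope classical_set_scope.
Local Open Scope ring_scope.

(** * Subfields and square classes *)

Ltac mem_closed := repeat first [assumption | apply: rpred1 | apply: rpred0
  | apply: rpred_nat | apply: rpredB | apply: rpredD | apply: rpred_div
  | apply: rpredM | apply: rpredX
  | match goal with |- is_true (in_mem (- _) _) => rewrite rpredN end].

(** [Zorn_bigcup] also tests the empty chain, whose union need not satisfy [P]; for the predicate
    [Q] the empty union stands for [A0]. *)
Lemma Zorn_superset (T : Type) (P : set (set T)) (A0 : set T) :
  P A0 ->
  (forall F : set (set T), F !=set0 -> F `<=` P -> total_on F subset ->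
    P (\bigcup_(X in F) X)) ->
  exists A, [/\ A0 `<=` A, P A & forall B, A `<=` B -> P B -> B `<=` A].
Proof.
move=> PA0 chainP; pose Q X := P (A0 `|` X).
have [F FQ totF|A [QA maxA]] := @Zorn_bigcup T Q.
  rewrite /Q; have [->|/set0P[X0 FX0]] := eqVneq F set0.
    by rewrite bigcup_set0 setU0.
  suff -> : A0 `|` \bigcup_(X in F) X = \bigcup_(X in [set A0 `|` X | X in F]) X.
    apply: chainP.
    - by exists (A0 `|` X0), X0.
    - by move=> _ [X FX <-]; exact: FQ.
    - move=> _ _ [X FX <-] [Y FY <-]; have [XY|YX] := totF _ _ FX FY.
        by left; apply: setUS.
      by right; apply: setUS.
  rewrite bigcup_image; apply/seteqP; split=> [x [xA0|[X FX Xx]]|x [X FX [xA0|Xx]]].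
  - by exists X0 => //; left.
  - by exists X => //; right.
  - by left.
  - by right; exists X.
exists (A0 `|` A); split=> // B AB PB; have [subA|/existsNP[x /not_implyP[Bx Ax]]] := pselect (B `<=` A).
  by move=> x /subA; right.
exfalso; apply: (maxA B); last by rewrite /Q setUidr // => y A0y; apply: AB; left.
by split=> [y Ay|/(_ _ Bx)//]; apply: AB; right.
Qed.

Definition mk_subfield (K : fieldType) (S : {pred K})
    (S_closed : GRing.divring_closed S) : divringClosed K :=
  HB.pack S (GRing.isDivringClosed.Build K S S_closed).

Section SquareClasses.
Variable K : fieldType.
Implicit Types (F M : divringClosed K) (d e u s x y : K).

(** Finiteness of the group of square classes, expressed by a finite colouring that separates them;
    the colouring may be finer, so the quotient is never built. *)
Definition finite_square_classes (F : {pred K}) :=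
  exists (C : finType) (c : K -> C), {in F &, forall d d', d != 0 -> d' != 0 ->
    c d = c d' -> exists2 u, u \in F & d = d' * u ^+ 2}.

Lemma finite_square_classes_up_to F e : e \in F -> e != 0 ->
  (exists (C : finType) (c : K -> C), {in F &, forall d d', d != 0 -> d' != 0 ->
    c d = c d' -> exists2 u, u \in F & d = d' * u ^+ 2 \/ d = d' * e * u ^+ 2}) ->
  finite_square_classes F.
Proof.
move=> eF e0 [C [c hc]].
pose r k := xget 0 [set d | [/\ d \in F, d != 0 & c d = k]]%classic.
have rP d : d \in F -> d != 0 ->
    [/\ r (c d) \in F, r (c d) != 0 & c (r (c d)) = c d].
  by move=> dF d0; rewrite /r; case: xgetP => [x _ //|/(_ d)[]].
pose b d := `[< exists2 u, u \in F & d = r (c d) * u ^+ 2 >].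
exists (C * bool)%type, (fun d => (c d, b d)) => d d' dF d'F d0 d'0 [cdd' bdd'].
have [rF r0 cr] := rP d dF d0.
have nz (w v z : K) : w = v * z ^+ 2 -> w != 0 -> z != 0.
  by move=> ->; apply: contraNneq => ->; rewrite expr0n mulr0.
have [bT|bF] := boolP (b d).
  have [u uF du] := asboolP _ bT; rewrite bdd' in bT.
  have [u' u'F du'] := asboolP _ bT; have u'0 : u' != 0 by exact: nz du' d'0.
  exists (u / u'); first exact: rpred_div.
  by rewrite du du' cdd'; field.
have bF' : ~~ b d' by rewrite -bdd'.
have [u uF [du|du]] := hc d _ dF rF d0 r0 (esym cr).
  by case/asboolP: bF; exists u.
rewrite cdd' in rF r0 cr du.
have [u' u'F [du'|du']] := hc d' _ d'F rF d'0 r0 (esym cr).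
  by case/asboolP: bF'; exists u'.
have u'0 : u' != 0 by exact: nz du' d'0.
exists (u / u'); first exact: rpred_div.
move: (r _) r0 du du' => R R0 -> ->; field => //; exact: u'0.
Qed.

Lemma sqr_mem_eq F y u : y ^+ 2 = u ^+ 2 -> u \in F -> y \in F.
Proof.
by move=> /eqP; rewrite eqf_sqr => /orP[]/eqP-> // uF; rewrite rpredN.
Qed.

(** If every element of [M] with square in [F] lay in [F], the finite colouring of [M] would already
    separate the square classes of [F]. *)
Lemma new_square F M : {subset F <= M} -> finite_square_classes M ->
  ~ finite_square_classes F -> exists2 y, y \in M /\ y \notin F & y ^+ 2 \in F.
Proof.
move=> FM [C [c hc]] nF; apply: contrapT => no; apply: nF; exists C, c.
move=> d d' dF d'F d0 d'0 /(hc _ _ (FM _ dF) (FM _ d'F) d0 d'0) [u uM du].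
exists u => //; apply: contrapT => /negP uF; apply: no; exists u => //.
by rewrite (_ : u ^+ 2 = d / d') ?rpred_div // du; field.
Qed.

Section Quadratic.
Variables (F : divringClosed K) (u : K).
Hypotheses (uF : u \notin F) (u2F : u ^+ 2 \in F).

Definition quadratic_pred : {pred K} :=
  fun x => `[< exists a b, [/\ a \in F, b \in F & x = a + b * u] >].

Lemma quadratic_predP x : reflect
  (exists a b, [/\ a \in F, b \in F & x = a + b * u]) (x \in quadratic_pred).
Proof. exact: asboolP. Qed.

Lemma quadratic_eq0 a b : a \in F -> b \in F -> a + b * u = 0 -> b = 0.
Proof.
move=> aF bF abu; apply: contraNeq uF => b0.
have -> : u = - a / b by rewrite -(addr0 (- a)) -abu; field.
by rewrite rpred_div ?rpredN.
Qed.

Lemma quadratic_closed : GRing.divring_closed quadratic_pred.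
Proof.
split.
- by apply/quadratic_predP; exists 1, 0; rewrite rpred1 rpred0; split=> //; ring.
- move=> x y /quadratic_predP[a [b [aF bF ->]]] /quadratic_predP[a' [b' [a'F b'F ->]]].
  apply/quadratic_predP; exists (a - a'), (b - b').
  by rewrite !rpredB //; split=> //; ring.
- move=> x y /quadratic_predP[a [b [aF bF ->]]] /quadratic_predP[a' [b' [a'F b'F ->]]].
  apply/quadratic_predP; pose e := u ^+ 2; have eF : e \in F := u2F.
  (* Division by 0 returns 0. Otherwise the conjugate a' - b' u rationalizes the quotient, and its
     norm is nonzero because [u] is not in [F]. *)
  have [z0|z0] := eqVneq (a' + b' * u) 0.
    by exists 0, 0; rewrite z0 rpred0; split=> //; rewrite invr0; ring.
  have nz : a' ^+ 2 - b' ^+ 2 * e != 0.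
    have -> : a' ^+ 2 - b' ^+ 2 * e = (a' + b' * u) * (a' - b' * u) by rewrite /e; ring.
    rewrite mulf_eq0 negb_or z0 /=; apply: contra_neq z0 => h.
    have b'0 : b' = 0.
      by apply: oppr_inj; rewrite oppr0; apply: (quadratic_eq0 a'F); rewrite ?rpredN // mulNr.
    by rewrite -h b'0; ring.
  pose n := (a' ^+ 2 - b' ^+ 2 * e)^-1.
  have nF : n \in F by rewrite rpredV rpredB // rpredM // ?rpredX.
  exists ((a * a' - b * b' * e) * n), ((b * a' - a * b') * n).
  split; [by mem_closed|by mem_closed|].
  by rewrite /n /e; field; rewrite z0 exprMn andbT; exact: nz.
Qed.

Definition quadratic := mk_subfield quadratic_closed.

Lemma quadratic_sub : {subset F <= quadratic}.
Proof.
by move=> x xF; apply/quadratic_predP; exists x, 0; rewrite rpred0 mul0r addr0.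
Qed.

Lemma quadratic_gen : u \in quadratic.
Proof.
by apply/quadratic_predP; exists 0, 1; rewrite rpred0 rpred1 mul1r add0r.
Qed.

Lemma quadratic_min M : {subset F <= M} -> u \in M -> {subset quadratic <= M}.
Proof.
move=> FM uM x /quadratic_predP[a [b [aF bF ->]]].
by rewrite rpredD ?rpredM // FM.
Qed.

Hypothesis char2 : 2 != 0 :> K.

(** If (a + b u)^2 lies in [F] then 2 a b = 0, so it is a square of [F] or [u ^+ 2] times one: on
    square classes the kernel has order at most 2. *)
Lemma quadratic_infinite_square_classes :
  ~ finite_square_classes F -> ~ finite_square_classes quadratic.
Proof.
move=> nF [C [c hc]]; apply: nF.
have u0 : u != 0 by apply: contraNneq uF => ->; exact: rpred0.
apply: (@finite_square_classes_up_to _ (u ^+ 2)) => //; first by rewrite expf_neq0.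
exists C, c => d d' dF d'F d0 d'0.
case/(hc _ _ (quadratic_sub dF) (quadratic_sub d'F) d0 d'0) => v.
case/quadratic_predP=> a [b [aF bF ->]] dE.
have : 2 * a * b = 0.
  apply: (@quadratic_eq0 (a ^+ 2 + b ^+ 2 * u ^+ 2 - d / d')).
  - by mem_closed.
  - by mem_closed.
  - by rewrite dE; field.
move/eqP; rewrite !mulf_eq0 (negPf char2) /= => /orP[]/eqP z0.
- by exists b => //; right; rewrite dE z0; ring.
- by exists a => //; left; rewrite dE z0; ring.
Qed.

End Quadratic.

Section Adjoin.
Variables (F : divringClosed K) (s : K).

Definition adjoin_pred : {pred K} := fun x => `[< exists a b : {poly K},
  [/\ a \is a polyOver F, b \is a polyOver F, b.[s] != 0 & x = a.[s] / b.[s]] >].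

Lemma adjoin_predP x : reflect (exists a b : {poly K},
  [/\ a \is a polyOver F, b \is a polyOver F, b.[s] != 0 & x = a.[s] / b.[s]])
  (x \in adjoin_pred).
Proof. exact: asboolP. Qed.

Lemma adjoin_closed : GRing.divring_closed adjoin_pred.
Proof.
split.
- apply/adjoin_predP; exists 1, 1.
  by rewrite rpred1 hornerC oner_neq0 divr1.
- move=> x y /adjoin_predP[a [b [aF bF b0 ->]]] /adjoin_predP[c [d [cF dF d0 ->]]].
  apply/adjoin_predP; exists (a * d - c * b), (b * d).
  rewrite !hornerE mulf_neq0 //; split; [by mem_closed|by mem_closed|by []|].
  by field; rewrite b0 d0.
- move=> x y /adjoin_predP[a [b [aF bF b0 ->]]] /adjoin_predP[c [d [cF dF d0 ->]]].
  apply/adjoin_predP; have [c0|c0] := eqVneq c.[s] 0.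
    exists 0, 1; rewrite rpred0 rpred1 c0 !hornerE oner_neq0; split=> //.
    by rewrite invr0 mulr0 ?mul0r.
  exists (a * d), (b * c); rewrite !hornerE mulf_neq0 //.
  split; [by mem_closed|by mem_closed|by []|].
  by field; rewrite b0 c0 d0.
Qed.

Definition adjoin := mk_subfield adjoin_closed.

Lemma adjoin_sub : {subset F <= adjoin}.
Proof.
move=> x xF; apply/adjoin_predP; exists x%:P, 1.
by rewrite polyOverC xF rpred1 !hornerC oner_neq0 divr1.
Qed.

Lemma adjoin_gen : s \in adjoin.
Proof.
apply/adjoin_predP; exists 'X, 1.
by rewrite polyOverX rpred1 hornerX hornerC oner_neq0 divr1.
Qed.

Lemma adjoin_min M : {subset F <= M} -> s \in M -> {subset adjoin <= M}.
Proof.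
move=> FM sM x /adjoin_predP[a [b [aF bF b0 ->]]].
by rewrite rpred_div // rpred_horner // (polyOverS FM).
Qed.

End Adjoin.

Lemma finite_square_classes_eq (F M : {pred K}) : F =i M ->
  finite_square_classes F -> finite_square_classes M.
Proof.
move=> FM [C [c hc]]; exists C, c => d d'; rewrite -!FM => dF d'F d0 d'0 cd.
by have [u uF ->] := hc d d' dF d'F d0 d'0 cd; exists u; rewrite -?FM.
Qed.

(** Division with remainder carried out with coefficients in [F]; it bounds the degrees of numerator
    and denominator of an element of F(s). *)
Lemma reduce_modulo F s (m : {poly K}) : m \is a polyOver F -> m != 0 ->
  root m s -> forall a : {poly K}, a \is a polyOver F ->
  exists a' : {poly K}, [/\ a' \is a polyOver F, (size a' < size m)%N & a'.[s] = a.[s]].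
Proof.
move=> mF m0 ms a; have [n] := ubnP (size a); elim: n a => // n IHn a /ltnSE san aF.
have [sam|sma] := ltnP (size a) (size m); first by exists a.
pose k := (size a - size m)%N; pose c := lead_coef a / lead_coef m.
have cF : c \in F by rewrite rpred_div // lead_coefE (polyOverP _).
have lm0 : lead_coef m != 0 by rewrite lead_coef_eq0.
have sm : (0 < size m)%N by rewrite size_poly_gt0.
have sa : (0 < size a)%N by apply: leq_trans sma.
pose b := a - c *: ('X^k * m).
have bF : b \is a polyOver F.
  by apply: rpredB => //; apply: polyOverZ => //; apply: rpredM => //; apply: rpredX; exact: polyOverX.
have sb : (size b < size a)%N.
  rewrite -(prednK sa) ltnS; apply/leq_sizeP => j; rewrite leq_eqVlt => /predU1P[<-|jl].
    rewrite coefB coefZ coefXnM ifN; last by rewrite -leqNgt /k; lia.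
    rewrite (_ : (_ - k)%N = (size m).-1); last by rewrite /k; lia.
    by rewrite -!lead_coefE /c divfK // subrr.
  have saj : (size a <= j)%N by lia.
  rewrite coefB coefZ coefXnM [a`_j]nth_default //.
  have -> : (j < k)%N = false by rewrite /k; lia.
  have sj : (size m <= j - k)%N by rewrite /k; lia.
  by rewrite [m`__]nth_default // mulr0 subrr.
have [a' [a'F sa' ea']] := IHn b (leq_trans sb san) bF.
exists a'; split; [by []|by []|by rewrite ea' /b hornerD hornerN hornerZ hornerM (rootP ms) !mulr0 subr0].
Qed.

Hypothesis char2 : 2 != 0 :> K.

(* The degree of s drops when the square root of an element of F which lies in
   F(s) is adjoined to F. *)
Lemma algebraic_infinite_square_classes F s (m : {poly K}) :
  m \is a polyOver F -> m != 0 -> root m s ->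
  ~ finite_square_classes F -> ~ finite_square_classes (adjoin F s).
Proof.
have [n] := ubnP (size m); elim: n F m => // n IHn F m /ltnSE smn mF m0 ms nF finA.
have [u [uA uF] u2F] := new_square (@adjoin_sub F s) finA nF.
have [a [b [aF bF b0 uE]]] := adjoin_predP _ _ _ uA.
have [a' [a'F sa' ea']] := reduce_modulo mF m0 ms aF.
have [b' [b'F sb' eb']] := reduce_modulo mF m0 ms bF.
pose M := quadratic uF u2F.
have FM : {subset F <= M} := quadratic_sub uF u2F.
have uM : u \in M := quadratic_gen uF u2F.
(* Since u = a'(s) / b'(s), this polynomial over M = F(u) vanishes at [s]. It is shorter than [m],
   and nonzero because [u] is not in [F]. *)
apply: (IHn M (a' - u *: b')).
- apply: leq_trans smn; apply: leq_ltn_trans (size_polyD _ _) _.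
  by rewrite size_polyN gtn_max sa' (leq_ltn_trans (size_scale_leq _ _)).
- by rewrite rpredB ?polyOverZ // (polyOverS FM).
- apply: contraNneq (uF) => h.
  have b'0 : b' != 0 by apply: contraNneq b0 => b'0; rewrite -eb' b'0 hornerC.
  have -> : u = lead_coef a' / lead_coef b'.
    rewrite (subr0_eq h) lead_coefZ mulfK // lead_coef_eq0 //.
  by rewrite rpred_div // lead_coefE (polyOverP _).
- by rewrite /root !hornerE ea' eb' uE divfK // subrr.
- exact: quadratic_infinite_square_classes.
(* The root [u] already lies in F(s), so M(s) = F(s). *)
- have subF : {subset adjoin F s <= adjoin M s}.
    by apply: adjoin_min; [move=> y /FM; exact: adjoin_sub | exact: adjoin_gen].
  have subM : {subset adjoin M s <= adjoin F s}.
    apply: adjoin_min (adjoin_gen F s); apply: quadratic_min => //; exact: adjoin_sub.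
  by apply: finite_square_classes_eq finA => x; apply/idP/idP => [/subF|/subM].
Qed.

End SquareClasses.

Lemma prime_pigeonhole (C : finType) (c : nat -> C) (n : nat) :
  exists p q : nat, [/\ prime p, prime q, (n < p)%N, (p < q)%N & c p = c q].
Proof.
apply: contrapT => no.
suff /(_ #|C|.+1)[s [ss su _]] : forall k, exists s : seq nat, [/\ size s = k,
    uniq (map c s) & {in s, forall p, prime p /\ (n < p)%N}].
  have /card_uniqP := su; rewrite size_map ss => eC.
  by have := max_card [in map c s]; rewrite eC ltnn.
elim=> [|k [s [sk su sP]]]; first by exists [::].
have [q qm q_prime] := prime_above (n + \max_(p <- s) p)%N.
exists (q :: s); split; first by rewrite /= sk.
  rewrite /= su andbT; apply/mapP => -[p ps cqp]; apply: no; exists p, q.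
  have [p_prime np] := sP _ ps; split=> //.
  apply: leq_ltn_trans qm; apply: leq_trans (leq_addl _ _).
  by apply: (@leq_bigmax_seq _ s xpredT id).
move=> p; rewrite inE => /predU1P[->|/sP //]; split=> //.
by apply: leq_ltn_trans qm; exact: leq_addr.
Qed.

(** * Square classes of transcendental extensions and of the prime field *)

Section InfiniteSquareClasses.
Variables (K L : fieldType) (iota : {rmorphism K -> L}).
Hypothesis closedL : separably_closed L.

(** A root of 1 + X + ... + X^(n-1) is wanted; it exists because this factor of X^n - 1 is
    separable, and it is not 1 because the value at 1 is n. *)
Lemma exists_root_of_unity (n : nat) : (1 < n)%N -> n%:R != 0 :> L ->
  exists2 c : L, c ^+ n = 1 & c != 1.
Proof.
move=> n1 n0; pose f : {poly L} := \sum_(i < n) 'X^i.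
have fE : 'X^n - 1 = ('X - 1%:P) * f by rewrite subrX1.
have sf : size f = n.
  have n_gt0 : (0 < n)%N by lia.
  have h : size ('X^n - 1 : {poly L}) = n.+1 by rewrite size_XnsubC.
  have f0 : f != 0.
    by apply: contraTneq isT => f0; move: h; rewrite fE f0 mulr0 size_poly0.
  by move: h; rewrite fE size_monicM ?monicXsubC // size_XsubC => -[].
have [c cf] : exists c, root f c.
  apply: closedL; last by rewrite sf.
  apply: (@dvdp_separable _ ('X^n - 1)); first by rewrite fE dvdp_mull.
  exact: separable_Xn_sub_1.
exists c.
  have := congr1 (horner^~ c) fE.
  by rewrite hornerM (rootP cf) mulr0 !hornerE => /subr0_eq.
apply: contraNneq n0 => c1; move: cf; rewrite /root c1 /f horner_sum.
under eq_bigr do rewrite hornerXn expr1n.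
by rewrite sumr_const card_ord.
Qed.

(* For primes p < q the polynomials X^p - 1 and X^q - 1 differ by no square of a
   rational function, because a nontrivial q-th root of unity is a simple root of the
   latter only. *)
Lemma transcendental_infinite_square_classes (F : divringClosed K) (s : K) :
  (forall m : {poly K}, m \is a polyOver F -> root m s -> m = 0) ->
  ~ finite_square_classes (adjoin F s).
Proof.
move=> trs [C [c hc]].
(* At most one prime vanishes in [L]; beyond it all X^p - 1 are separable. *)
have [N hN] : exists N, forall p, prime p -> (N < p)%N -> p%:R != 0 :> L.
  have [[q [q_prime q0]]|no] := pselect (exists q, prime q /\ q%:R == 0 :> L).
    exists q => p p_prime qp; apply: contraL (q_prime) => p0.
    have cL : q \in [pchar L] by rewrite inE q_prime.
    move: p0; rewrite -(dvdn_pcharf cL) dvdn_prime2 // => /eqP e.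
    by rewrite e ltnn in qp.
  by exists 0 => p p_prime _; apply/negP => p0; apply: no; exists p.
have [p [q [p_prime q_prime Np pq cpq]]] :=
  prime_pigeonhole (fun p => c (s ^+ p - 1)) N.
have XnF n : ('X^n - 1 : {poly K}) \is a polyOver F.
  by apply: rpredB; rewrite ?rpred1 // rpredX // polyOverX.
have Xn0 n : (0 < n)%N -> ('X^n - 1 : {poly K}) != 0.
  by move=> n0; rewrite -size_poly_eq0 size_XnsubC.
have sn n : s ^+ n - 1 \in adjoin F s.
  by mem_closed; exact: adjoin_gen.
have sn0 n : (0 < n)%N -> s ^+ n - 1 != 0.
  move=> n0; apply: contraNneq (Xn0 _ n0) => h; apply/eqP/trs => //.
  by rewrite /root !hornerE h.
have p0 := prime_gt0 p_prime; have q0 := prime_gt0 q_prime.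
have [u uF] := hc _ _ (sn q) (sn p) (sn0 _ q0) (sn0 _ p0) (esym cpq).
have [a [b [aF bF bs0 ->]]] := adjoin_predP _ _ _ uF => e.
have /eqP : ('X^q - 1) * b ^+ 2 - ('X^p - 1) * a ^+ 2 = 0.
  apply: trs; first by apply: rpredB; apply: rpredM => //; apply: rpredX.
  by rewrite /root !hornerE /= e; apply/eqP; field.
rewrite subr_eq0 => /eqP eqab.
have a0 : a != 0.
  apply: contraNneq bs0 => a0; move/eqP: eqab.
  rewrite a0 expr0n mulr0 mulf_eq0 (negPf (Xn0 _ q0)) /= expf_eq0 /=.
  by move/eqP->; rewrite horner0.
have b0 : b != 0 by apply: contraNneq bs0 => ->; rewrite horner0.
have [z zq z1] := exists_root_of_unity (prime_gt1 q_prime) (hN q q_prime (ltn_trans Np pq)).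
have Xr n : root ('X^n - 1 : {poly L}) z = (z ^+ n == 1).
  by rewrite /root !hornerE subr_eq0.
have XL n : map_poly iota ('X^n - 1) = 'X^n - 1 :> {poly L}.
  by rewrite rmorphB /= map_polyXn rmorph1.
have XnL0 n : (0 < n)%N -> ('X^n - 1 : {poly L}) != 0.
  by move=> n0; rewrite -size_poly_eq0 size_XnsubC.
have zp : ~~ root ('X^p - 1 : {poly L}) z.
  rewrite Xr; apply: contra_neq z1 => zp.
  have /(Bezoutl q)[k k_lt] : (0 < p)%N by [].
  have /eqP -> : coprime p q by rewrite prime_coprime // dvdn_prime2 // (ltn_eqF pq).
  case/dvdnP=> l kl; have := congr1 (fun n => z ^+ n) kl.
  by rewrite exprD expr1 mulnC exprM zq expr1n mulr1 mulnC exprM zp expr1n.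
have mz : mup z ('X^q - 1 : {poly L}) = 1%N.
  have sep : separable_poly ('X^q - 1 : {poly L}).
    by apply: separable_Xn_sub_1; apply: hN => //; apply: ltn_trans pq.
  apply/eqP; rewrite eqn_leq mup_leq ?XnL0 // mup_geq ?XnL0 // expr1.
  rewrite dvdp_XsubCl Xr zq eqxx andbT.
  by rewrite separable_nosquare // size_XsubC.
(* The multiplicity of [z] is odd on the left, one more than twice that in [b], and even on the
   right. *)
have := congr1 (fun f => mup z (map_poly iota f)) eqab.
rewrite !expr2 !rmorphM /= !XL !mupM ?mulf_neq0 ?XnL0 ?map_poly_eq0 //.
rewrite mz (mupNroot zp) => /(congr1 odd).
by rewrite /= !oddD !addbb.
Qed.

End InfiniteSquareClasses.

Section PrimeField.
Variable K : fieldType.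

Definition prime_field_pred : {pred K} := fun x =>
  `[< exists a b : int, b%:~R != 0 :> K /\ x = a%:~R / b%:~R >].

Lemma prime_field_predP x : reflect
  (exists a b : int, b%:~R != 0 :> K /\ x = a%:~R / b%:~R)
  (x \in prime_field_pred).
Proof. exact: asboolP. Qed.

Lemma prime_field_closed : GRing.divring_closed prime_field_pred.
Proof.
split.
- by apply/prime_field_predP; exists 1, 1; rewrite oner_neq0 divr1.
- move=> x y /prime_field_predP[a [b [b0 ->]]] /prime_field_predP[c [d [d0 ->]]].
  apply/prime_field_predP; exists (a * d - c * b), (b * d).
  rewrite rmorphB !rmorphM /= mulf_neq0 //; split=> //.
  by field; rewrite b0 d0.
- move=> x y /prime_field_predP[a [b [b0 ->]]] /prime_field_predP[c [d [d0 ->]]].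
  apply/prime_field_predP; have [c0|c0] := eqVneq (c%:~R : K) 0.
    by exists 0, 1; rewrite c0 oner_neq0 !mul0r invr0 mulr0.
  exists (a * d), (b * c); rewrite !rmorphM /= mulf_neq0 //; split=> //.
  by field; rewrite b0 c0 d0.
Qed.

Definition prime_field := mk_subfield prime_field_closed.

(** Distinct primes are inequivalent: in p b^2 = q a^2 the exponent of p is odd on the left and even
    on the right. *)
Lemma prime_field_infinite_square_classes :
  (forall n, n.+1%:R != 0 :> K) -> ~ finite_square_classes prime_field.
Proof.
move=> char0 [C [c hc]].
have int0 (z : int) : (z%:~R == 0 :> K) = (z == 0).
  case: z => [[|n]|n]; rewrite ?eqxx // ?(negPf (char0 _)) //.
  by rewrite NegzE rmorphN /= oppr_eq0 (negPf (char0 _)).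
have [p [q [p_prime q_prime _ pq cpq]]] := prime_pigeonhole (fun p => c p%:R) 0.
have P n : n%:R \in prime_field by exact: rpred_nat.
have P0 n : prime n -> n%:R != 0 :> K by case: n.
have [u /prime_field_predP[a [b [b0 ->]]] e] := hc _ _ (P p) (P q) (P0 _ p_prime) (P0 _ q_prime) cpq.
have /eqP : (p%:Z * b ^+ 2 - q%:Z * a ^+ 2)%:~R = 0 :> K.
  by rewrite !expr2 rmorphB !rmorphM /= -!pmulrn e; field.
rewrite int0 subr_eq0 => /eqP /(congr1 absz); rewrite !expr2 !abszM /= => eN.
have bN : (0 < absz b)%N by rewrite absz_gt0 -int0.
have aN : (0 < absz a)%N.
  rewrite lt0n; apply: contraTneq isT => a0; move/eqP: eN.
  rewrite a0 !muln0 !muln_eq0 orbb.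
  by rewrite (gtn_eqF (prime_gt0 p_prime)) (gtn_eqF bN).
have /(congr1 odd) := congr1 (logn p) eN.
rewrite !lognM ?muln_gt0 ?bN ?aN ?prime_gt0 // (logn_prime p p_prime) (logn_prime p q_prime).
by rewrite eqxx (ltn_eqF pq) !oddD !addbb.
Qed.

End PrimeField.

(** * Valuation rings *)

Definition mk_subring (K : fieldType) (S : {pred K})
    (S_closed : GRing.subring_closed S) : subringClosed K :=
  HB.pack S (GRing.isSubringClosed.Build K S S_closed).

Section ValuationRing.
Variable K : fieldType.

Lemma expf_mul_invX (x : K) (i n : nat) : x != 0 -> (i <= n)%N ->
  x ^+ i * x^-1 ^+ n = x^-1 ^+ (n - i).
Proof.
move=> x0 in_; rewrite -[in LHS](subnK in_) exprD mulrCA -exprMn mulfV //.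
by rewrite expr1n mulr1.
Qed.

Definition valuation_ring (O : subringClosed K) :=
  forall x, x \notin O -> x^-1 \in O.

Section MaximalIdeal.
Variable O : subringClosed K.
Hypothesis valO : valuation_ring O.

(** The nonunits of [O]. The clause for 0 is separate because 0^-1 = 0 lies in [O]; elements outside
    [O] are excluded, since their inverses lie in [O]. *)
Definition maximal_ideal : {pred K} := fun x => (x == 0) || (x^-1 \notin O).
Local Notation m := maximal_ideal.

Lemma maximal_idealE x : (x \in m) = (x == 0) || (x^-1 \notin O).
Proof. by []. Qed.

Lemma maximal_ideal_sub : {subset m <= O}.
Proof.
move=> x; rewrite maximal_idealE => /orP[/eqP->|/valO]; first exact: rpred0.
by rewrite invrK.
Qed.

Lemma maximal_ideal1 : 1 \notin m.
Proof. by rewrite maximal_idealE oner_eq0 invr1 rpred1. Qed.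

Lemma maximal_idealM x y : x \in O -> y \in m -> x * y \in m.
Proof.
move=> xO; rewrite !maximal_idealE mulf_eq0.
have [->//|x0] := eqVneq x 0; have [->//|y0 /= yO] := eqVneq y 0.
by apply: contra yO => xyO; rewrite (_ : y^-1 = x * (x * y)^-1) ?rpredM //; field; rewrite y0.
Qed.

Lemma maximal_idealMr x y : x \in m -> y \in O -> x * y \in m.
Proof. by move=> xm yO; rewrite mulrC maximal_idealM. Qed.

Lemma maximal_ideal0 : 0 \in m.
Proof. by rewrite maximal_idealE eqxx. Qed.

Lemma maximal_idealN x : x \in m -> - x \in m.
Proof. by rewrite !maximal_idealE oppr_eq0 invrN rpredN. Qed.

(** Of two nonzero elements one divides the other in [O], and a + b = (a / b + 1) b. *)
Lemma maximal_idealD x y : x \in m -> y \in m -> x + y \in m.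
Proof.
have wlogP a b : a \in m -> b \in m -> b != 0 -> a / b \in O -> a + b \in m.
  move=> am bm b0 abO; rewrite (_ : a + b = (a / b + 1) * b); last by field.
  by rewrite maximal_idealM // rpredD // rpred1.
move=> xm ym.
have [->|x0] := eqVneq x 0; first by rewrite add0r.
have [->|y0] := eqVneq y 0; first by rewrite addr0.
have [xy|/valO] := boolP (x / y \in O); first exact: wlogP.
by rewrite invf_div addrC; exact: wlogP.
Qed.

Lemma maximal_idealB x y : x \in m -> y \in m -> x - y \in m.
Proof. by move=> xm ym; rewrite maximal_idealD ?maximal_idealN. Qed.

Lemma unit_of_notin_maximal_ideal x : x \notin m -> x != 0 /\ x^-1 \in O.
Proof. by rewrite maximal_idealE negb_or negbK => /andP. Qed.

Lemma add_one_notin_maximal_ideal x : x \in m -> 1 + x \notin m.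
Proof.
move=> xm; apply: contra maximal_ideal1 => h.
by rewrite -[1](addrK x) maximal_idealB.
Qed.

Lemma scale_into_valuation_ring (F : divringClosed K) (s : seq K) :
  {subset s <= F} ->
  exists e, [/\ e \in F, e != 0 & {in s, forall g, e * g \in O}].
Proof.
elim: s => [|g s IHs] sF; first by exists 1; rewrite rpred1 oner_neq0.
have [|e [eF e0 es]] := IHs; first by move=> x xs; apply: sF; rewrite inE xs orbT.
have gF : g \in F by apply: sF; exact: mem_head.
have [egO|egO] := boolP (e * g \in O).
  by exists e; split=> // x; rewrite inE => /predU1P[->|/es].
have eg0 : e * g != 0 by apply: contraNneq egO => ->; exact: rpred0.
(* This factor is 1 / g: it sends [g] to 1, and the earlier elements stay in [O] because (e g)^-1 is
   in [O]. *)
exists (e * (e * g)^-1); split; first by mem_closed.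
  by rewrite mulf_neq0 ?invr_neq0.
move=> x; rewrite inE => /predU1P[->|xs].
  by rewrite mulrAC divff ?rpred1.
by rewrite mulrAC rpredM ?es ?valO.
Qed.

End MaximalIdeal.

(** * Chevalley's theorem: a subring maximal without t^-1 is a valuation ring *)

Section Chevalley.
Variables (S : subringClosed K) (t : K).
Hypotheses (t0 : t != 0) (tS : t \in S) (tVS : t^-1 \notin S).

Section Maximal.
Variable O : subringClosed K.
Hypotheses (tO : t \in O) (tVO : t^-1 \notin O).
Hypothesis maxO : forall x, x \notin O ->
  exists2 p : {poly K}, p \is a polyOver O & p.[x] = t^-1.

Lemma horner_mul_expr_inv (p : {poly K}) (x : K) (n : nat) :
  p \is a polyOver O -> x != 0 -> x^-1 \in O -> (size p <= n.+1)%N ->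
  p.[x] * x^-1 ^+ n \in O.
Proof.
move=> pO x0 xO sp; rewrite (horner_coef_wide _ sp) mulr_suml rpred_sum // => i _.
rewrite -mulrA expf_mul_invX //; last by rewrite -ltnS.
by apply: rpredM; [exact: (polyOverP pO)|exact: rpredX].
Qed.

(** Were w = (1 - t r)^-1 outside [O], maximality would give t^-1 = p(w). Multiplying by a power of
    1 - t r puts the right side in [O], while the left side becomes t^-1 - r' with r' in [O]. *)
Lemma inv_one_sub_in_maximal_subring r : r \in O -> 1 - t * r != 0 /\ (1 - t * r)^-1 \in O.
Proof.
move=> rO; have nz : 1 - t * r != 0.
  apply: contraNneq tVO => /subr0_eq h.
  by rewrite (_ : t^-1 = r) //; apply: (mulfI t0); rewrite divff.
split=> //; apply: contrapT => /negP/maxO[p pO].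
set w := _^-1 => pw; case/negP: tVO.
have w0 : w != 0 by rewrite invr_neq0.
have wO : w^-1 \in O by rewrite invrK rpredB ?rpred1 ?rpredM.
have [r' r'O rE] : exists2 r', r' \in O & (1 - t * r) ^+ (size p) = 1 - t * r'.
  elim: (size p) => [|n [r' r'O e]]; first by exists 0; rewrite ?rpred0 // mulr0 subr0.
  exists (r + r' - t * r * r'); last by rewrite exprS e; ring.
  by mem_closed.
have := horner_mul_expr_inv pO w0 wO (leqnSn _).
rewrite pw invrK rE mulrBr mulr1 mulKf // => h.
by rewrite -[t^-1](subrK r') rpredD.
Qed.

(** The relation q(x^-1) = t^-1 reads 1 - t q_0 = t (q_1 x^-1 + ... + q_k x^-k). As 1 - t q_0 is a
    unit, x^(n+1) is an [O]-combination of lower powers, which replaces the top term of [p]. *)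
Lemma lower_degree (x : K) (n k : nat) (p q : {poly K}) :
  x != 0 -> (k <= n.+1)%N -> p \is a polyOver O -> q \is a polyOver O ->
  (size p <= n.+2)%N -> (size q <= k.+1)%N -> p.[x] = t^-1 -> q.[x^-1] = t^-1 ->
  exists p' : {poly K},
    [/\ p' \is a polyOver O, (size p' <= n.+1)%N & p'.[x] = t^-1].
Proof.
move=> x0 kn pO qO sp sq px qx.
have q0O : q`_0 \in O := polyOverP qO 0%N.
have [nz wO] := inv_one_sub_in_maximal_subring q0O; set w := _^-1 in wO.
pose r : {poly K} := \sum_(j < k) (w * t * q`_j.+1) *: 'X^(n - j).
have rO : r \is a polyOver O.
  apply: rpred_sum => j _; apply: polyOverZ; last by rewrite rpredX // polyOverX.
  by mem_closed; exact: (polyOverP qO).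
have sr : (size r <= n.+1)%N.
  apply: leq_trans (size_sum _ _ _) _; apply/bigmax_leqP => j _.
  by apply: leq_trans (size_scale_leq _ _) _; rewrite size_polyXn ltnS leq_subr.
have rx : r.[x] = x ^+ n.+1.
  have e : 1 - t * q`_0 = t * \sum_(j < k) q`_j.+1 * x^-1 ^+ j.+1.
    have := qx; rewrite (horner_coef_wide _ sq) big_ord_recl /= expr0 mulr1.
    move=> h; apply/eqP; rewrite subr_eq addrC -mulrDr h divff //.
  have -> : r.[x] = x ^+ n.+1 * w * (t * \sum_(j < k) q`_j.+1 * x^-1 ^+ j.+1).
    rewrite !mulr_sumr horner_sum; apply: eq_bigr => j _.
    have jn : (j <= n)%N by rewrite -ltnS (leq_trans (ltn_ord j)).
    have h := @expf_mul_invX x^-1 j.+1 n.+1; rewrite invrK invr_eq0 in h.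
    by rewrite hornerZ hornerXn -[(n - j)%N]subSS -h //; ring.
  by rewrite -e -mulrA /w mulVf // mulr1.
exists (take_poly n.+1 p + p`_n.+1 *: r); split.
- apply: rpredD; last by apply: polyOverZ => //; exact: (polyOverP pO).
  apply/polyOverP => i; rewrite coef_take_poly; case: ifP => _; last exact: rpred0.
  exact: (polyOverP pO).
- rewrite (leq_trans (size_polyD _ _)) // geq_max size_take_poly.
  exact: leq_trans (size_scale_leq _ _) sr.
rewrite hornerD hornerZ rx -px (horner_coef_wide _ (size_take_poly _ _)).
rewrite (horner_coef_wide _ sp) [in RHS]big_ord_recr /=; congr (_ + _).
by apply: eq_bigr => i _; rewrite coef_take_poly ltn_ord.
Qed.

Lemma maximal_subring_valuation : valuation_ring O.
Proof.
move=> x xO; apply: contrapT => /negP xVO.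
have x0 : x != 0 by apply: contraNneq xO => ->; exact: rpred0.
have [p pO px] := maxO xO; have [q qO qx] := maxO xVO.
(* Descent on the sum of the two degrees: the longer polynomial is shortened, and y is exchanged
   with its inverse when the order of the degrees changes. *)
suff : forall N n k (y : K) (p q : {poly K}), (n + k <= N)%N -> (k <= n)%N -> y != 0 ->
    p \is a polyOver O -> q \is a polyOver O -> (size p <= n.+1)%N ->
    (size q <= k.+1)%N -> p.[y] = t^-1 -> q.[y^-1] = t^-1 -> False.
  move=> h; have [kn|nk] := leqP (size q) (size p).
    exact: (h _ (size p) (size q) x p q (leqnn _)).
  apply: (h _ (size q) (size p) x^-1 q p (leqnn _)) => //; first exact: ltnW.
    by rewrite invr_eq0.
  by rewrite invrK.
elim=> [|N IHN] [|n] k y {}p {}q nkN kn y0 {}pO {}qO sp sq {}px {}qx //.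
- case/negP: tVO; rewrite -px (size1_polyC sp) hornerC; exact: (polyOverP pO).
- case/negP: tVO; rewrite -px (size1_polyC sp) hornerC; exact: (polyOverP pO).
have [p' [p'O sp' p'x]] := lower_degree y0 kn pO qO sp sq px qx.
have nkN' : (n + k <= N)%N by rewrite -ltnS -addSn.
have [kn'|nk'] := leqP k n; first exact: (IHN n k y p' q).
have yV0 : y^-1 != 0 by rewrite invr_eq0.
have p'xV : p'.[y^-1^-1] = t^-1 by rewrite invrK.
rewrite addnC in nkN'.
exact: (IHN k n y^-1 q p' nkN' (ltnW nk') yV0 qO p'O sq sp' qx p'xV).
Qed.

End Maximal.

(** Zorn's lemma gives a maximal subring that contains [S] and omits t^-1; adjoining a further x
    must produce t^-1 as a value p(x), which is the hypothesis [maxO]. *)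
Lemma chevalley : exists O : subringClosed K,
  [/\ {subset S <= O}, valuation_ring O & t^-1 \notin O].
Proof.
pose P (X : set K) := GRing.subring_closed [in X] /\ (t^-1 \notin X).
have [|F [X0 FX0] FP totF|A [SA [Asub tVA] maxA]] :=
    @Zorn_superset K P [set x | x \in S]%classic.
- split; last by rewrite mem_setE.
  by split=> [|x y|x y]; rewrite !mem_setE; [exact: rpred1|exact: rpredB|exact: rpredM].
- have inU x : (x \in (\bigcup_(X in F) X)%classic) <-> exists2 X, F X & x \in X.
    split=> [/set_mem[X FX Xx]|[X FX /set_mem Xx]]; first by exists X => //; exact: mem_set.
    by apply: mem_set; exists X.
  have in2 x y : x \in (\bigcup_(X in F) X)%classic -> y \in (\bigcup_(X in F) X)%classic ->
      exists X, [/\ F X, x \in X & y \in X].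
    move=> /inU[X FX xX] /inU[Y FY yY]; have [XY|YX] := totF _ _ FX FY.
      by exists Y; split=> //; apply/mem_set/XY/set_mem.
    by exists X; split=> //; apply/mem_set/YX/set_mem.
  split; last by apply/negP => /inU[X FX]; apply/negP; exact: (FP _ FX).2.
  split.
  + by apply/inU; exists X0 => //; case: (FP _ FX0) => [[]].
  + move=> x y xU yU; have [X [FX xX yX]] := in2 _ _ xU yU; apply/inU; exists X => //.
    by have [[_ + _] _] := FP _ FX; exact.
  + move=> x y xU yU; have [X [FX xX yX]] := in2 _ _ xU yU; apply/inU; exists X => //.
    by have [[_ _ +] _] := FP _ FX; exact.
pose O := mk_subring Asub; exists O.
have OE x : (x \in O) = (x \in A) by [].
have SO : {subset S <= O} by move=> x xS; rewrite OE; apply/mem_set/SA.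
split=> //; apply: maximal_subring_valuation => //; first exact: SO.
move=> x xO; apply: contrapT => no.
pose B : set K := [set y | exists2 p : {poly K}, p \is a polyOver O & p.[x] = y]%classic.
have inB y : (y \in B) <-> exists2 p : {poly K}, p \is a polyOver O & p.[x] = y.
  by split=> [/set_mem|h]; last exact: mem_set.
case/negP: xO; rewrite OE; apply/mem_set/(maxA B).
- move=> y /mem_set yA; exists y%:P; last by rewrite hornerC.
  by rewrite polyOverC.
- split; last by apply/negP => /inB.
  split=> [|y z /inB[p pO <-] /inB[q qO <-]|y z /inB[p pO <-] /inB[q qO <-]]; apply/inB.
  + by exists 1; rewrite ?rpred1 ?hornerC.
  + by exists (p - q); rewrite ?rpredB // !hornerE.
  + by exists (p * q); rewrite ?rpredM // !hornerE.
- by exists 'X; rewrite ?polyOverX ?hornerX.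
Qed.

End Chevalley.
End ValuationRing.

(** * A multiplicative version of the theorems of Gallai and Brauer *)

Section GallaiBrauer.
Variables (K : fieldType) (O : subringClosed K) (F : divringClosed K) (t : K).
Hypotheses (valO : valuation_ring O) (tF : t \in F) (t0 : t != 0).
Local Notation m := (maximal_ideal O).
Hypothesis tm : t \in m.

Section Evaluation.
Variables (T : Type) (g : T -> K) (e : K).

(* The factors t make the step of every combinatorial line a nonzero element of m. *)
Definition word_value (w : seq T) : K := foldr (fun i v => t * (e * g i + v)) 0 w.

Definition line_base (u : seq (option T)) : K :=
  foldr (fun x v => t * ((if x is Some i then e * g i else 0) + v)) 0 u.

Definition line_step (u : seq (option T)) : K :=
  foldr (fun x v => t * ((if x is None then 1 else 0) + v)) 0 u.

Lemma word_value_subst u i :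
  word_value (subst_word u i) = line_base u + e * line_step u * g i.
Proof.
elim: u => [|[j|] u IHu] /=; first by rewrite mulr0 mul0r addr0.
  by rewrite IHu; ring.
by rewrite IHu; ring.
Qed.

Lemma line_step_small u : line_step u \in m.
Proof.
elim: u => [|x u IHu]; first exact: maximal_ideal0.
have h := maximal_ideal_sub valO IHu.
by case: x => [j|] /=; apply: maximal_idealMr => //; apply: rpredD => //;
  rewrite ?rpred0 ?rpred1.
Qed.

Lemma line_step_mem u : line_step u \in F.
Proof. by elim: u => [|[j|] u IHu] /=; mem_closed. Qed.

Lemma line_step_neq0 (u : seq (option T)) : has (fun x => ~~ isSome x) u -> line_step u != 0.
Proof.
elim: u => //= -[j|] u IHu /= Nu; rewrite mulf_neq0 //.
  by rewrite add0r IHu.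
have /unit_of_notin_maximal_ideal[] // :=
  add_one_notin_maximal_ideal valO (line_step_small u).
Qed.

Hypotheses (eF : e \in F) (gF : forall i, g i \in F) (egO : forall i, e * g i \in O).

Lemma line_base_mem u : line_base u \in F.
Proof. by elim: u => [|[j|] u IHu] /=; mem_closed. Qed.

Lemma line_base_small u : line_base u \in m.
Proof.
elim: u => [|x u IHu]; first exact: maximal_ideal0.
have h := maximal_ideal_sub valO IHu.
by case: x => [j|] /=; apply: maximal_idealMr => //; apply: rpredD => //;
  rewrite ?rpred0.
Qed.

End Evaluation.

(** Letters index [G] and words are valued affinely, so combinatorial lines become progressions p +
    q g. The finite list [W] precedes the colouring, as [brauer_bounded] requires. *)
Lemma gallai (G : seq K) (e : K) (C : finType) : {subset G <= F} ->
  e \in F -> e != 0 -> {in G, forall g, e * g \in O} ->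
  exists W : seq (K * K),
    (forall p q, (p, q) \in W -> [/\ p \in F, q \in F, q != 0, p - 1 \in m & q / e \in m]) /\
    forall c : K -> C, exists p q, (p, q) \in W /\
      {in G &, forall g g', c (p + q * g) = c (p + q * g')}.
Proof.
move=> GF eF e0 eG; pose T := 'I_(size G); pose g (i : T) := tnth (in_tuple G) i.
have gG i : g i \in G by exact: mem_tnth.
have gF i : g i \in F by exact: GF.
have gO i : e * g i \in O by exact: eG.
have [n hn] := hales_jewett (enum T) C.
(* The constant 1 makes p a unit congruent to 1, and [e] scales the step so that q g lies in the
   maximal ideal. *)
pose pq (u : seq (option T)) := (1 + line_base g e u, e * line_step u).
exists [seq pq (val u) | u <- enum {: n.-tuple (option T)} & None \in val u]; split.
  move=> p q /mapP[u]; rewrite mem_filter => /andP[Nu _] [-> ->]; split.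
  - by have ? := line_base_mem eF gF u; mem_closed.
  - by have ? := line_step_mem u; mem_closed.
  - rewrite mulf_neq0 // line_step_neq0 //; apply/hasP; by exists None.
  - by rewrite addrC addKr; exact: line_base_small.
  - by rewrite mulrC mulKf // line_step_small.
move=> c; have [u [/andP[su Nu] hu]] := hn (fun w => c (1 + word_value g e w)).
exists (pq u).1, (pq u).2; split.
  apply/mapP; exists (Tuple su) => //.
  by rewrite mem_filter Nu mem_enum.
have h i : c ((pq u).1 + (pq u).2 * g i) = c (1 + word_value g e (subst_word u i)).
  by rewrite word_value_subst /= addrA.
move=> a b /seq_tnthP[i ->] /seq_tnthP[j ->].
by rewrite -/(g i) -/(g j) !h; apply: hu; rewrite mem_enum.
Qed.

(* Brauer's induction on the number of colours: when no multiple q d of the step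
   of a long monochromatic progression has its colour, the set q D uses one colour
   less. *)
Lemma brauer_bounded (E Z : seq K) (h : K) (C : finType) :
  {subset E <= F} -> {subset Z <= F} -> h \in F -> h != 0 -> forall k : nat,
  exists D : seq K, [/\ {subset D <= F}, 0 \notin D &
    forall (B : {set C}) (c : K -> C), (#|B| <= k)%N -> {in D, forall d, c d \in B} ->
    exists p q, [/\ p \in F, q \in F, p != 0 /\ q != 0,
      {in Z, forall z, z * (q / p) \in m} &
      {in E, forall e, c (p + q * e) = c (h * q)}]].
Proof.
move=> EF ZF hF h0; elim=> [|k [D [DF D0 hD]]].
  (* With no colour allowed, a nonempty [D] already contradicts the assumption on [c]. *)
  exists [:: 1]; split=> [x|//|B c]; rewrite ?inE ?(eq_sym 0) ?oner_eq0 //.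
    by move/eqP->; exact: rpred1.
  by rewrite leqn0 cards_eq0 => /eqP-> /(_ _ (mem_head _ _)); rewrite inE.
(* The final step will be q d / h, so that h times it is q d; the entry 0 puts p itself in the
   progression. *)
pose G := 0 :: [seq e * (d / h) | e <- E, d <- D].
have GF : {subset G <= F}.
  move=> x; rewrite inE => /predU1P[->|/allpairsP[[e d] /= [eE dD ->]]]; first exact: rpred0.
  by have ? := EF _ eE; have ? := DF _ dD; mem_closed.
(* The products with [Z] are scaled as well, to make z times the final step small compared with
   p. *)
pose S := G ++ [seq z * (d / h) | z <- Z, d <- D].
have SF : {subset S <= F}.
  move=> x; rewrite mem_cat => /orP[/GF//|/allpairsP[[e d] /= [eE dD ->]]].
  by have ? := ZF _ eE; have ? := DF _ dD; mem_closed.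
have [a [aF a0 aS]] := scale_into_valuation_ring valO SF.
have aG : {in G, forall g, a * g \in O} by move=> g gG; apply: aS; rewrite mem_cat gG.
have [W [hW cW]] := gallai C GF aF a0 aG.
exists (flatten [seq [seq w.1 + w.2 * g | g <- G] ++ [seq w.2 * d | d <- D] | w <- W]).
have pqg p q g : (p, q) \in W -> g \in G -> p + q * g != 0.
  move=> /hW[_ _ _ pm qm] gG.
  have /(add_one_notin_maximal_ideal valO)/unit_of_notin_maximal_ideal[+ _] : p - 1 + q * g \in m.
    apply: maximal_idealD => //; rewrite (_ : q * g = (q / a) * (a * g)); last by field.
    by apply: maximal_idealMr => //; exact: aG.
  by rewrite addrA addrCA subrr addr0.
split.
- move=> x /flattenP[_ /mapP[[p q] pqW ->]]; rewrite mem_cat.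
  have [pF qF _ _ _] := hW _ _ pqW.
  case/orP=> /mapP[y yG ->] /=; first by have ? := GF _ yG; mem_closed.
  by have ? := DF _ yG; mem_closed.
- apply/negP => /flattenP[_ /mapP[[p q] pqW ->]]; rewrite mem_cat.
  have [_ _ q0 _ _] := hW _ _ pqW.
  case/orP=> /mapP[y yG /eqP]; rewrite eq_sym /=; first by rewrite (negPf (pqg _ _ _ pqW yG)).
  by rewrite mulf_eq0 (negPf q0) /=; apply/negP; apply: contraNneq D0 => <-.
move=> B c Bk cB; have [p [q [pqW pqG]]] := cW c.
have [pF qF q0 pm qm] := hW _ _ pqW.
have inD x : x \in [seq p + q * g | g <- G] ++ [seq q * d | d <- D] -> c x \in B.
  move=> xD; apply: cB; apply/flattenP; eexists; last exact: xD.
  by apply/mapP; exists (p, q).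
have [p0 pO] : p != 0 /\ p^-1 \in O.
  apply: unit_of_notin_maximal_ideal; rewrite -(subrK 1 p) addrC.
  exact: add_one_notin_maximal_ideal.
have [/hasP[d dD /eqP cd]|/hasPn noD] := boolP (has (fun d => c (q * d) == c p) D).
  have d0 : d != 0 by apply: contraNneq D0 => <-.
  exists p, (q * (d / h)); split=> //.
  - by have ? := DF _ dD; mem_closed.
  - by rewrite !mulf_neq0 ?invr_neq0.
  - move=> z zZ.
    have -> : z * (q * (d / h) / p) = q / a * (a * (z * (d / h)) * p^-1).
      by field; rewrite a0 h0 p0.
    apply: maximal_idealMr => //; apply: rpredM => //; apply: aS.
    by rewrite mem_cat; apply/orP; right; apply/allpairsP; exists (z, d).
  move=> e eE; rewrite (_ : h * _ = q * d); last by field.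
  rewrite cd -{2}[p]addr0 -(mulr0 q) (_ : q * (d / h) * e = q * (e * (d / h))); last by ring.
  apply: pqG; last exact: mem_head.
  by rewrite inE; apply/orP; right; apply/allpairsP; exists (e, d).
have [||p' [q' [p'F q'F [p'0 q'0] hZ hE]]] := hD (B :\ c p) (fun x => c (q * x)).
- have cpB : c p \in B.
    by apply: inD; rewrite /= mulr0 addr0 mem_head.
  by move: Bk; rewrite (cardsD1 (c p) B) cpB.
- move=> d dD; rewrite !inE noD //=; apply: inD.
  by rewrite mem_cat; apply/orP; right; apply: map_f.
exists (q * p'), (q * q'); split; [by mem_closed|by mem_closed| | |].
- by rewrite !mulf_neq0.
- by move=> z /hZ; rewrite -mulf_div divff // mul1r.
- by move=> e /hE; rewrite mulrDr !mulrA [h * q]mulrC -!mulrA.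
Qed.

Lemma brauer (E Z : seq K) (h : K) (C : finType) (c : K -> C) :
  {subset E <= F} -> {subset Z <= F} -> h \in F -> h != 0 ->
  exists p q, [/\ p \in F, q \in F, p != 0 /\ q != 0,
    {in Z, forall z, z * (q / p) \in m} &
    {in E, forall e, c (p + q * e) = c (h * q)}].
Proof.
move=> EF ZF hF h0; have [D [_ _ hD]] := brauer_bounded C EF ZF hF h0 #|[set: C]%SET|.
by apply: (hD [set: C]%SET) => // d _; rewrite inE.
Qed.

End GallaiBrauer.

(** * Ideal classes of the coordinate ring *)

(* The pair (a, b) stands for a + b Y in K[X, Y] / (Y ^ 2 - f). *)
Definition coord_ring (K : fieldType) (f : {poly K}) : Type :=
  ({poly K} * {poly K})%type.

Section CoordinateRing.
Variables (K : fieldType) (f : {poly K}).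
Local Notation R := (coord_ring f).

HB.instance Definition _ := GRing.Zmodule.copy R ({poly K} * {poly K})%type.

Definition cr_one : R := (1, 0).
Definition cr_mul (p q : R) : R :=
  (p.1 * q.1 + p.2 * q.2 * f, p.1 * q.2 + p.2 * q.1).

Fact cr_mulA : associative cr_mul.
Proof. by move=> [a b] [c d] [e g]; congr (_, _) => /=; ring. Qed.
Fact cr_mulC : commutative cr_mul.
Proof. by move=> [a b] [c d]; congr (_, _) => /=; ring. Qed.
Fact cr_mul1 : left_id cr_one cr_mul.
Proof. by move=> [a b]; rewrite /cr_mul /=; congr (_, _); ring. Qed.
Fact cr_mulD : left_distributive cr_mul +%R.
Proof. by move=> [a b] [c d] [e g]; congr (_, _) => /=; ring. Qed.
Fact cr_one_neq0 : cr_one != 0.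
Proof. by apply/eqP => -[/eqP]; rewrite oner_eq0. Qed.

HB.instance Definition _ := GRing.Zmodule_isComNzRing.Build R
  cr_mulA cr_mulC cr_mul1 cr_mulD cr_one_neq0.

Lemma cr_mulE (p q : R) : p * q =
  (p.1 * q.1 + p.2 * q.2 * f, p.1 * q.2 + p.2 * q.1) :> {poly K} * {poly K}.
Proof. by []. Qed.

Definition cr_poly (p : {poly K}) : R := (p, 0).

Definition cr_norm (p : R) : {poly K} := p.1 ^+ 2 - p.2 ^+ 2 * f.

Lemma cr_normM p q : cr_norm (p * q) = cr_norm p * cr_norm q.
Proof. by rewrite /cr_norm cr_mulE /=; ring. Qed.

Hypothesis size_f : size f = 4%N.

(** The degree of a^2 is even and that of b^2 f is odd and at least 3, so the two terms cannot
    cancel. *)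
Lemma cr_norm_size (p : R) : p.2 != 0 -> (3 < size (cr_norm p))%N.
Proof.
case: p => a b /= b0; rewrite /cr_norm /=.
have f0 : f != 0 by rewrite -size_poly_eq0 size_f.
have sq (c : {poly K}) : c != 0 -> size (c ^+ 2) = ((size c).-1.*2).+1.
  move=> c0; have := size_exp c 2; rewrite muln2 => <-.
  by rewrite prednK // size_poly_gt0 expf_neq0.
have sb : size (b ^+ 2 * f) = ((size b).-1.*2 + 4)%N.
  rewrite size_proper_mul; last by rewrite mulf_neq0 ?lead_coef_eq0 ?expf_neq0.
  rewrite sq // size_f; lia.
have [->|a0] := eqVneq a 0.
  by rewrite expr0n sub0r size_polyN sb; lia.
have sa : size (a ^+ 2) = ((size a).-1.*2).+1 := sq _ a0.
have [lt|ge] := ltnP (size (a ^+ 2)) (size (b ^+ 2 * f)).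
  by rewrite addrC size_polyDl ?size_polyN // sb; lia.
rewrite size_polyDl ?size_polyN; last by rewrite ltn_neqAle ge andbT sa sb; lia.
by move: ge; rewrite sa sb; lia.
Qed.

Lemma cr_norm_eq0 p : cr_norm p = 0 -> p = 0.
Proof.
move=> np; have [b0|/cr_norm_size] := eqVneq p.2 0; last by rewrite np size_poly0.
case: p np b0 => a b; rewrite /cr_norm /= => + b0.
by rewrite b0 expr0n mul0r subr0 => /eqP; rewrite expf_eq0 /= => /eqP->.
Qed.

Lemma cr_integral (p q : R) : p * q = 0 -> p = 0 \/ q = 0.
Proof.
have n0 : cr_norm 0 = 0 by rewrite /cr_norm /= expr0n mul0r subr0.
move=> /(congr1 cr_norm); rewrite cr_normM n0.
by move/eqP; rewrite mulf_eq0 => /orP[]/eqP/cr_norm_eq0; [left|right].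
Qed.

Lemma cr_mulf_neq0 (p q : R) : p != 0 -> q != 0 -> p * q != 0.
Proof. by move=> /eqP p0 /eqP q0; apply/eqP => /cr_integral[]. Qed.

Lemma cr_mulfI (p : R) : p != 0 -> injective ( *%R p).
Proof.
move=> p0 q r /eqP; rewrite -subr_eq0 -mulrBr => /eqP /cr_integral[/eqP|/eqP].
  by rewrite (negPf p0).
by rewrite subr_eq0 => /eqP.
Qed.

Section Ideals.
Implicit Types (I J M : set R) (a b c d r x y : R).

Definition ideal I := [/\ I 0, forall x y, I x -> I y -> I (x + y) &
  forall r x, I x -> I (r * x)].

(** The ideal generated by the products, as an intersection instead of finite sums: inclusions need
    only be checked on products. *)
Definition ideal_mul I J : set R :=
  [set x | forall M, ideal M -> (forall i j, I i -> J j -> M (i * j)) -> M x].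

Definition ideal_scale a I : set R := [set a * x | x in I].

Definition ideal_gen2 a b : set R := [set r.1 * a + r.2 * b | r in [set: R * R]].

Lemma ideal_mul_ideal I J : ideal (ideal_mul I J).
Proof.
split=> [M idM _|x y xIJ yIJ M idM h|r x xIJ M idM h]; case: (idM) => M0 MD Mr.
- by [].
- by apply: MD; [exact: xIJ|exact: yIJ].
- by apply: Mr; exact: xIJ.
Qed.

Lemma ideal_mul_mem I J i j : I i -> J j -> ideal_mul I J (i * j).
Proof. by move=> Ii Jj M _; exact. Qed.

Lemma ideal_scale_ideal a I : ideal I -> ideal (ideal_scale a I).
Proof.
move=> [I0 ID Ir]; split.
- by exists 0 => //; rewrite mulr0.
- by move=> _ _ [x Ix <-] [y Iy <-]; exists (x + y); [exact: ID|rewrite mulrDr].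
- by move=> r _ [x Ix <-]; exists (r * x); [exact: Ir|rewrite mulrCA].
Qed.

Lemma ideal_gen2_ideal a b : ideal (ideal_gen2 a b).
Proof.
split.
- by exists (0, 0) => //=; ring.
- by move=> _ _ [[r s] _ <-] [[r' s'] _ <-]; exists (r + r', s + s') => //=; ring.
- by move=> c _ [[r s] _ <-]; exists (c * r, c * s) => //=; ring.
Qed.

Lemma ideal_gen2_l a b : ideal_gen2 a b a.
Proof. by exists (1, 0) => //=; ring. Qed.

Lemma ideal_gen2_r a b : ideal_gen2 a b b.
Proof. by exists (0, 1) => //=; ring. Qed.

Lemma ideal_gen2_sub a b I : ideal I -> I a -> I b -> ideal_gen2 a b `<=` I.
Proof. by move=> [I0 ID Ir] Ia Ib _ [[r s] _ <-]; apply: ID; exact: Ir. Qed.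

Lemma ideal_mul_gen2_sub a b c d I : ideal I ->
  I (a * c) -> I (a * d) -> I (b * c) -> I (b * d) ->
  ideal_mul (ideal_gen2 a b) (ideal_gen2 c d) `<=` I.
Proof.
move=> idI ac ad bc bd x; apply=> // _ _ [[r s] _ <-] [[r' s'] _ <-] /=.
case: idI => I0 ID Ir.
have -> : (r * a + s * b) * (r' * c + s' * d) = r * r' * (a * c) + r * s' * (a * d)
  + s * r' * (b * c) + s * s' * (b * d) by ring.
by apply: (ID); [apply: (ID); [apply: (ID)|]|]; exact: Ir.
Qed.

Lemma ideal_scale_sub a I J : ideal J -> (forall x, I x -> J (a * x)) ->
  ideal_scale a I `<=` J.
Proof. by move=> _ h _ [x Ix <-]; exact: h. Qed.

Lemma ideal_mulC I J : ideal_mul I J = ideal_mul J I.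
Proof.
by apply/seteqP; split=> x xIJ M idM h; apply: xIJ => // i j Ii Jj;
  rewrite mulrC; exact: h.
Qed.

(** Colon ideals let one factor vary while the others are fixed, so that inclusions of products can
    be tested on generators. *)
Lemma ideal_colon_ideal I (P : R -> Prop) :
  ideal I -> ideal [set x | forall y, P y -> I (x * y)].
Proof.
move=> [I0 ID Ir]; split=> [y Py|x x' h h' y Py|r x h y Py] /=.
- by rewrite mul0r.
- by rewrite mulrDl; apply: ID; [exact: h|exact: h'].
- by rewrite -mulrA; apply: Ir; exact: h.
Qed.

Lemma ideal_mulA_sub I J M :
  ideal_mul (ideal_mul I J) M `<=` ideal_mul I (ideal_mul J M).
Proof.
move=> x; apply; first exact: ideal_mul_ideal.
move=> i k IJi Mk.
apply: (IJi _ (ideal_colon_ideal M (ideal_mul_ideal I (ideal_mul J M)))) => // i' j Ii' Jj k' Mk'.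
by rewrite -mulrA; apply: ideal_mul_mem => //; exact: ideal_mul_mem.
Qed.

Lemma ideal_mulA I J M :
  ideal_mul I (ideal_mul J M) = ideal_mul (ideal_mul I J) M.
Proof.
apply/seteqP; split; last exact: ideal_mulA_sub.
rewrite ideal_mulC [X in _ `<=` X]ideal_mulC (ideal_mulC I J) (ideal_mulC J M).
exact: ideal_mulA_sub.
Qed.

Lemma ideal_mulT I : ideal I -> ideal_mul setT I = I.
Proof.
move=> idI; apply/seteqP; split=> x.
  by apply=> // r i _; case: idI => _ _; apply.
by move=> Ix; rewrite -[x]mul1r; exact: ideal_mul_mem.
Qed.

Lemma ideal_scaleA a b I : ideal_scale a (ideal_scale b I) = ideal_scale (a * b) I.
Proof.
apply/seteqP; split=> [_ [_ [x Ix <-] <-]|_ [x Ix <-]].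
  by exists x => //; rewrite mulrA.
by exists (b * x); [exists x|rewrite mulrA].
Qed.

Lemma ideal_mul_scale a I J :
  ideal_mul (ideal_scale a I) J = ideal_scale a (ideal_mul I J).
Proof.
apply/seteqP; split=> [x|_ [x xIJ <-]].
  apply; first exact/ideal_scale_ideal/ideal_mul_ideal.
  by move=> _ j [i Ii <-] Jj; exists (i * j); [exact: ideal_mul_mem|rewrite mulrA].
pose M := [set x | ideal_mul (ideal_scale a I) J (a * x)].
have idM : ideal M.
  have [I0 ID Ir] := ideal_mul_ideal (ideal_scale a I) J.
  split=> [|u v Mu Mv|r u Mu]; rewrite /M /=.
  - by rewrite mulr0.
  - by rewrite mulrDr; exact: ID.
  - by rewrite mulrCA; exact: Ir.
apply: (xIJ M idM) => i j Ii Jj; rewrite /M /= mulrA.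
by apply: ideal_mul_mem => //; exists i.
Qed.

(** Equality of ideal classes with denominators cleared, which avoids fractional ideals. *)
Definition ideal_equiv I J := exists a b,
  [/\ a != 0, b != 0 & ideal_scale a I = ideal_scale b J].

Lemma ideal_equiv_refl I : ideal_equiv I I.
Proof. by exists 1, 1; rewrite oner_neq0. Qed.

Lemma ideal_equiv_sym I J : ideal_equiv I J -> ideal_equiv J I.
Proof. by move=> [a [b [a0 b0 e]]]; exists b, a. Qed.

Lemma ideal_equiv_trans J I M :
  ideal_equiv I J -> ideal_equiv J M -> ideal_equiv I M.
Proof.
move=> [a [b [a0 b0 e]]] [c [d [c0 d0 e']]]; exists (c * a), (b * d).
by rewrite !cr_mulf_neq0 // -!ideal_scaleA e -e' !ideal_scaleA mulrC.
Qed.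

Lemma ideal_equiv_mul I I' J J' : ideal_equiv I I' -> ideal_equiv J J' ->
  ideal_equiv (ideal_mul I J) (ideal_mul I' J').
Proof.
have mull M M' N : ideal_equiv M M' -> ideal_equiv (ideal_mul M N) (ideal_mul M' N).
  by move=> [a [b [a0 b0 e]]]; exists a, b; rewrite -!ideal_mul_scale e.
move=> /(mull _ _ J) eI /(mull _ _ I') eJ; apply: ideal_equiv_trans eI _.
by rewrite ![ideal_mul I' _]ideal_mulC.
Qed.

Lemma ideal_equivT I : ideal I -> ideal_equiv I setT ->
  exists2 g, I g & I = ideal_scale g setT.
Proof.
move=> idI [a [b [a0 b0 e]]].
have [g Ig bE] : ideal_scale a I b by rewrite e; exists 1 => //; rewrite mulr1.
exists g => //; apply/seteqP; split=> [x Ix|_ [r _ <-]].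
  have : ideal_scale b setT (a * x) by rewrite -e; exists x.
  by move=> [r _]; rewrite -bE -mulrA => /(cr_mulfI a0) <-; exists r.
by rewrite mulrC; case: idI => _ _; apply.
Qed.

End Ideals.
End CoordinateRing.

(** * The group law on a curve in Legendre form *)

(* The curve y ^ 2 = x (x - a) (x - b). *)
Record legendre (K : fieldType) := Legendre {
  lg_a : K;
  lg_b : K;
  lg_char2 : 2 != 0 :> K;
  lg_a0 : lg_a != 0;
  lg_b0 : lg_b != 0;
  lg_ab : lg_a != lg_b
}.

Section LegendreCurve.
Variables (K : fieldType) (E : legendre K).
Local Notation a := (lg_a E).
Local Notation b := (lg_b E).

Definition lg_A : K := - (a + b).
Definition lg_B : K := a * b.
Local Notation A := lg_A.
Local Notation B := lg_B.

Definition lg_cubic (x : K) : K := x ^+ 3 + A * x ^+ 2 + B * x.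

Lemma lg_cubicE x : lg_cubic x = x * (x - a) * (x - b).
Proof. by rewrite /lg_cubic /lg_A /lg_B; ring. Qed.

Definition lg_weierstrass := Weierstrass 0 A 0 B 0.
Local Notation W := lg_weierstrass.

Lemma on_lgP x y : reflect (y ^+ 2 = lg_cubic x) (on_curve W (Some (x, y))).
Proof.
apply: (iffP eqP) => /=; first by rewrite !mul0r !addr0.
by rewrite !mul0r !addr0.
Qed.

Lemma lg_oppE x y : coord_opp W (Some (x, y)) = Some (x, - y).
Proof. by rewrite /= mul0r !subr0. Qed.

Definition lg_line (l x1 y1 x2 : K) : option (K * K) :=
  Some (l ^+ 2 - A - x1 - x2, - (l * (l ^+ 2 - A - x1 - x2 - x1) + y1)).

Lemma coord_lineE l x1 y1 x2 : coord_line W l x1 y1 x2 = lg_line l x1 y1 x2.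
Proof. by rewrite /coord_line lg_oppE /= mul0r addr0. Qed.

Lemma lg_add_chord x1 y1 x2 y2 : x1 != x2 ->
  coord_add W (Some (x1, y1)) (Some (x2, y2)) =
  lg_line ((y2 - y1) / (x2 - x1)) x1 y1 x2.
Proof. by move=> x12; rewrite /coord_add x12 coord_lineE. Qed.

Lemma lg_add_opp x y : coord_add W (Some (x, y)) (Some (x, - y)) = None.
Proof. by rewrite /coord_add eqxx /= mul0r !subr0 opprK eqxx. Qed.

Lemma lg_add_double x y : y != 0 ->
  coord_add W (Some (x, y)) (Some (x, y)) =
  lg_line ((3 * x ^+ 2 + 2 * A * x + B) / (2 * y)) x y x.
Proof.
move=> y0; rewrite /coord_add eqxx lg_oppE.
have -> : (Some (x, y) == Some (x, - y)) = false.
  apply/negP => /eqP[/eqP]; rewrite -subr_eq0 opprK -mulr2n -mulr_natl mulf_eq0.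
  by rewrite (negPf (lg_char2 E)) (negPf y0).
by rewrite /= coord_lineE; congr (lg_line (_ / _) _ _ _); ring.
Qed.

(** In [LgAddLine] chord and tangent obey the same division-free relations: the second is the
    divided difference of y^2 = f(x), and for x1 = x2 it reads 2 y1 l = f'(x1). *)
Variant lg_add_spec : option (K * K) -> option (K * K) -> option (K * K) -> Prop :=
| LgAdd0l Q : lg_add_spec None Q Q
| LgAdd0r P : lg_add_spec P None P
| LgAddOpp x y : lg_add_spec (Some (x, y)) (Some (x, - y)) None
| LgAddLine l x1 y1 x2 y2 of y2 = y1 + l * (x2 - x1)
    & l * (2 * y1 + l * (x2 - x1)) =
      x1 ^+ 2 + x1 * x2 + x2 ^+ 2 + A * (x1 + x2) + B
    & (x1 != x2) || (x1 == x2) && (y1 != 0) :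
    lg_add_spec (Some (x1, y1)) (Some (x2, y2)) (lg_line l x1 y1 x2).

Lemma lg_addP P Q : on_curve W P -> on_curve W Q ->
  lg_add_spec P Q (coord_add W P Q).
Proof.
case: P Q => [[x1 y1]|] [[x2 y2]|] => [/on_lgP c1 /on_lgP c2|_ _|_ _|_ _];
  [|exact: LgAdd0r|exact: LgAdd0l|exact: LgAdd0l].
have [x12|x12] := eqVneq x1 x2.
  rewrite -{}x12 in c2 *.
  have : (y2 - y1) * (y2 + y1) = 0.
    have -> : (y2 - y1) * (y2 + y1) = y2 ^+ 2 - y1 ^+ 2 by ring.
    by rewrite c1 c2 subrr.
  move/eqP; rewrite mulf_eq0 subr_eq0 addr_eq0 => /orP[]/eqP->; last first.
    by rewrite lg_add_opp; exact: LgAddOpp.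
  have [y0|y0] := eqVneq y1 0.
    rewrite {}y0; have := lg_add_opp x1 0; rewrite oppr0 => ->.
    by rewrite -{2}oppr0; exact: LgAddOpp.
  rewrite lg_add_double //; apply: LgAddLine.
  - by rewrite subrr mulr0 addr0.
  - by field; rewrite y0 lg_char2.
  - by rewrite eqxx y0.
rewrite lg_add_chord //; have d : x2 - x1 != 0 by rewrite subr_eq0 eq_sym.
apply: LgAddLine; rewrite ?x12 //; first by field.
apply: (mulfI d); rewrite divfK //.
have -> : (x2 - x1) * ((y2 - y1) / (x2 - x1) * (2 * y1 + (y2 - y1))) = y2 ^+ 2 - y1 ^+ 2.
  by field.
by rewrite c1 c2 /lg_cubic; ring.
Qed.

Definition lg_poly : {poly K} := 'X * ('X - a%:P) * ('X - b%:P).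
Local Notation f := lg_poly.
Local Notation R := (coord_ring f).

Lemma size_lg_poly : size f = 4%N.
Proof. by rewrite /lg_poly !size_mul ?mulf_neq0 ?polyX_eq0 ?polyXsubC_eq0 // size_polyX !size_XsubC. Qed.

Lemma lg_polyE : f = 'X ^+ 3 + A%:P * 'X ^+ 2 + B%:P * 'X.
Proof. by rewrite /lg_poly /lg_A /lg_B polyCN polyCD polyCM; ring. Qed.

(** The functions that vanish at the point. Its class corresponds to the divisor class of (P) - (O),
    whence the unit ideal at infinity. *)
Definition point_ideal (P : option (K * K)) : set R :=
  if P is Some (x, y) then
    ideal_gen2 (cr_poly f ('X - x%:P)) ((- y%:P, 1) : R)
  else setT.

Lemma idealT : ideal (setT : set R).
Proof. by []. Qed.

Lemma ideal_gen2_addr (p q r : R) : ideal_gen2 p (q + r * p) = ideal_gen2 p q.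
Proof.
apply/seteqP; split; apply: ideal_gen2_sub; try exact: ideal_gen2_ideal; try exact: ideal_gen2_l.
  by exists (r, 1) => //=; ring.
by exists (- r, 1) => //=; ring.
Qed.

Local Notation "p %:R_" := (cr_poly f p) (at level 2).

Section Line.
Variables (x1 y1 x2 l : K).
Let y2 := y1 + l * (x2 - x1).
Let x3 := l ^+ 2 - A - x1 - x2.
Hypotheses (c1 : y1 ^+ 2 = lg_cubic x1)
  (slope : l * (2 * y1 + l * (x2 - x1)) =
      x1 ^+ 2 + x1 * x2 + x2 ^+ 2 + A * (x1 + x2) + B)
  (generic : (x1 != x2) || (x1 == x2) && (y1 != 0)).
Let L : {poly K} := l%:P * ('X - x1%:P) + y1%:P.
Let u := ('X - x1%:P)%:R_.
Let v := ('X - x2%:P)%:R_.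
Let w := ('X - x3%:P)%:R_.
Let g : R := (- L, 1).
Let h : R := (L, 1).

(** The abscissas of the intersection with the line Y = L are the roots of the monic cubic f - L^2;
    the third one is read off its second coefficient. *)
Lemma line_poly_identity :
  f = L ^+ 2 + ('X - x1%:P) * ('X - x2%:P) * ('X - x3%:P).
Proof.
have BE : B = l * (2 * y1 + l * (x2 - x1)) -
    (x1 ^+ 2 + x1 * x2 + x2 ^+ 2 + A * (x1 + x2)) by rewrite slope; ring.
have yE : y1 * y1 - lg_cubic x1 = 0 by rewrite -c1; ring.
apply/subr0_eq; transitivity ((lg_cubic x1 - y1 * y1)%:P); last first.
  by rewrite -opprB yE oppr0.
rewrite lg_polyE /lg_cubic BE /L /x3.
rewrite !(polyCD, polyCN, polyCM, polyCB, polyC_exp, polyC_natr); ring.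
Qed.

Lemma line_mul : g * h = u * v * w.
Proof.
by congr (_, _); rewrite /= ?line_poly_identity; ring.
Qed.

Lemma point_ideal_line1 : point_ideal (Some (x1, y1)) = ideal_gen2 u g.
Proof.
rewrite /point_ideal -/u -(ideal_gen2_addr u _ (- l%:P)%:R_); congr (ideal_gen2 _ _).
by congr (_, _); rewrite /L /=; ring.
Qed.

Lemma point_ideal_line2 : point_ideal (Some (x2, y2)) = ideal_gen2 v g.
Proof.
rewrite /point_ideal -/v -(ideal_gen2_addr v _ (- l%:P)%:R_); congr (ideal_gen2 _ _).
by congr (_, _); rewrite /L /y2 ?(polyCD, polyCM, polyCB) /=; ring.
Qed.

(** The sum is the reflection of the third intersection point, hence lies on Y = -L, the zero set of
    [h]. *)
Lemma point_ideal_line3 : point_ideal (lg_line l x1 y1 x2) = ideal_gen2 w h.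
Proof.
have key z : ideal_gen2 ('X - z%:P)%:R_ ((- (- (l * (z - x1) + y1))%:P, 1) : R) =
    ideal_gen2 ('X - z%:P)%:R_ h.
  rewrite -(ideal_gen2_addr _ _ (l%:P)%:R_); congr (ideal_gen2 _ _).
  by congr (_, _); rewrite /L ?(polyCN, polyCD, polyCM, polyCB) /=; ring.
exact: key.
Qed.

(** For a chord, (x2 - x1) g = u g - g v. For a tangent, 2 y1 g is recovered from g h = u v w, since
    h = g + 2 L and L is y1 plus a multiple of u. *)
Lemma line_mem : ideal_mul (ideal_gen2 u g) (ideal_gen2 v g) g.
Proof.
have [I0 ID Ir] := ideal_mul_ideal (ideal_gen2 u g) (ideal_gen2 v g).
have ug : ideal_mul (ideal_gen2 u g) (ideal_gen2 v g) (u * g).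
  by apply: ideal_mul_mem; [exact: ideal_gen2_l|exact: ideal_gen2_r].
have gv : ideal_mul (ideal_gen2 u g) (ideal_gen2 v g) (g * v).
  by apply: ideal_mul_mem; [exact: ideal_gen2_r|exact: ideal_gen2_l].
have gg : ideal_mul (ideal_gen2 u g) (ideal_gen2 v g) (g * g).
  by apply: ideal_mul_mem; [exact: ideal_gen2_r|exact: ideal_gen2_r].
have uv : ideal_mul (ideal_gen2 u g) (ideal_gen2 v g) (u * v).
  by apply: ideal_mul_mem; [exact: ideal_gen2_l|exact: ideal_gen2_l].
have constK (c : K) (r : R) : c != 0 ->
    ideal_mul (ideal_gen2 u g) (ideal_gen2 v g) (c%:P%:R_ * r) ->
    ideal_mul (ideal_gen2 u g) (ideal_gen2 v g) r.
  move=> c0 /(Ir (c^-1%:P)%:R_); rewrite mulrA.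
  have -> : (c^-1%:P)%:R_ * c%:P%:R_ = 1.
    by congr (_, _); rewrite /= -?polyCM ?mulVf //; ring.
  by rewrite mul1r.
have [x12|/negPn/eqP x12] := boolP (x1 != x2).
  apply: (constK (x2 - x1)); first by rewrite subr_eq0 eq_sym.
  have -> : (x2 - x1)%:P%:R_ * g = u * g + (-1) * (g * v).
    by congr (_, _); rewrite /= ?polyCB; ring.
  by apply: (ID) => //; exact: Ir.
have y0 : y1 != 0 by move: generic; rewrite x12 eqxx.
apply: (constK (2 * y1)); first by rewrite mulf_neq0 // lg_char2.
have -> : (2 * y1)%:P%:R_ * g =
    w * (u * v) + (-1) * (g * g) + (- (2 * l%:P))%:R_ * (u * g).
  have -> : w * (u * v) = g * h by rewrite line_mul mulrC.
  have -> : h = g + (2 * L)%:R_ by congr (_, _); rewrite /=; ring.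
  by congr (_, _); rewrite /= /L polyCM polyC_natr; ring.
by apply: (ID); [apply: (ID)|]; exact: Ir.
Qed.

(** As divisors, [g] cuts out P, Q and -(P + Q), and [w] cuts out P + Q and its opposite. Hence w
    times the product of the ideals of P and Q is g times the ideal of P + Q. *)
Lemma line_ideal_equiv : ideal_equiv
  (ideal_mul (point_ideal (Some (x1, y1))) (point_ideal (Some (x2, y2))))
  (point_ideal (lg_line l x1 y1 x2)).
Proof.
exists w, g; split.
- by apply/eqP => -[/eqP]; rewrite polyXsubC_eq0.
- by apply/eqP => -[_ /eqP]; rewrite oner_eq0.
rewrite point_ideal_line1 point_ideal_line2 point_ideal_line3.
have idI := ideal_mul_ideal (ideal_gen2 u g) (ideal_gen2 v g).
have idJ := ideal_gen2_ideal w h.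
apply/seteqP; split; apply: ideal_scale_sub; try exact: ideal_scale_ideal.
  have sub : ideal_mul (ideal_gen2 u g) (ideal_gen2 v g) `<=`
      [set x | forall y, y = w -> ideal_scale g (ideal_gen2 w h) (x * y)].
    have gw r : ideal_scale g (ideal_gen2 w h) (g * (r * w)).
      by exists (r * w) => //; case: idJ => _ _; apply; exact: ideal_gen2_l.
    apply: ideal_mul_gen2_sub.
    - exact: (ideal_colon_ideal (fun y => y = w) (ideal_scale_ideal g idJ)).
    - move=> _ ->; rewrite -line_mul; exists h => //; exact: ideal_gen2_r.
    - by move=> _ ->; rewrite -mulrA mulrCA; exact: gw.
    - by move=> _ ->; rewrite -mulrA; exact: gw.
    - by move=> _ ->; rewrite -mulrA; exact: gw.
  by move=> x /sub/(_ _ erefl); rewrite mulrC.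
have sub : ideal_gen2 w h `<=` [set x | forall y, y = g ->
    ideal_scale w (ideal_mul (ideal_gen2 u g) (ideal_gen2 v g)) (x * y)].
  apply: ideal_gen2_sub.
  - exact: (ideal_colon_ideal (fun y => y = g) (ideal_scale_ideal w idI)).
  - by move=> _ ->; exists g => //; exact: line_mem.
  - move=> _ ->; exists (u * v); last by rewrite [h * g]mulrC line_mul mulrC.
    by apply: ideal_mul_mem; exact: ideal_gen2_l.
by move=> x /sub/(_ _ erefl); rewrite mulrC.
Qed.

End Line.

Lemma point_ideal_ideal P : ideal (point_ideal P).
Proof. by case: P => [[x y]|]; [exact: ideal_gen2_ideal|exact: idealT]. Qed.

Lemma lg_cubic_deriv x : lg_cubic x = 0 -> 3 * x ^+ 2 + 2 * A * x + B != 0.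
Proof.
have ab0 : a - b != 0 by rewrite subr_eq0 lg_ab.
have ba0 : b - a != 0 by rewrite subr_eq0 eq_sym lg_ab.
move/eqP; rewrite lg_cubicE !mulf_eq0 !subr_eq0 -orbA => /or3P[]/eqP->.
- rewrite (_ : _ + B = a * b); last by rewrite /lg_A /lg_B; ring.
  by rewrite mulf_neq0 ?lg_a0 ?lg_b0.
- rewrite (_ : _ + B = a * (a - b)); last by rewrite /lg_A /lg_B; ring.
  by rewrite mulf_neq0 ?lg_a0.
- rewrite (_ : _ + B = b * (b - a)); last by rewrite /lg_A /lg_B; ring.
  by rewrite mulf_neq0 ?lg_b0.
Qed.

Section Opposite.
Variables (x y : K).
Hypothesis c : y ^+ 2 = lg_cubic x.
Let u := ('X - x%:P)%:R_.
Let q : R := (- y%:P, 1).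
Let q' : R := (y%:P, 1).
Let k : {poly K} := 'X ^+ 2 + (x + A)%:P * 'X + (x ^+ 2 + A * x + B)%:P.
Let k' : {poly K} := 'X + (2 * x + A)%:P.

Lemma opp_mul : q * q' = u * k%:R_.
Proof.
congr (_, _); rewrite /=; last ring.
have yE : y%:P * y%:P = (lg_cubic x)%:P :> {poly K} by rewrite -polyCM -expr2 c.
apply/subr0_eq; transitivity ((lg_cubic x)%:P - y%:P * y%:P); last by rewrite yE subrr.
rewrite lg_polyE /k /lg_cubic !(polyCD, polyCM, polyC_exp); ring.
Qed.

(** The product is the principal ideal of X - x. It contains 2 y u, and for y = 0 it contains f'(x)
    u, where f'(x) is nonzero because f has simple roots. *)
Lemma opp_ideal_equiv : ideal_equiv
  (ideal_mul (point_ideal (Some (x, y))) (point_ideal (Some (x, - y)))) setT.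
Proof.
have u0 : u != 0 by apply/eqP => -[/eqP]; rewrite polyXsubC_eq0.
exists 1, u; rewrite oner_neq0 u0; split=> //.
rewrite (_ : ideal_scale 1 _ = ideal_mul (ideal_gen2 u q) (ideal_gen2 u q')); last first.
  rewrite /point_ideal polyCN opprK -/q -/q' -/u.
  apply/seteqP; split=> [_ [r Ir <-]|r Ir]; first by rewrite mul1r.
  by exists r => //; rewrite mul1r.
apply/seteqP; split.
  apply: ideal_mul_gen2_sub; first exact/ideal_scale_ideal/idealT.
  - by exists u.
  - by exists q'.
  - by exists q => //; rewrite mulrC.
  - by rewrite opp_mul; exists k%:R_.
have [I0 ID Ir] := ideal_mul_ideal (ideal_gen2 u q) (ideal_gen2 u q').
suff uI : ideal_mul (ideal_gen2 u q) (ideal_gen2 u q') u.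
  by move=> _ [r _ <-]; rewrite mulrC; exact: Ir.
have uu : ideal_mul (ideal_gen2 u q) (ideal_gen2 u q') (u * u).
  by apply: ideal_mul_mem; exact: ideal_gen2_l.
have uq' : ideal_mul (ideal_gen2 u q) (ideal_gen2 u q') (u * q').
  by apply: ideal_mul_mem; [exact: ideal_gen2_l|exact: ideal_gen2_r].
have qu : ideal_mul (ideal_gen2 u q) (ideal_gen2 u q') (q * u).
  by apply: ideal_mul_mem; [exact: ideal_gen2_r|exact: ideal_gen2_l].
have qq' : ideal_mul (ideal_gen2 u q) (ideal_gen2 u q') (q * q').
  by apply: ideal_mul_mem; exact: ideal_gen2_r.
have constK (e : K) (r : R) : e != 0 ->
    ideal_mul (ideal_gen2 u q) (ideal_gen2 u q') (e%:P%:R_ * r) ->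
    ideal_mul (ideal_gen2 u q) (ideal_gen2 u q') r.
  move=> e0 /(Ir (e^-1%:P)%:R_); rewrite mulrA.
  have -> : (e^-1%:P)%:R_ * e%:P%:R_ = 1.
    by congr (_, _); rewrite /= -?polyCM ?mulVf //; ring.
  by rewrite mul1r.
have [y0|y0] := eqVneq y 0.
  apply: (constK (3 * x ^+ 2 + 2 * A * x + B)).
    by apply: lg_cubic_deriv; rewrite -c y0 expr0n.
  have -> : (3 * x ^+ 2 + 2 * A * x + B)%:P%:R_ * u =
      q * q' + (- k')%:R_ * (u * u).
    rewrite opp_mul; congr (_, _); rewrite /= /k /k' ?(polyCD, polyCM, polyC_exp, polyC_natr); ring.
  by apply: (ID) => //; exact: Ir.
apply: (constK (2 * y)); first by rewrite mulf_neq0 // lg_char2.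
have -> : (2 * y)%:P%:R_ * u = u * q' + (-1) * (q * u).
  by congr (_, _); rewrite /= polyCM polyC_natr; ring.
by apply: (ID) => //; exact: Ir.
Qed.

(** The norm of a generator divides (X - x)^2, so by [cr_norm_size] the generator is a polynomial in
    X. It vanishes at x, and so cannot divide Y - y, whose coefficient of Y is 1. *)
Lemma point_ideal_not_principal :
  ~ ideal_equiv (point_ideal (Some (x, y))) setT.
Proof.
have ev (r : R) : point_ideal (Some (x, y)) r -> r.1.[x] + r.2.[x] * y = 0.
  move=> [[s s'] _ <-] /=; rewrite !hornerE /=.
  transitivity (s'.2.[x] * (lg_cubic x - y * y)); first by rewrite lg_cubicE; ring.
  by rewrite -c; ring.
case/(ideal_equivT size_lg_poly (point_ideal_ideal _)) => g /ev gx Ig.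
have [r _ gr] : ideal_scale g setT u by rewrite -Ig; exact: ideal_gen2_l.
have [s _ gs] : ideal_scale g setT q by rewrite -Ig; exact: ideal_gen2_r.
have nu : cr_norm u = ('X - x%:P) ^+ 2 by rewrite /cr_norm /= expr0n mul0r subr0.
have u0 : u != 0 by apply/eqP => -[/eqP]; rewrite polyXsubC_eq0.
have g2 : g.2 = 0.
  apply: contraTeq isT => /(cr_norm_size size_lg_poly) sg.
  have : cr_norm g %| cr_norm u by rewrite -gr cr_normM dvdp_mulr.
  move/dvdp_leq; rewrite nu expf_neq0 ?polyXsubC_eq0 // => /(_ isT).
  by rewrite size_exp_XsubC => h; have := leq_trans sg h.
have /eqP := congr1 (fun r : R => (r.2).[x]) gs.
move: gx; rewrite g2 horner0 mul0r addr0 => gx.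
by rewrite /= g2 mul0r addr0 hornerM gx mul0r hornerC eq_sym oner_eq0.
Qed.

End Opposite.

Lemma point_ideal_add P Q : on_curve W P -> on_curve W Q ->
  ideal_equiv (ideal_mul (point_ideal P) (point_ideal Q))
    (point_ideal (coord_add W P Q)).
Proof.
move=> cP cQ; move: (lg_addP cP cQ) => s; case: s cP cQ => {P Q}.
- move=> Q _ _; rewrite ideal_mulT; first exact: ideal_equiv_refl.
  exact: point_ideal_ideal.
- move=> P _ _; rewrite ideal_mulC ideal_mulT; first exact: ideal_equiv_refl.
  exact: point_ideal_ideal.
- by move=> x y /on_lgP c _; exact: opp_ideal_equiv.
- move=> l x1 y1 x2 y2 -> slope generic /on_lgP c1 _.
  exact: line_ideal_equiv.
Qed.

Lemma lg_add_eq0 P Q : on_curve W P -> on_curve W Q ->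
  coord_add W P (coord_opp W Q) = None -> P = Q.
Proof.
case: Q => [[x y]|] cP cQ; last by case: P cP => [[x y]|].
have := lg_addP cP (on_curve_opp cQ); rewrite lg_oppE => s e.
by rewrite e in s; inversion s; congr (Some (_, _)); apply: oppr_inj.
Qed.

(** The class of P - Q is trivial and no affine point has trivial class, so P - Q is infinity. This
    injectivity carries associativity from ideals over to points. *)
Lemma point_ideal_inj P Q : on_curve W P -> on_curve W Q ->
  ideal_equiv (point_ideal P) (point_ideal Q) -> P = Q.
Proof.
move=> cP cQ ePQ; apply: lg_add_eq0 => //.
have cQ' := on_curve_opp cQ.
have QQ : coord_add W Q (coord_opp W Q) = None.
  by case: Q {cP cQ cQ' ePQ} => [[x y]|] //; rewrite lg_oppE lg_add_opp.
have e : ideal_equiv (point_ideal (coord_add W P (coord_opp W Q))) setT.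
  apply: ideal_equiv_trans (size_lg_poly) _ _ _ _ _.
    apply: ideal_equiv_sym; exact: point_ideal_add.
  apply: ideal_equiv_trans (size_lg_poly) _ _ _ _ _.
    apply: ideal_equiv_mul ePQ (ideal_equiv_refl _); exact: size_lg_poly.
  by have := point_ideal_add cQ cQ'; rewrite QQ.
case: (coord_add _ _ _) (on_curve_add cP cQ') e => [[x y]|//] /on_lgP c.
by move/(point_ideal_not_principal c).
Qed.

End LegendreCurve.

Definition lpoint (K : fieldType) (E : legendre K) : Type :=
  {P : option (K * K) | on_curve (lg_weierstrass E) P}.

Section LegendreGroup.
Variables (K : fieldType) (E : legendre K).
Local Notation W := (lg_weierstrass E).
Implicit Types (P Q : lpoint E).

HB.instance Definition _ := Choice.on (lpoint E).

Definition lp_zero : lpoint E := exist _ None isT.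
Definition lp_opp P : lpoint E := exist _ (coord_opp W (val P)) (on_curve_opp (valP P)).
Definition lp_add P Q : lpoint E :=
  exist _ (coord_add W (val P) (val Q)) (on_curve_add (valP P) (valP Q)).

Lemma lp_ideal_add P Q : ideal_equiv
  (point_ideal (E := E) (val (lp_add P Q)))
  (ideal_mul (point_ideal (E := E) (val P)) (point_ideal (E := E) (val Q))).
Proof. exact/ideal_equiv_sym/point_ideal_add/valP/valP. Qed.

Fact lp_addC : commutative lp_add.
Proof.
move=> P Q; apply/val_inj/(point_ideal_inj (valP _) (valP _)).
apply: ideal_equiv_trans (size_lg_poly E) _ _ _ (lp_ideal_add P Q) _.
by rewrite ideal_mulC; exact/ideal_equiv_sym/lp_ideal_add.
Qed.

Fact lp_addA : associative lp_add.
Proof.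
move=> P Q S; apply/val_inj/(point_ideal_inj (valP _) (valP _)).
apply: ideal_equiv_trans (size_lg_poly E) _ _ _ (lp_ideal_add _ _) _.
apply: ideal_equiv_trans (size_lg_poly E) _ _ _
  (ideal_equiv_mul (size_lg_poly E) (ideal_equiv_refl _) (lp_ideal_add _ _)) _.
rewrite ideal_mulA; apply: ideal_equiv_sym.
apply: ideal_equiv_trans (size_lg_poly E) _ _ _ (lp_ideal_add _ _) _.
apply: (ideal_equiv_mul (size_lg_poly E)); [exact: lp_ideal_add|exact: ideal_equiv_refl].
Qed.

Fact lp_add0 : left_id lp_zero lp_add.
Proof. by move=> P; exact: val_inj. Qed.

Fact lp_addN : left_inverse lp_zero lp_opp lp_add.
Proof.
move=> P; rewrite lp_addC; apply: val_inj; case: P => -[[x y]|] c //.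
have : coord_add W (Some (x, y)) (coord_opp W (Some (x, y))) = None.
  by rewrite lg_oppE lg_add_opp.
exact.
Qed.

HB.instance Definition _ := GRing.isZmodule.Build (lpoint E)
  lp_addA lp_addC lp_add0 lp_addN.

Lemma val_lpD P Q : val (P + Q) = coord_add W (val P) (val Q).
Proof. by []. Qed.

Lemma val_lpN P : val (- P) = coord_opp W (val P).
Proof. by []. Qed.

Lemma lp_eq0 P : (P == 0) = (val P == None).
Proof. by []. Qed.

End LegendreGroup.

(** * Finiteness of odd torsion *)

Lemma poly_roots_seq (K : fieldType) (s : {poly K}) : s != 0 ->
  exists rs : seq K, forall x, root s x -> x \in rs.
Proof.
have [n] := ubnP (size s); elim: n s => // n IHn s /ltnSE sn s0.
have [[x /factor_theorem[q sE]]|no] := pselect (exists x, root s x); last first.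
  by exists [::] => x sx; case: no; exists x.
have q0 : q != 0 by apply: contraNneq s0 => q0; rewrite sE q0 mul0r.
have [|rs hrs] := IHn q _ q0.
  by apply: leq_trans sn; rewrite sE size_Mmonic ?monicXsubC // size_XsubC addn2.
exists (x :: rs) => y; rewrite sE rootM root_XsubC inE orbC.
by case/orP=> [->//|/hrs->]; rewrite orbT.
Qed.

Section FiniteTorsion.
Variables (K : fieldType) (E : legendre K).
Local Notation A := (lg_A E).
Local Notation B := (lg_B E).
Local Notation W := (lg_weierstrass E).
Implicit Types (P Q : lpoint E).

Lemma lpoint_eqn P x y : val P = Some (x, y) -> y ^+ 2 = lg_cubic E x.
Proof. by case: P => Q c /= QE; apply/on_lgP; rewrite -QE. Qed.

Lemma finite_points_over (s : {poly K}) : s != 0 ->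
  exists l : seq (lpoint E), forall P x y, val P = Some (x, y) -> root s x -> P \in l.
Proof.
move=> /poly_roots_seq[rs hrs].
pose g : {poly K} := \prod_(x <- rs) ('X ^+ 2 - (lg_cubic E x)%:P).
have [|ys hys] := @poly_roots_seq _ g.
  rewrite prodf_seq_neq0; apply/allP => x _ /=.
  by rewrite -size_poly_eq0 size_XnsubC.
exists (pmap insub [seq Some (x, y) | x <- rs, y <- ys]) => P x y PE /hrs xrs.
rewrite mem_pmap_sub PE; apply/allpairsP; exists (x, y); split=> //=; apply: hys.
rewrite /root /g horner_prod prodf_seq_eq0; apply/hasP; exists x => //=.
by rewrite !hornerE (lpoint_eqn PE) subrr.
Qed.

Fact on_lg_T : on_curve W (Some (0, 0)).
Proof. by apply/on_lgP; rewrite lg_cubicE !mul0r expr0n. Qed.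

(** Every odd multiple of this point is the point itself, which shows that multiplication by an odd
    number is not identically 0. *)
Definition lg_T : lpoint E := exist _ (Some (0, 0)) on_lg_T.

Lemma lg_T2 : lg_T *+ 2 = 0.
Proof.
apply: val_inj; rewrite mulr2n val_lpD.
by have := lg_add_opp E 0 0; rewrite oppr0 => h; exact: h.
Qed.

Lemma lg_T_odd n : odd n -> lg_T *+ n = lg_T.
Proof.
move=> on; rewrite -(odd_double_half n) on -mul2n mulrnDr mulrnA lg_T2.
by rewrite mul0rn addr0.
Qed.

(* Off the roots of s, the x-coordinate and the quotient of the y-coordinates of
   n P and P are rational functions of the x-coordinate of P. *)
Definition generic_multiple n (s a c d : {poly K}) :=
  forall P x y, val P = Some (x, y) -> s.[x] != 0 ->
    d.[x] != 0 /\ val (P *+ n) = Some (a.[x] / d.[x], y * (c.[x] / d.[x])).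

Definition generic_zero n (s : {poly K}) :=
  forall P x y, val P = Some (x, y) -> s.[x] != 0 -> P *+ n = 0.

(** The square of the slope involves y only through y^2 = f(x), so the line construction preserves
    the shape of [generic_multiple]. *)
Lemma generic_line n (s a c d g h : {poly K}) :
  (forall P x y, val P = Some (x, y) -> s.[x] != 0 -> [/\ d.[x] != 0, h.[x] != 0 &
    val (P *+ n.+1) = lg_line E (y * (g.[x] / h.[x])) x y (a.[x] / d.[x])]) ->
  exists a' c' d', generic_multiple n.+1 s a' c' d'.
Proof.
have [f fE] : exists f : {poly K}, forall x, f.[x] = lg_cubic E x.
  by exists (lg_poly E) => x; rewrite lg_cubicE /lg_poly !hornerE.
move=> hyp; pose u : {poly K} := f * g ^+ 2 * d - (A%:P + 'X) * h ^+ 2 * d - a * h ^+ 2.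
exists (u * h), (- (g * (u - 'X * h ^+ 2 * d) + h ^+ 3 * d)), (h ^+ 3 * d).
move=> P x y PE sx; have [dx hx ->] := hyp P x y PE sx.
have fx : f.[x] = y ^+ 2 by rewrite (lpoint_eqn PE).
have ux : u.[x] = y ^+ 2 * g.[x] ^+ 2 * d.[x] - (A + x) * h.[x] ^+ 2 * d.[x]
    - a.[x] * h.[x] ^+ 2.
  by rewrite /u !(hornerD, hornerN, hornerM, horner_exp, hornerC, hornerX) fx.
clearbody u; rewrite !(hornerD, hornerN, hornerM, horner_exp, hornerX) ux.
split; first by rewrite ?(mulf_neq0, expf_neq0).
by congr (Some (_, _)); field; rewrite dx hx.
Qed.

(** Induction adding P to n P. If a - X d is nonzero, the chord is generic. Otherwise n P has the
    abscissa of P, and c = d or c = -d means that generically n P is P or -P. Exceptional abscissas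
    become roots of [s]. *)
Lemma generic_dichotomy n : exists s : {poly K}, s != 0 /\
  (generic_zero n s \/ exists a c d, generic_multiple n s a c d).
Proof.
elim: n => [|n [s [s0 [hs|[a [c [d hs]]]]]]].
- by exists 1; rewrite oner_neq0; split=> //; left=> P x y _ _; rewrite mulr0n.
- exists s; split=> //; right; exists 'X, 1, 1 => P x y PE sx.
  split; first by rewrite hornerC oner_neq0.
  by rewrite mulrS (hs _ _ _ PE sx) addr0 PE hornerX !hornerC !divr1 mulr1.
pose D := a - 'X * d.
have [D0|D0] := eqVneq D 0; last first.
  exists (s * D); rewrite mulf_neq0 //; split=> //; right.
  apply: (@generic_line n (s * D) a c d (c - d) D) => P x y PE.
  rewrite hornerM mulf_eq0 negb_or => /andP[sx Dx].
  have [dx nP] := hs _ _ _ PE sx; split=> //.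
  rewrite mulrS val_lpD nP PE.
  have DxE : D.[x] = a.[x] - x * d.[x] by rewrite hornerD hornerN hornerM hornerX.
  have nz : a.[x] / d.[x] - x != 0.
    apply: contra_neq Dx => h; rewrite DxE -[RHS](mul0r d.[x]) -h; field.
    exact: dx.
  rewrite lg_add_chord; last by rewrite eq_sym -subr_eq0.
  rewrite DxE in Dx *.
  by congr lg_line; rewrite hornerD hornerN; field; rewrite Dx dx.
have [f [f0 fE]] : exists f : {poly K}, f != 0 /\ forall x, f.[x] = lg_cubic E x.
  exists (lg_poly E); split=> [|x]; last by rewrite lg_cubicE /lg_poly !hornerE.
  by rewrite -size_poly_eq0 size_lg_poly.
have fx P x y : val P = Some (x, y) -> f.[x] = y ^+ 2.
  by move=> PE; rewrite (lpoint_eqn PE).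
have yE P x y : val P = Some (x, y) -> s.[x] != 0 -> d.[x] != 0 /\
    val (P *+ n) = Some (x, y * (c.[x] / d.[x])).
  move=> PE sx; have [dx ->] := hs _ _ _ PE sx; split=> //; congr (Some (_, _)).
  have := congr1 (horner^~ x) D0; rewrite !hornerE /= => /subr0_eq->.
  by rewrite mulfK.
have [cd|cd] := eqVneq c d.
  pose g : {poly K} := 3 *: 'X ^+ 2 + (2 * A) *: 'X + B%:P.
  exists (s * f); rewrite mulf_neq0 //; split=> //; right.
  apply: (@generic_line n (s * f) 'X c 1 g (2 *: f)) => P x y PE.
  rewrite hornerM (fx _ _ _ PE) mulf_eq0 negb_or => /andP[sx y2].
  have y0 : y != 0 by apply: contraNneq y2 => ->; rewrite expr0n.
  have [dx nP] := yE _ _ _ PE sx.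
  split; first by rewrite hornerC oner_neq0.
    by rewrite hornerZ (fx _ _ _ PE) mulf_neq0 // lg_char2.
  rewrite mulrS val_lpD nP PE cd divff // mulr1 lg_add_double // hornerX hornerC divr1.
  congr lg_line; rewrite hornerZ (fx _ _ _ PE) /g !hornerE /=; field.
  by rewrite y0 lg_char2.
have [cd'|cd'] := eqVneq c (- d).
  exists s; split=> //; left=> P x y PE sx; apply: val_inj.
  have [dx nP] := yE _ _ _ PE sx.
  by rewrite mulrS val_lpD nP PE cd' hornerN mulNr divff // mulrN1 lg_add_opp.
(* No point remains off these roots: both P and n P have ordinates squaring to f(x), so (c - d)(c +
   d) f vanishes at x. The zero alternative holds vacuously. *)
exists (s * ((c - d) * (c + d) * f)); split.
  by rewrite !mulf_neq0 // ?subr_eq0 ?addr_eq0.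
left=> P x y PE; rewrite !hornerM (fx _ _ _ PE) => nz; exfalso; move: nz.
rewrite !mulf_eq0 !negb_or => /and3P[sx /andP[cdx cdx'] y2].
have [dx nP] := yE _ _ _ PE sx.
have := lpoint_eqn nP; rewrite -(lpoint_eqn PE) => e.
suff : (c - d).[x] * (c + d).[x] * y ^+ 2 = 0.
  have [y0 _] := andP y2.
  by move/eqP; rewrite !mulf_eq0 (negPf cdx) (negPf cdx') (negPf y0).
rewrite hornerD hornerN hornerD.
transitivity (d.[x] ^+ 2 * ((y * (c.[x] / d.[x])) ^+ 2 - y ^+ 2)); first by field.
by rewrite e subrr mulr0.
Qed.

(** If multiplication by n is generically 0, translation by [lg_T] gives P + T, whose n-th multiple
    is T, so its abscissa is exceptional unless it is infinity. Otherwise n P is affine for generic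
    P, and P itself is exceptional or 0. *)
Lemma finite_odd_torsion n : odd n ->
  exists l : seq (lpoint E), forall P, P *+ n = 0 -> P \in l.
Proof.
move=> on; have [s [s0 gen]] := generic_dichotomy n.
have [l hl] := finite_points_over s0.
case: gen => [hs|[a [c [d hs]]]].
  exists (- lg_T :: [seq Q - lg_T | Q <- l]) => P nP.
  have nPT : (P + lg_T) *+ n = lg_T by rewrite mulrnDl nP add0r lg_T_odd.
  rewrite inE -addr_eq0; case PT : (val (P + lg_T)) => [[x y]|]; last first.
    by rewrite lp_eq0 PT.
  have [sx|sx] := boolP (root s x).
    apply/orP; right; rewrite -[P](addrK lg_T); apply: map_f; exact: hl PT sx.
  by have := hs _ _ _ PT sx; rewrite nPT.
exists (0 :: l) => P nP; rewrite inE lp_eq0; case PE : (val P) => [[x y]|//].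
rewrite /= (hl _ _ _ PE) //; apply/negPn/negP => sx.
by have [_] := hs _ _ _ PE sx; rewrite nP.
Qed.

End FiniteTorsion.

(** * Points close to the origin *)

(* The substitution x = Z / (z ^ 2 W), y = 1 / (z ^ 3 W) turns the curve into
   W = Z ^ 3 + A' Z ^ 2 W + B' Z W ^ 2 with A' = A z ^ 2 and B' = B z ^ 4, and the
   line y = l x + n into W = s Z + t. *)
Section LineInParameters.
Variables (K : fieldType) (A B z l Z1 Z2 W1 W2 s : K).
Let A' := A * z ^+ 2.
Let B' := B * z ^+ 4.
Let x1 := Z1 / (z ^+ 2 * W1).
Let x2 := Z2 / (z ^+ 2 * W2).
Let y1 := (z ^+ 3 * W1)^-1.
Let y2 := (z ^+ 3 * W2)^-1.
Let t := W1 - s * Z1.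
Let D := 1 - A' * Z2 ^+ 2 - B' * Z2 * (W1 + W2).
Let N := Z1 ^+ 2 + Z1 * Z2 + Z2 ^+ 2 + A' * W1 * (Z1 + Z2) + B' * W1 ^+ 2.
Hypotheses (z0 : z != 0) (W10 : W1 != 0) (W20 : W2 != 0).
Hypotheses (e1 : W1 = Z1 ^+ 3 + A' * Z1 ^+ 2 * W1 + B' * Z1 * W1 ^+ 2)
  (e2 : W2 = Z2 ^+ 3 + A' * Z2 ^+ 2 * W2 + B' * Z2 * W2 ^+ 2)
  (y2E : y2 = y1 + l * (x2 - x1))
  (slope : l * (2 * y1 + l * (x2 - x1)) =
    x1 ^+ 2 + x1 * x2 + x2 ^+ 2 + A * (x1 + x2) + B)
  (D0 : D != 0) (sE : s * D = N).

(** The slope (W2 - W1) / (Z2 - Z1) takes the form N / D, which also makes sense for Z1 = Z2; in the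
    application [D] is a unit of the valuation ring. *)
Lemma param_chord : (W2 - W1) * D = (Z2 - Z1) * N.
Proof.
apply/subr0_eq.
transitivity ((W2 - (Z2 ^+ 3 + A' * Z2 ^+ 2 * W2 + B' * Z2 * W2 ^+ 2))
  - (W1 - (Z1 ^+ 3 + A' * Z1 ^+ 2 * W1 + B' * Z1 * W1 ^+ 2))).
  by rewrite /D /N; ring.
by rewrite -e1 -e2 !subrr.
Qed.

Lemma param_W2 : W2 = s * Z2 + t.
Proof.
apply/eqP; rewrite -subr_eq0; apply/eqP/(mulIf D0); rewrite mul0r.
transitivity ((W2 - W1) * D - (Z2 - Z1) * (s * D)); first by rewrite /t; ring.
by rewrite sE param_chord subrr.
Qed.

(** With n = y1 - l x1, the line y = l x + n becomes W = - (l / (n z^2)) Z + 1 / (n z^3): this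
    identifies [s] here and [t] in [param_intercept]. *)
Lemma param_line : l = - (s * (y1 - l * x1) * z ^+ 2).
Proof.
apply/eqP; rewrite -addr_eq0; apply/eqP.
have [/= x12|/negPn/eqP x12] := boolP (x1 != x2).
  have Z12 : Z2 - Z1 != 0.
    apply: contraNneq x12 => Z12; have := param_chord; rewrite Z12 mul0r => /eqP.
    rewrite mulf_eq0 (negPf D0) orbF subr_eq0 => /eqP W12.
    by apply/eqP; rewrite /x1 /x2 W12 (subr0_eq Z12).
  apply: (mulfI Z12); rewrite mulr0.
  apply: (mulfI (expf_neq0 1 z0)); rewrite mulr0 expr1.
  transitivity (z * l * (Z2 - Z1) + z ^+ 3 * (y1 - l * x1) * (s * (Z2 - Z1))); first by ring.
  have -> : s * (Z2 - Z1) = W2 - W1 by rewrite param_W2 /t; ring.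
  transitivity (z ^+ 3 * W2 * (y1 + l * (x2 - x1) - y2)); last by rewrite y2E subrr mulr0.
  by rewrite /y1 /y2 /x1 /x2; field; rewrite z0 W10 W20.
have y12 : y2 = y1 by rewrite y2E x12 subrr mulr0 addr0.
have W12 : W2 = W1.
  by apply: (mulfI (expf_neq0 3 z0)); apply: invr_inj.
have Z12 : Z2 = Z1.
  move: x12; rewrite /x1 /x2 W12 => /(mulIf _) -> //.
  by rewrite invr_neq0 // mulf_neq0 // expf_neq0.
have lE : l * (2 * z * W1) = N.
  transitivity (l * (2 * y1 + l * (x2 - x1)) * (z ^+ 4 * W1 ^+ 2)).
    by rewrite /x1 /x2 /y1 W12 Z12; field; rewrite z0 W10.
  by rewrite slope /x1 /x2 /N /A' /B' W12 Z12; field; rewrite z0 W10.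
have DN : D * W1 - N * Z1 = - 2 * W1.
  transitivity (W1 - 3 * (Z1 ^+ 3 + A' * Z1 ^+ 2 * W1 + B' * Z1 * W1 ^+ 2)).
    by rewrite /D /N W12 Z12; ring.
  by rewrite -e1; ring.
apply: (mulIf D0); rewrite mul0r.
transitivity ((l * (D * W1 - N * Z1) + s * D / z) / W1); last first.
  by rewrite DN sE -lE; field; rewrite z0 W10.
by rewrite -sE /x1 /y1; field; rewrite z0 W10.
Qed.

Lemma param_intercept : (y1 - l * x1) * z ^+ 3 * t = 1.
Proof.
transitivity (z ^+ 3 * W1 * (y1 - l * x1) + z * Z1 * (- (s * (y1 - l * x1) * z ^+ 2))).
  by rewrite /t; ring.
rewrite -param_line /x1 /y1; field.
by rewrite z0 W10.
Qed.

(** Substituting W = s Z + t gives a cubic in Z with leading coefficient [k] and next coefficient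
    (A' + 2 B' s) t. Its roots are Z1, Z2 and -Z3, because taking opposites changes the sign of Z
    and of W. *)
Let k := 1 + A' * s + B' * s ^+ 2.
Let Z3 := Z1 + Z2 + (A' + 2 * B' * s) * t / k.
Let W3 := s * Z3 - t.
Let x3 := l ^+ 2 - A - x1 - x2.
Let y3 := - (l * (x3 - x1) + y1).
Hypothesis k0 : k != 0.

Lemma param_sum_x : z ^+ 2 * x3 * W3 = Z3.
Proof.
have t0 : t != 0.
  by apply/eqP => t0; have := param_intercept; rewrite t0 mulr0 => /eqP; rewrite eq_sym oner_eq0.
have nE : y1 - l * x1 = (z ^+ 3 * t)^-1.
  apply: (mulIf (mulf_neq0 (expf_neq0 3 z0) t0)); rewrite mulVf ?mulf_neq0 ?expf_neq0 //.
  by rewrite mulrA param_intercept.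
have lE : l = - (s / (z * t)) by rewrite param_line nE; field; rewrite z0 t0.
have W1E : W1 = s * Z1 + t by rewrite /t; ring.
have G1 : k * Z1 ^+ 3 + (A' + 2 * B' * s) * t * Z1 ^+ 2 + (B' * t ^+ 2 - s) * Z1 - t = 0.
  transitivity (Z1 ^+ 3 + A' * Z1 ^+ 2 * W1 + B' * Z1 * W1 ^+ 2 - W1); last by rewrite -e1 subrr.
  by rewrite /k W1E; ring.
have H : k * (Z1 ^+ 2 + Z1 * Z2 + Z2 ^+ 2) + (A' + 2 * B' * s) * t * (Z1 + Z2)
    + (B' * t ^+ 2 - s) = 0.
  transitivity (N - s * D); last by rewrite sE subrr.
  by rewrite /k /N /D param_W2 W1E; ring.
pose e := (A' + 2 * B' * s) * t.
have kZ3 : k * Z3 = k * (Z1 + Z2) + e by rewrite /Z3 /e; field.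
(* Vieta's relations for the roots Z1, Z2, -Z3; [q1] and [q2] then give the combinations of W1, W2,
   W3 that enter x3. *)
pose p2 := k * Z1 * Z2 - k * Z3 * (Z1 + Z2).
have p2E : p2 = B' * t ^+ 2 - s.
  apply/eqP; rewrite -subr_eq0; apply/eqP.
  transitivity (k * Z1 * Z2 - (k * (Z1 + Z2) + e) * (Z1 + Z2) - (B' * t ^+ 2 - s)).
    by rewrite /p2 kZ3.
  transitivity (- (k * (Z1 ^+ 2 + Z1 * Z2 + Z2 ^+ 2) + (A' + 2 * B' * s) * t * (Z1 + Z2)
    + (B' * t ^+ 2 - s))); first by rewrite /e; ring.
  by rewrite H oppr0.
have p3E : k * Z1 * Z2 * Z3 = - t.
  apply/eqP; rewrite -addr_eq0; apply/eqP.
  transitivity (Z1 * Z2 * (k * Z3) + t); first by ring.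
  transitivity (Z1 * (k * (Z1 ^+ 2 + Z1 * Z2 + Z2 ^+ 2) + (A' + 2 * B' * s) * t * (Z1 + Z2)
    + (B' * t ^+ 2 - s)) - (k * Z1 ^+ 3 + (A' + 2 * B' * s) * t * Z1 ^+ 2
    + (B' * t ^+ 2 - s) * Z1 - t)); first by rewrite kZ3 /e; ring.
  by rewrite H G1 mulr0 subr0.
have q1 : k * W1 * W2 * W3 = - t ^+ 3.
  transitivity (s ^+ 3 * (k * Z1 * Z2 * Z3) - s ^+ 2 * t * p2
      + s * t ^+ 2 * (k * Z3 - k * (Z1 + Z2)) - k * t ^+ 3).
    by rewrite /p2 /W3 param_W2 W1E; ring.
  by rewrite p3E p2E kZ3 /e /k; ring.
have q2 : k * (W3 * (Z1 * W2 + Z2 * W1) + Z3 * W1 * W2) = - (t * (s ^+ 2 - A' * t ^+ 2)).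
  transitivity (3 * s ^+ 2 * (k * Z1 * Z2 * Z3) - 2 * s * t * p2
      + t ^+ 2 * (k * Z3 - k * (Z1 + Z2))).
    by rewrite /p2 /W3 param_W2 W1E; ring.
  by rewrite p3E p2E kZ3 /e /k; ring.
have x3E : z ^+ 2 * x3 = s ^+ 2 / t ^+ 2 - A' - Z1 / W1 - Z2 / W2.
  by rewrite /x3 lE /x1 /x2 /A'; field; rewrite z0 t0 W10 W20.
have nz : k * W1 * W2 * t ^+ 2 != 0 by rewrite !mulf_neq0 // expf_neq0.
apply: (mulfI nz); rewrite x3E.
transitivity ((s ^+ 2 - A' * t ^+ 2) * (k * W1 * W2 * W3) + t ^+ 2 * (k * Z3 * W1 * W2)
  - t ^+ 2 * (k * (W3 * (Z1 * W2 + Z2 * W1) + Z3 * W1 * W2))).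
  by field; rewrite W10 W20 t0.
by rewrite q1 q2; ring.
Qed.

Lemma param_sum_y : y3 * (z ^+ 3 * W3) = 1.
Proof.
have tE := param_intercept.
have t0 : t != 0.
  by apply/eqP => t0; move: tE; rewrite t0 mulr0 => /eqP; rewrite eq_sym oner_eq0.
have y3E : y3 * t * z ^+ 3 = s * (z ^+ 2 * x3) - 1.
  transitivity (- (l * x3 * t * z ^+ 3) - (y1 - l * x1) * z ^+ 3 * t).
    by rewrite /y3; ring.
  rewrite tE; congr (_ - _); rewrite {1}param_line.
  transitivity (s * (z ^+ 2 * x3) * ((y1 - l * x1) * z ^+ 3 * t)); first by ring.
  by rewrite tE mulr1.
apply: (mulfI t0); rewrite mulr1.
transitivity ((y3 * t * z ^+ 3) * W3); first by ring.
rewrite y3E mulrBl mul1r.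
transitivity (s * (z ^+ 2 * x3 * W3) - W3); first by ring.
by rewrite param_sum_x /W3; ring.
Qed.

End LineInParameters.

(** * Reduction to the additive group *)

Section Reduction.
Variables (K : fieldType) (E : legendre K) (O : subringClosed K).
Hypothesis valO : valuation_ring O.
Local Notation m := (maximal_ideal O).
Local Notation A := (lg_A E).
Local Notation B := (lg_B E).
Local Notation W := (lg_weierstrass E).
Variable z : K.
Hypotheses (z0 : z != 0) (Am : A * z ^+ 2 \in m) (Bm : B * z ^+ 4 \in m).
Local Notation A' := (A * z ^+ 2).
Local Notation B' := (B * z ^+ 4).

(* The rescaled curve W = Z ^ 3 + A' Z ^ 2 W + B' Z W ^ 2 reduces to the cuspidal
   cubic, whose smooth points form the additive group with coordinate Z. *)
Definition reduces_to (P : option (K * K)) (r : K) : Prop :=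
  if P is Some (x, y) then
    exists Z V, [/\ Z \in O, V \in O, V != 0,
      x = Z / (z ^+ 2 * V) /\ y = (z ^+ 3 * V)^-1 & Z - r \in m]
  else r \in m.

Lemma reduced_equation x y Z V : y ^+ 2 = lg_cubic E x -> V != 0 ->
  x = Z / (z ^+ 2 * V) -> y = (z ^+ 3 * V)^-1 ->
  V = Z ^+ 3 + A' * Z ^+ 2 * V + B' * Z * V ^+ 2.
Proof.
move=> c V0 xE yE.
transitivity (y ^+ 2 * (z ^+ 6 * V ^+ 3)); first by rewrite yE; field; rewrite z0 V0.
by rewrite c /lg_cubic xE; field; rewrite z0 V0.
Qed.

(** [D] and [k] are congruent to 1, hence units, so Z3 and V3 stay in [O]; and Z3 - Z1 - Z2 has the
    factor A' + 2 B' s, which lies in the maximal ideal. *)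
Lemma reduces_to_add P Q r r' : on_curve W P -> on_curve W Q ->
  reduces_to P r -> reduces_to Q r' -> reduces_to (coord_add W P Q) (r + r').
Proof.
have mO x : x \in m -> x \in O by exact: maximal_ideal_sub.
have mD := @maximal_idealD _ O valO; have mB := @maximal_idealB _ O valO.
have mM := @maximal_idealMr _ O.
move=> cP cQ; move: (lg_addP cP cQ) => sp; case: sp cP cQ => {P Q}.
- move=> [[x y]|] _ _ /= rm; last exact: mD.
  case=> Z [V [ZO VO V0 xy Zr]]; exists Z, V; split=> //.
  by rewrite opprD addrCA addrC mB.
- move=> [[x y]|] _ _ /=; last exact: mD.
  case=> Z [V [ZO VO V0 xy Zr]] rm; exists Z, V; split=> //.
  by rewrite opprD addrA mB.
- move=> x y _ _ [Z1 [V1 [_ _ V10 [x1 y1] Zr1]]] [Z2 [V2 [_ _ V20 [x2 y2] Zr2]]] /=.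
  have V12 : V2 = - V1.
    apply: (mulfI (expf_neq0 3 z0)); apply: invr_inj.
    by rewrite -y2 y1 mulrN invrN.
  have Z12 : Z2 = - Z1.
    have nz : z ^+ 2 * V1 != 0 by rewrite mulf_neq0 // expf_neq0.
    apply: (mulIf (invr_neq0 nz)); rewrite mulNr -x1 x2 V12; field.
    by rewrite ?oppr_eq0 V10 z0.
  rewrite (_ : r + r' = - (Z1 - r + (Z2 - r'))); last by rewrite Z12; ring.
  by apply: maximal_idealN; exact: mD.
move=> l x1 y1 x2 y2 y2E slope generic /on_lgP c1 /on_lgP c2.
move=> [Z1 [V1 [Z1O V1O V10 [x1E y1E] Zr1]]] [Z2 [V2 [Z2O V2O V20 [x2E y2E'] Zr2]]].
have e1 := reduced_equation c1 V10 x1E y1E.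
have e2 := reduced_equation c2 V20 x2E y2E'.
subst x1 y1 x2; rewrite y2E' in y2E.
pose D := 1 - A' * Z2 ^+ 2 - B' * Z2 * (V1 + V2).
pose N := Z1 ^+ 2 + Z1 * Z2 + Z2 ^+ 2 + A' * V1 * (Z1 + Z2) + B' * V1 ^+ 2.
have unit_add x : x \in m -> 1 + x != 0 /\ (1 + x)^-1 \in O.
  by move=> xm; exact/unit_of_notin_maximal_ideal/add_one_notin_maximal_ideal.
have [D0 DO] : D != 0 /\ D^-1 \in O.
  rewrite /D -addrA -opprD; apply/unit_add/maximal_idealN/mD.
    by apply: (mM) => //; exact: rpredX.
  by rewrite -mulrA; apply: (mM) => //; mem_closed.
have A'O := mO _ Am; have B'O := mO _ Bm.
have NO : N \in O by rewrite /N; mem_closed.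
pose s := N / D.
have sO : s \in O by rewrite /s rpredM.
have sE : s * D = N by rewrite /s divfK.
pose k := 1 + A' * s + B' * s ^+ 2.
have [k0 kO] : k != 0 /\ k^-1 \in O.
  by rewrite /k -addrA; apply/unit_add/mD; apply: (mM) => //; exact: rpredX.
pose t := V1 - s * Z1.
have tO : t \in O by rewrite /t; mem_closed.
pose Z3 := Z1 + Z2 + (A' + 2 * B' * s) * t / k.
pose V3 := s * Z3 - t.
have em : (A' + 2 * B' * s) * t / k \in m.
  rewrite -[X in X \in _]mulrA; apply: (mM); last exact: rpredM.
  by apply: (mD) => //; apply: (mM) => //; apply: maximal_idealM => //; exact: rpred_nat.
have Z3O : Z3 \in O by rewrite /Z3; apply: rpredD; [exact: rpredD|exact: (mO)].
have V3O : V3 \in O by rewrite /V3; mem_closed.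
have px := param_sum_x z0 V10 V20 e1 e2 y2E slope D0 sE k0.
have py := param_sum_y z0 V10 V20 e1 e2 y2E slope D0 sE k0.
rewrite -/t -/k -/Z3 -/V3 in px py.
have V30 : V3 != 0.
  by apply: contra_eq_neq py => ->; rewrite !mulr0 eq_sym oner_neq0.
exists Z3, V3; split=> //; first split.
- apply: (mulIf V30); apply: (mulfI (expf_neq0 2 z0)); rewrite mulrA px; field.
  by rewrite z0 V30.
- have nz : z ^+ 3 * V3 != 0 by rewrite mulf_neq0 // expf_neq0.
  by apply: (mulIf nz); rewrite py mulVf.
rewrite (_ : Z3 - _ = (Z1 - r) + (Z2 - r') + (A' + 2 * B' * s) * t / k).
  by apply: (mD) => //; exact: mD.
by rewrite /Z3; ring.
Qed.

Lemma reduces_to_mulrn (P : lpoint E) n :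
  reduces_to (val P) 1 -> reduces_to (val (P *+ n)) n%:R.
Proof.
move=> rP; elim: n => [|n IHn]; first by rewrite mulr0n /=; exact: maximal_ideal0.
by rewrite mulrS val_lpD -natr1 addrC; apply: reduces_to_add; rewrite ?valP.
Qed.

End Reduction.

Section FormalGroup.
Variables (K : fieldType) (E : legendre K) (O : subringClosed K).
Hypothesis valO : valuation_ring O.
Local Notation m := (maximal_ideal O).

(** The choice z = x / y gives P the parameter Z = 1, so n P reduces to n, and infinity reduces to
    0. It is admissible because y^2 / x^3 is a unit when x is large. *)
Lemma mulrn_eq0_near_origin (P : lpoint E) x y n : val P = Some (x, y) ->
  x != 0 -> lg_A E / x \in m -> lg_B E / x ^+ 2 \in m ->
  P *+ n = 0 -> n%:R \in m.
Proof.
move=> PE x0 Am Bm nP.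
have c : y ^+ 2 = lg_cubic E x by case: P PE {nP} => Q cQ /= QE; apply/on_lgP; rewrite -QE.
pose V := 1 + (lg_A E / x + lg_B E / x ^+ 2).
have [V0 VO] : V != 0 /\ V^-1 \in O.
  by apply/unit_of_notin_maximal_ideal/add_one_notin_maximal_ideal => //; exact: maximal_idealD.
have VE : y ^+ 2 = V * x ^+ 3 by rewrite c /lg_cubic /V; field.
have y0 : y != 0.
  by apply: contra_eq_neq VE => ->; rewrite expr0n eq_sym mulf_neq0 // expf_neq0.
pose z := x / y; have z0 : z != 0 by rewrite mulf_neq0 // invr_neq0.
have z2 : z ^+ 2 = V^-1 / x.
  by rewrite /z expr_div_n VE; field; rewrite x0 V0.
have Am' : lg_A E * z ^+ 2 \in m.
  by rewrite z2 mulrCA mulrC maximal_idealMr.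
have Bm' : lg_B E * z ^+ 4 \in m.
  rewrite (_ : _ * _ = lg_B E / x ^+ 2 * V^-1 ^+ 2).
    by apply: maximal_idealMr => //; exact: rpredX.
  have -> : z ^+ 4 = (z ^+ 2) ^+ 2 by ring.
  by rewrite z2; field; rewrite x0 V0.
have rP : reduces_to O z (val P) 1.
  rewrite PE; exists 1, V; rewrite subrr rpred1 V0 maximal_ideal0; split=> //.
    by rewrite rpredD ?rpred1 // maximal_ideal_sub // maximal_idealD.
  split; first by rewrite z2; field; rewrite x0 V0 oner_neq0.
  by rewrite exprSr z2 /z; field; rewrite ?oner_neq0 x0 V0 y0.
by have := reduces_to_mulrn valO z0 Am' Bm' n rP; rewrite nP.
Qed.

End FormalGroup.

(** * Galois theory *)

Lemma minimal_polynomial (G L : fieldType) (phi : {rmorphism G -> L}) (x : L)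
    (p : {poly G}) : p != 0 -> root (map_poly phi p) x ->
  exists m : {poly G}, irreducible_poly m /\
    forall q, root (map_poly phi q) x = (m %| q).
Proof.
have [n] := ubnP (size p); elim: n p => // n IHn p /ltnSE sp p0 px.
have [[q [q0 qx qp]]|no] :=
    pselect (exists q : {poly G}, [/\ q != 0, root (map_poly phi q) x & (size q < size p)%N]).
  by apply: (IHn q) => //; exact: leq_trans sp.
have dvd q : root (map_poly phi q) x = (p %| q).
  apply/idP/idP => [qx|/dvdpP[r ->]]; last by rewrite rmorphM /= rootM px orbT.
  apply: contrapT => /negP nd; apply: no; exists (q %% p).
  split; [by []| |by rewrite ltn_modp].
  move: qx; rewrite {1}(divp_eq q p) rmorphD rmorphM /= /root !hornerE /=.
  by rewrite (rootP px) mulr0 add0r.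
exists p; split=> //; split.
  rewrite ltnNge; apply/negP => /size1_polyC pE; move: px p0.
  by rewrite pE map_polyC /root hornerC fmorph_eq0 polyC_eq0 => ->.
move=> q sq /dvdpP[r pE]; rewrite /eqp {1}pE dvdp_mull //=.
have := px; rewrite pE rmorphM /= rootM => /orP[]; rewrite dvd -?pE // => pr.
have r0 : r != 0 by apply: contraNneq p0 => r0; rewrite pE r0 mul0r.
have q0 : q != 0 by apply: contraNneq p0 => q0; rewrite pE q0 mulr0.
have := dvdp_leq r0 pr; rewrite pE size_mul // => h.
have s0 : (0 < size r)%N by rewrite size_poly_gt0.
have t0 : (0 < size q)%N by rewrite size_poly_gt0.
by move: sq h s0 t0; case: (size q) => [|[|k]] //; lia.
Qed.

(** A pair with exactly one zero component is not a unit and would be its own inverse; the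
    hypothesis excludes it, and 0 is inverted to 0 in both components. *)
Lemma pair_invE (L : fieldType) (z : L * L) :
  (z.1 == 0) = (z.2 == 0) -> z^-1 = (z.1^-1, z.2^-1).
Proof.
case: z => x y /= xy; have [x0|x0] := eqVneq x 0; last first.
  apply: (@mulrI _ (x, y)); first by apply/andP; rewrite !unitfE -xy x0.
  rewrite mulrV; first by congr (_, _); rewrite /= divff // -xy.
  by apply/andP; rewrite !unitfE -xy x0.
move: xy; rewrite x0 eqxx => /esym/eqP->; rewrite invr_out ?invr0 //.
by apply/negP => /andP[]; rewrite unitr0.
Qed.

Section Automorphisms.
Variables (K L : fieldType) (iota : {rmorphism K -> L}).

(* Graphs of partial K-embeddings of L in itself which are defined on a subfield. *)
Definition partial_embedding (S : set (L * L)) :=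
  [/\ GRing.divring_closed [in S],
      forall x y, (x, y) \in S -> (x == 0) = (y == 0) &
      forall a, (iota a, iota a) \in S].

Section Extension.
Variables (G : fieldType) (phi psi : {rmorphism G -> L}) (j : K -> G).
Hypotheses (phij : forall a, phi (j a) = iota a) (psij : forall a, psi (j a) = iota a).
Variables (x y : L) (p m : {poly G}).
Hypotheses (m_irr : irreducible_poly m)
  (mx : forall q, root (map_poly phi q) x = (m %| q))
  (my : root (map_poly psi m) y).

Definition extension_graph : set (L * L) :=
  [set ((map_poly phi q).[x], (map_poly psi q).[y]) | q in [set: {poly G}]].

Lemma extension_root q : root (map_poly psi q) y = (m %| q).
Proof.
apply/idP/idP => [qy|/dvdpP[r ->]]; last by rewrite rmorphM /= rootM my orbT.
apply: contrapT => /negP; rewrite -irreducible_poly_coprime // => /Bezout_eq1_coprimepP.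
case=> -[u v] /= /(congr1 (fun r => (map_poly psi r).[y])).
rewrite rmorphD !rmorphM /= !hornerE (rootP my) (rootP qy) !mulr0 addr0.
by rewrite rmorph1 hornerC => /eqP; rewrite eq_sym oner_eq0.
Qed.

Lemma extension_graph_zero q :
  ((map_poly phi q).[x] == 0) = ((map_poly psi q).[y] == 0).
Proof. by rewrite -!/(root _ _) mx extension_root. Qed.

Lemma extension_graph_embedding : partial_embedding extension_graph.
Proof.
have inP z : reflect (exists q, z = ((map_poly phi q).[x], (map_poly psi q).[y]))
    (z \in extension_graph).
  by apply: (iffP idP) => [/set_mem[q _ <-]|[q ->]]; [exists q|apply/mem_set; exists q].
split.
- split=> [|_ _ /inP[q ->] /inP[r ->]|_ _ /inP[q ->] /inP[r ->]].
  + by apply/inP; exists 1; rewrite !rmorph1 !hornerC.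
  + by apply/inP; exists (q - r); rewrite !rmorphB !hornerE.
  have [rx|rx] := eqVneq (map_poly phi r).[x] 0.
    have /eqP ry : (map_poly psi r).[y] == 0 by rewrite -extension_graph_zero rx.
    by apply/inP; exists 0; rewrite !rmorph0 !horner0 rx ry pair_invE /= ?eqxx // invr0;
      congr (_, _); rewrite /= mulr0.
  have : coprimep m r by rewrite irreducible_poly_coprime // -mx.
  case/Bezout_eq1_coprimepP => -[u v] /= e.
  have hx : (map_poly phi v).[x] = (map_poly phi r).[x]^-1.
    apply: (mulIf rx); rewrite mulVf //.
    have /(congr1 (fun q => (map_poly phi q).[x])) := e.
    have mx0 : (map_poly phi m).[x] = 0 by apply/rootP; rewrite mx.
    by rewrite rmorphD !rmorphM /= !hornerE mx0 mulr0 add0r rmorph1 hornerC.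
  have hy : (map_poly psi v).[y] = (map_poly psi r).[y]^-1.
    have ry : (map_poly psi r).[y] != 0 by rewrite -extension_graph_zero.
    apply: (mulIf ry); rewrite mulVf //.
    have /(congr1 (fun q => (map_poly psi q).[y])) := e.
    by rewrite rmorphD !rmorphM /= !hornerE (rootP my) mulr0 add0r rmorph1 hornerC.
  apply/inP; exists (q * v); rewrite !rmorphM /= !hornerM hx hy.
  by rewrite pair_invE //=; exact: extension_graph_zero.
- by move=> _ _ /inP[q [-> ->]]; exact: extension_graph_zero.
- by move=> a; apply/inP; exists (j a)%:P; rewrite !map_polyC !hornerC /= phij psij.
Qed.

End Extension.

Section GraphField.
Variables (S : set (L * L)) (emb : partial_embedding S).

Let Sclosed : GRing.divring_closed [in S].
Proof. by case: emb. Qed.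

Definition graph_pred : divringClosed (L * L)%type :=
  HB.pack [in S] (GRing.isDivringClosed.Build (L * L)%type [in S] Sclosed).

(** The graph is an abstract copy of the domain: [graph_fst] is its inclusion in [L] and [graph_snd]
    the partial embedding, both as field morphisms. *)
Definition graph_field : Type := {z : L * L | z \in graph_pred}.

HB.instance Definition _ := SubChoice.on graph_field.
HB.instance Definition _ := [SubChoice_isSubComUnitRing of graph_field by <:].

Fact graph_field_axiom : GRing.field_axiom graph_field.
Proof.
move=> z z0; have [_ zE _] := emb.
have zS := valP z; have := zE (val z).1 (val z).2; rewrite -surjective_pairing => /(_ zS) z12.
have z1 : (val z).1 != 0.
  apply: contra_neq z0 => z1; apply: val_inj; move: z12; rewrite z1 eqxx => /esym/eqP z2.
  by rewrite [LHS]surjective_pairing z1 z2.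
have zU : val z \is a GRing.unit by apply/andP; rewrite !unitfE -z12 z1.
have zV : (val z)^-1 \in graph_pred by rewrite rpredV.
by apply/unitrP; exists (Sub (val z)^-1 zV); split; apply: val_inj; rewrite /= ?mulVr ?mulrV.
Qed.

HB.instance Definition _ :=
  GRing.ComUnitRing_isField.Build graph_field graph_field_axiom.

Definition graph_fst (z : graph_field) : L := (val z).1.
Definition graph_snd (z : graph_field) : L := (val z).2.

Fact graph_fst_zmod : zmod_morphism graph_fst. Proof. by []. Qed.
Fact graph_snd_zmod : zmod_morphism graph_snd. Proof. by []. Qed.
Fact graph_fst_monoid : GRing.monoid_morphism graph_fst. Proof. by []. Qed.
Fact graph_snd_monoid : GRing.monoid_morphism graph_snd. Proof. by []. Qed.

HB.instance Definition _ := GRing.isZmodMorphism.Build graph_field L graph_fst graph_fst_zmod.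
HB.instance Definition _ := GRing.isMonoidMorphism.Build graph_field L graph_fst graph_fst_monoid.
HB.instance Definition _ := GRing.isZmodMorphism.Build graph_field L graph_snd graph_snd_zmod.
HB.instance Definition _ := GRing.isMonoidMorphism.Build graph_field L graph_snd graph_snd_monoid.

Fact graph_iota_mem (a : K) : (iota a, iota a) \in graph_pred.
Proof. by case: emb => _ _; apply. Qed.

Definition graph_iota (a : K) : graph_field := Sub (iota a, iota a) (graph_iota_mem a).

Fact graph_iota_zmod : zmod_morphism graph_iota.
Proof. by move=> a b; apply: val_inj; congr (_, _); rewrite /= rmorphB. Qed.
Fact graph_iota_monoid : GRing.monoid_morphism graph_iota.
Proof.
by split=> [|a b]; apply: val_inj; congr (_, _); rewrite /= ?rmorph1 ?rmorphM.
Qed.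
HB.instance Definition _ := GRing.isZmodMorphism.Build K graph_field graph_iota graph_iota_zmod.
HB.instance Definition _ := GRing.isMonoidMorphism.Build K graph_field graph_iota graph_iota_monoid.

End GraphField.

Lemma partial_embedding_bigcup (F : set (set (L * L))) :
  F !=set0 -> F `<=` partial_embedding -> total_on F subset ->
  partial_embedding (\bigcup_(X in F) X).
Proof.
move=> [X0 FX0] FP totF.
have inU z : z \in \bigcup_(X in F) X <-> exists2 X, F X & z \in X.
  split=> [/set_mem[X FX Xz]|[X FX /set_mem Xz]]; first by exists X => //; exact: mem_set.
  by apply: mem_set; exists X.
have in2 z w : z \in \bigcup_(X in F) X -> w \in \bigcup_(X in F) X ->
    exists X, [/\ F X, z \in X & w \in X].
  move=> /inU[X FX zX] /inU[Y FY wY]; have [XY|YX] := totF _ _ FX FY.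
    by exists Y; split=> //; apply/mem_set/XY/set_mem.
  by exists X; split=> //; apply/mem_set/YX/set_mem.
split; last by move=> a; apply/inU; exists X0 => //; case: (FP _ FX0).
  split; first by apply/inU; exists X0 => //; case: (FP _ FX0) => -[].
  - move=> z w zU wU; have [X [FX zX wX]] := in2 _ _ zU wU; apply/inU; exists X => //.
    by have [[_ + _] _ _] := FP _ FX; exact.
  - move=> z w zU wU; have [X [FX zX wX]] := in2 _ _ zU wU; apply/inU; exists X => //.
    by have [[_ _ +] _ _] := FP _ FX; exact.
by move=> x y /inU[X FX xyX]; case: (FP _ FX) => _ + _; apply.
Qed.

Hypothesis sepL : is_separable_closure iota.

(** The minimal polynomial of x over the graph field divides a separable polynomial over K, so its
    image under the second projection has a root y in [L]. Sending x to y extends the embedding. *)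
Lemma maximal_embedding_total S : partial_embedding S ->
  (forall S', S `<=` S' -> partial_embedding S' -> S' `<=` S) ->
  forall x, exists y, S (x, y).
Proof.
move=> emb maxS x; have [sep closed] := sepL.
have [p [p_monic p_irr px p_sep]] := sep x.
pose phi : {rmorphism graph_field emb -> L} := graph_fst (emb := emb).
pose psi : {rmorphism graph_field emb -> L} := graph_snd (emb := emb).
pose j : {rmorphism K -> graph_field emb} := graph_iota emb.
have phij a : phi (j a) = iota a by [].
have psij a : psi (j a) = iota a by [].
have phip : map_poly phi (map_poly j p) = map_poly iota p.
  by rewrite -map_poly_comp; apply: eq_map_poly.
have psip : map_poly psi (map_poly j p) = map_poly iota p.
  by rewrite -map_poly_comp; apply: eq_map_poly.
have jp0 : map_poly j p != 0 by rewrite map_poly_eq0 monic_neq0.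
have [|m [m_irr mx]] := @minimal_polynomial _ _ phi x _ jp0; first by rewrite phip.
have m_dvd : m %| map_poly j p by rewrite -mx phip.
have [y my] : exists y, root (map_poly psi m) y.
  apply: closed; last by rewrite size_map_poly; case: m_irr.
  apply: (@dvdp_separable _ (map_poly iota p)); first by rewrite -psip dvdp_map.
  by rewrite separable_map.
have embS' := extension_graph_embedding phij psij m_irr mx my.
exists y; apply: (maxS _ _ embS').
  move=> z Sz; have zG : z \in graph_pred emb by exact: mem_set.
  exists (Sub z zG : graph_field emb)%:P => //.
  by rewrite !map_polyC !hornerC /= [RHS]surjective_pairing.
by exists 'X => //; rewrite !map_polyX !hornerX.
Qed.

(** The minimal polynomial of u is X^2 - e up to a constant, so -u is a root of it and u -> -u
    defines a partial embedding, which Zorn's lemma extends to all of [L]. *)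
Lemma exists_automorphism u : (forall a, iota a <> u) ->
  (exists e, u ^+ 2 = iota e) -> exists g : galois iota, g u = - u.
Proof.
move=> nu [e ue].
pose p : {poly K} := 'X^2 - e%:P.
have p0 : p != 0 by rewrite -size_poly_eq0 size_XnsubC.
have pE v : root (map_poly iota p) v = (v ^+ 2 == iota e).
  by rewrite rmorphB /= map_polyXn map_polyC /root !hornerE subr_eq0.
have [|m [m_irr mu]] := @minimal_polynomial _ _ iota u _ p0; first by rewrite pE ue.
have m_dvd : m %| p by rewrite -mu pE ue.
have m0 : m != 0 by apply: contraTneq m_dvd => ->; rewrite dvd0p.
have size_m : (2 < size m)%N.
  rewrite ltnNge; apply/negP => sm; have [s1 _] := m_irr.
  have m1 : m`_1 != 0.
    have : lead_coef m != 0 by rewrite lead_coef_eq0.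
    by rewrite lead_coefE (_ : size m = 2%N) //; apply/eqP; rewrite eqn_leq sm s1.
  have : root (map_poly iota m) u by rewrite mu.
  rewrite /root (horner_coef_wide _ (n := 2)) ?size_map_poly //.
  rewrite !big_ord_recl big_ord0 /= !coef_map expr0 mulr1 addr0 expr1 => /eqP h.
  apply: (nu (- m`_0 / m`_1)); rewrite fmorph_div rmorphN /=.
  have im1 : iota m`_1 != 0 by rewrite fmorph_eq0.
  by apply: (mulfI im1); rewrite mulrC divfK //; apply/eqP; rewrite eq_sym -addr_eq0 addrC h.
have mNu : root (map_poly iota m) (- u).
  have [r pr] := dvdpP _ _ m_dvd.
  have : root (map_poly iota p) (- u) by rewrite pE sqrrN ue.
  rewrite pr rmorphM /= rootM => /orP[ru|//]; exfalso.
  have r0 : r != 0 by apply: contraNneq p0 => r0; rewrite pr r0 mul0r.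
  have : size p = 3%N by rewrite size_XnsubC.
  rewrite pr size_mul // => sp.
  have arith (i k : nat) : (i + k).-1 = 3%N -> (2 < k)%N -> (i <= 1)%N by lia.
  have sr := arith _ _ sp size_m.
  move: ru r0; rewrite (size1_polyC sr) map_polyC /root hornerC fmorph_eq0 polyC_eq0.
  by move->.
have emb0 := @extension_graph_embedding _ iota iota idfun (fun=> erefl) (fun=> erefl) _ _ _ m_irr mu mNu.
have [S [S0 embS maxS]] := @Zorn_superset _ partial_embedding _ emb0 partial_embedding_bigcup.
have total := maximal_embedding_total embS maxS.
pose g x := sval (cid (total x)).
have gS x : (x, g x) \in S by apply/mem_set; rewrite /g; case: cid.
have [[S1 SB SM] S00 Siota] := embS.
have fS x y : (x, y) \in S -> g x = y.
  move=> xy; have : (x - x, g x - y) \in S by exact: (SB _ _ (gS x) xy).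
  by rewrite subrr => /S00; rewrite eqxx => /esym/eqP/subr0_eq.
have g_zmod : zmod_morphism g by move=> x y; apply: fS; exact: (SB _ _ (gS x) (gS y)).
have g_monoid : GRing.monoid_morphism g.
  split; first exact: fS.
  move=> x y; apply: fS.
  have pm z w : z \in S -> w \in S -> z * w \in S.
    by move=> zS wS; apply: (rpredM (s := graph_pred embS)).
  exact: (pm _ _ (gS x) (gS y)).
have g_iota a : g (iota a) = iota a by apply: fS.
have g0 x : (g x == 0) = (x == 0) by rewrite (S00 _ _ (gS x)).
have g_inj : injective g.
  by move=> x y /eqP; rewrite -subr_eq0 -g_zmod g0 subr_eq0 => /eqP.
(* Being injective, [g] permutes the finitely many roots of each polynomial over K. *)
have g_surj y : exists x, g x = y.
  have [q [q_monic q_irr qy q_sep]] := sepL.1 y.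
  have q0 : map_poly iota q != 0 by rewrite map_poly_eq0 monic_neq0.
  have [rs hrs] := poly_roots_seq q0.
  pose r := undup [seq x <- rs | root (map_poly iota q) x].
  have rP x : (x \in r) = root (map_poly iota q) x.
    by rewrite mem_undup mem_filter; apply: andb_idr; exact: hrs.
  have groot x : root (map_poly iota q) x -> root (map_poly iota q) (g x).
    move=> qx; rewrite /root; have -> : (map_poly iota q).[g x] = g (map_poly iota q).[x].
      pose ag := GRing.isZmodMorphism.Build L L g g_zmod.
      pose mg := GRing.isMonoidMorphism.Build L L g g_monoid.
      pose g' : {rmorphism L -> L} := HB.pack g ag mg.
      rewrite -[g x]/(g' x) -[g _]/(g' _) -horner_map -map_poly_comp /=.
      by congr (_.[_]); apply: eq_map_poly => b /=; rewrite g_iota.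
    by rewrite (rootP qx) g0.
  have [_ eq_r] : (size (map g r) = size r) * (map g r =i r).
    apply: uniq_min_size; last by rewrite size_map.
      by rewrite map_inj_uniq // undup_uniq.
    by move=> _ /mapP[x xr ->]; rewrite rP groot // -rP.
  have : y \in map g r by rewrite eq_r rP.
  by case/mapP => x _ ->; exists x.
have g_bij : bijective g.
  exists (fun y => sval (cid (g_surj y))) => y; last by case: cid.
  by apply: g_inj; case: cid.
exists (Galois g_zmod g_monoid g_bij g_iota) => /=.
apply: fS; apply/mem_set/S0; exists 'X => //.
by rewrite !map_polyX !hornerX.
Qed.

Section FinitelyGenerated.
Hypothesis char2 : 2 != 0 :> K.
Hypothesis fg : topologically_finitely_generated iota.

(** The automorphisms that agree with a given one at u form an open set, which the dense subgroup
    meets; its elements fix u once the generators do. *)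
Lemma fixed_by_generators : exists s : seq (galois iota),
  forall u, {in s, forall g : galois iota, g u = u} -> forall g : galois iota, g u = u.
Proof.
have [s clos] := fg; exists s => u su g.
have stab h : generated_subgroup s h -> h u = u.
  move=> /(_ [set h : galois iota | h u = u]); apply; split; last by move=> k /su.
  split; first by apply/mem_set.
  move=> h1 h2 /set_mem /= e1 /set_mem /= e2; apply/mem_set.
  have e2' : gal_inv h2 u = u by rewrite -{1}e2; exact: gal_inv_funK.
  by rewrite /= -[RHS]e1 -[in RHS]e2'.
have : closure (generated_subgroup s) g by rewrite clos.
have nb : nbhs g [set h : galois iota | h u = g u].
  apply: open_nbhs_nbhs; split=> //=.
  move=> h hu; exists [:: u] => k ku /=; rewrite (ku u) ?mem_head //.
by move=> /(_ _ nb) [h [/stab hu /= <-]].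
Qed.

Lemma separable_sqr_sub (c : L) : c != 0 -> separable_poly ('X^2 - c%:P).
Proof.
have char2L : 2 != 0 :> L by rewrite -(rmorph_nat iota) fmorph_eq0.
move=> c0; rewrite unlock; apply/Bezout_eq1_coprimepP.
exists (- (c^-1)%:P, (2 * c)^-1 *: 'X) => /=.
rewrite derivB derivXn derivC subr0 /= expr1 -mul_polyC.
transitivity ((c^-1 * c)%:P + (((2 * c)^-1 * 2 - c^-1)%:P * 'X ^+ 2)).
  rewrite !(polyCD, polyCN, polyCM, polyC_natr) /=; ring.
rewrite mulVf // (_ : _ - c^-1 = 0) ?mul0r ?addr0 //.
by field; rewrite char2L c0.
Qed.

Theorem finitely_generated_finite_square_classes :
  finite_square_classes (predT : {pred K}).
Proof.
have char2L : 2 != 0 :> L by rewrite -(rmorph_nat iota) fmorph_eq0.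
have [s hs] := fixed_by_generators.
pose r d : L := xget 0 [set x | x ^+ 2 = iota d].
have rP d : d != 0 -> r d ^+ 2 = iota d.
  move=> d0; rewrite /r; case: xgetP => [x _ //|no]; exfalso.
  have [x] : exists x, root ('X^2 - (iota d)%:P) x.
    by apply: sepL.2; rewrite ?size_XnsubC // separable_sqr_sub // fmorph_eq0.
  by rewrite /root !hornerE subr_eq0 => /eqP; exact: no.
exists {ffun 'I_(size s) -> bool}.
exists (fun d => [ffun i => tnth (in_tuple s) i (r d) == r d]).
move=> d d' _ _ d0 d'0 /ffunP cdd'.
have nz e : e != 0 -> r e != 0.
  by move=> e0; apply: contra_neq (e0) => re; apply: (fmorph_inj iota); rewrite rmorph0 -(rP e e0) re expr0n.
have sgn (g : galois iota) e : e != 0 -> g (r e) = r e \/ g (r e) = - r e.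
  move=> e0; have : g (r e) ^+ 2 == r e ^+ 2 by rewrite -rmorphXn /= rP // gal_fix.
  by rewrite eqf_sqr => /orP[]/eqP->; [left|right].
pose u := r d / r d'.
have u2 : u ^+ 2 = iota (d / d') by rewrite expr_div_n !rP // fmorph_div.
have gu : forall g : galois iota, g u = u.
  apply: hs => g /seq_tnthP[i gi]; rewrite fmorph_div /=.
  have := cdd' i; rewrite !ffunE -gi.
  have [-> | ->] := sgn g d d0; have [-> | ->] := sgn g d' d'0; rewrite ?eqxx.
  - by [].
  - by move/esym/eqP => <-; rewrite opprK.
  - by move/eqP->.
  - by rewrite invrN mulrNN.
(* Were u outside K, some automorphism would send it to -u; but all of them fix u, and 2 u is
   nonzero. *)
have [[v uv]|no] := pselect (exists v, iota v = u).
  exists v => //; apply: (fmorph_inj iota).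
  rewrite rmorphM rmorphXn /= uv u2 fmorph_div /=.
  by rewrite mulrC divfK // fmorph_eq0.
have [||g] := @exists_automorphism u; first by move=> v uv; apply: no; exists v.
  by exists (d / d').
rewrite gu => /eqP; rewrite -addr_eq0 -mulr2n -mulr_natl mulf_eq0 (negPf char2L) /=.
by rewrite mulf_eq0 invr_eq0 (negPf (nz _ d0)) (negPf (nz _ d'0)).
Qed.

End FinitelyGenerated.
End Automorphisms.

(** * A new independent point *)

(** A subgroup maximal among those that contain the squares and omit h has index 2: if d is outside,
    adjoining d captures h, so d h is inside. Membership is the wanted character. *)
Lemma quadratic_character (K : fieldType) (F : divringClosed K) (h : K) :
  h \in F -> h != 0 -> (forall u, u \in F -> u ^+ 2 != h) ->
  exists N : {pred K}, [/\ h \notin N,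
    forall u, u \in F -> u != 0 -> u ^+ 2 \in N,
    {in N &, forall d e, d * e \in N} &
    {in F &, forall d e, d != 0 -> e != 0 -> (d \in N) = (e \in N) -> d * e \in N}].
Proof.
move=> hF h0 hsq.
pose P (N : set K) := [/\ forall d, N d -> d \in F /\ d != 0,
  forall u, u \in F -> u != 0 -> N (u ^+ 2),
  forall d e, N d -> N e -> N (d * e) & ~ N h].
have [|G [X0 GX0] GP totG|N [_ [NF Nsq NM Nh] maxN]] :=
    @Zorn_superset K P [set d | exists u, [/\ u \in F, u != 0 & d = u ^+ 2]].
- split=> [_ [u [uF u0 ->]]|u uF u0|_ _ [u [uF u0 ->]] [v [vF v0 ->]]|[u [uF _ /esym/eqP]]].
  + by rewrite rpredX // expf_neq0.
  + by exists u.
  + by exists (u * v); rewrite rpredM // mulf_neq0 // exprMn.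
  + by apply/negP; exact: hsq.
- split=> [d [X GX Xd]|u uF u0|d e [X GX Xd] [Y GY Ye]|[X GX Xh]].
  + by have [h1 _ _ _] := GP _ GX; exact: h1.
  + by exists X0 => //; have [_ h2 _ _] := GP _ GX0; exact: h2.
  + have [XY|YX] := totG _ _ GX GY.
      by exists Y => //; have [_ _ h3 _] := GP _ GY; apply: h3 => //; exact: XY.
    by exists X => //; have [_ _ h3 _] := GP _ GX; apply: h3 => //; exact: YX.
  + by have [_ _ _ h4] := GP _ GX; exact: h4.
pose M : {pred K} := fun d => `[< N d >]; exists M.
have inN d : (d \in M) = `[< N d >] by [].
have other d : d \in F -> d != 0 -> ~ N d -> N (d * h).
  move=> dF d0 Nd; apply: contrapT => Ndh; apply: Nd.
  pose B := N `|` [set d * n | n in N].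
  have N1 : N 1 by rewrite -(expr1n _ 2); apply: (Nsq); rewrite ?rpred1 ?oner_neq0.
  apply: (maxN B); [by move=> n Nn; left| |by right; exists 1 => //; rewrite mulr1].
  split=> [_ [/NF //|[n /NF[nF n0] <-]]|u uF u0|x y|].
  - by rewrite rpredM // mulf_neq0.
  - by left; exact: Nsq.
  - move=> [Nx|[n Nn <-]] [Ny|[n' Nn' <-]].
    + by left; exact: NM.
    + by right; exists (x * n'); [exact: NM|rewrite mulrCA].
    + by right; exists (n * y); [exact: NM|rewrite mulrA].
    + left; rewrite (_ : d * n * (d * n') = d ^+ 2 * (n * n')); last by ring.
      by apply: (NM); [exact: Nsq|exact: NM].
  - case=> [//|[n Nn dn]]; apply: Ndh; rewrite -dn mulrA -expr2.
    by apply: (NM) => //; exact: Nsq.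
split=> [|u uF u0|d e /asboolP Nd /asboolP Ne|d e dF eF d0 e0]; rewrite !inN.
- exact/asboolP.
- by apply/asboolP/Nsq.
- by apply/asboolP/NM.
have [Nd|Nd] := asboolP (N d); have [Ne|Ne] := asboolP (N e) => // _.
  by apply/asboolP/NM.
have := NM _ _ (NM _ _ (other _ dF d0 Nd) (other _ eF e0 Ne)) (Nsq h^-1 _ _).
rewrite rpredV hF invr_eq0 h0 => /(_ isT isT) => hN; apply/asboolP.
by rewrite (_ : d * e = d * h * (e * h) * h^-1 ^+ 2) //; field.
Qed.

Section PointsOverSubfield.
Variables (K : fieldType) (E : legendre K) (F : divringClosed K).
Local Notation W := (lg_weierstrass E).
Hypotheses (aF : lg_a E \in F) (bF : lg_b E \in F).
Implicit Types (P Q : lpoint E).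

(* For y ^ 2 in F these are the points of the quadratic twist of E by y ^ 2. *)
Definition twisted_over (w : K) (P : option (K * K)) : Prop :=
  if P is Some (x, y) then x \in F /\ exists2 c, c \in F & y = w * c else True.

Lemma lg_A_mem : lg_A E \in F.
Proof. by rewrite rpredN rpredD. Qed.

Lemma lg_B_mem : lg_B E \in F.
Proof. by rewrite rpredM. Qed.

Lemma twisted_over_line w l c x1 y1 x2 : w ^+ 2 \in F -> l = w * c -> c \in F ->
  x1 \in F -> x2 \in F -> (exists2 d, d \in F & y1 = w * d) ->
  twisted_over w (lg_line E l x1 y1 x2).
Proof.
move=> wF -> cF x1F x2F [d dF ->]; have AF := lg_A_mem.
have xF : (w * c) ^+ 2 - lg_A E - x1 - x2 \in F by rewrite exprMn; mem_closed.
split=> //; exists (- (c * ((w * c) ^+ 2 - lg_A E - x1 - x2 - x1) + d)); last by ring.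
by rewrite rpredN rpredD // rpredM // rpredB.
Qed.

(** The slope is [w] times an element of [F]; for a tangent it is w f'(x1) / (2 w^2 d1), whose
    denominator involves only w^2. *)
Lemma twisted_over_add w (P Q : option (K * K)) : w ^+ 2 \in F -> on_curve W P -> on_curve W Q ->
  twisted_over w P -> twisted_over w Q -> twisted_over w (coord_add W P Q).
Proof.
move=> wF cP cQ; move: (lg_addP cP cQ) => sp; case: sp => {P Q cP cQ} //.
move=> l x1 y1 x2 y2 y2E slope generic [x1F [d1 d1F y1E]] [x2F [d2 d2F y2E']].
have AF := lg_A_mem; have BF := lg_B_mem.
have [x12|/negPn/eqP x12] := boolP (x1 != x2).
  have nz : x2 - x1 != 0 by rewrite subr_eq0 eq_sym.
  apply: (@twisted_over_line w l ((d2 - d1) / (x2 - x1))) => //; [|by mem_closed|by exists d1].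
  apply: (mulIf nz); rewrite -mulrA divfK // [in RHS]mulrBr -y1E -y2E' y2E; ring.
subst x2; rewrite eqxx /= in generic; rewrite y1E in generic slope.
move: generic; rewrite mulf_eq0 negb_or => /andP[w0 d10].
pose G := x1 ^+ 2 + x1 * x1 + x1 ^+ 2 + lg_A E * (x1 + x1) + lg_B E.
have GF : G \in F by rewrite /G; mem_closed.
apply: (@twisted_over_line w l (G / (2 * w ^+ 2 * d1))) => //; [|by mem_closed|by exists d1].
rewrite /G -slope; field.
by rewrite w0 d10 lg_char2.
Qed.

Lemma twisted_over_mulrn w P n : w ^+ 2 \in F ->
  twisted_over w (val P) -> twisted_over w (val (P *+ n)).
Proof.
move=> wF hP; elim: n => [|n IHn]; first by rewrite mulr0n.
by rewrite mulrS val_lpD; apply: twisted_over_add; rewrite ?valP.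
Qed.

Definition rational_over (P : lpoint E) : Prop := twisted_over 1 (val P).

Lemma rational_overP P x y : val P = Some (x, y) ->
  rational_over P <-> x \in F /\ y \in F.
Proof.
rewrite /rational_over => ->; split=> -[xF]; last by move=> yF; split=> //; exists y; rewrite ?mul1r.
by case=> d dF ->; rewrite mul1r.
Qed.

Lemma rational_over0 : rational_over 0.
Proof. by []. Qed.

Lemma rational_overD P Q : rational_over P -> rational_over Q -> rational_over (P + Q).
Proof.
by move=> hP hQ; apply: twisted_over_add; rewrite ?valP // expr1n rpred1.
Qed.

Lemma rational_overN P : rational_over P -> rational_over (- P).
Proof.
rewrite /rational_over val_lpN; case: (val P) => [[x y]|//]; rewrite lg_oppE.
by case=> xF [d dF ->]; split=> //; exists (- d); rewrite ?rpredN ?mulrN.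
Qed.

Lemma lpoint_y0 P x : val P = Some (x, 0) -> P *+ 2 = 0.
Proof.
move=> PE; apply: val_inj; rewrite mulr2n val_lpD PE.
by have := lg_add_opp E x 0; rewrite oppr0.
Qed.

(** An ordinate lying both in [F] and in w F is 0. *)
Lemma rational_twisted w P : w \notin F -> rational_over P ->
  twisted_over w (val P) -> P *+ 2 = 0.
Proof.
move=> wF; case PE : (val P) => [[x y]|]; last first.
  by move=> _ _; have -> : P = 0; [apply: val_inj; exact: PE|rewrite mul0rn].
move=> /(rational_overP PE)[_ yF] [_ [c cF yE]].
have c0 : c = 0.
  by apply: contraNeq wF => c0; rewrite -(mulfK c0 w) -yE rpred_div.
by apply: (@lpoint_y0 P x); rewrite PE yE c0 mulr0.
Qed.

End PointsOverSubfield.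

Section IndependentPoint.
Variables (K : fieldType) (E : legendre K) (O : subringClosed K) (F : divringClosed K).
Local Notation m := (maximal_ideal O).
Local Notation a := (lg_a E).
Local Notation b := (lg_b E).
Variables (t : K) (p : nat).
Hypotheses (valO : valuation_ring O) (t0 : t != 0) (tm : t \in m)
  (p_prime : prime p) (p_odd : odd p) (pm : p%:R \in m).
Hypotheses (finK : finite_square_classes (predT : {pred K}))
  (infF : ~ finite_square_classes F).
Hypotheses (tF : t \in F) (aF : a \in F) (bF : b \in F)
  (torsF : forall Q : lpoint E, Q *+ p = 0 -> rational_over F Q).

Lemma exists_new_point : exists (P : lpoint E) (x y : K), [/\ val P = Some (x, y),
  x \in F, y \notin F, x != 0 & lg_A E / x \in m /\ lg_B E / x ^+ 2 \in m].
Proof.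
have T_closed : GRing.divring_closed (predT : {pred K}) by [].
have [w [_ wF] w2F] := @new_square _ F (mk_subfield T_closed) (fun _ _ => isT) finK infF.
have w0 : w != 0 by apply: contraNneq wF => ->; exact: rpred0.
pose h := w ^+ 2; have h0 : h != 0 by rewrite expf_neq0.
have hsq u : u \in F -> u ^+ 2 != h.
  by move=> uF; apply: contraNneq wF => e; apply: sqr_mem_eq uF.
have [N [hN sqN MN NN]] := quadratic_character w2F h0 hsq.
have [C [c0 hc]] := finK.
pose c z := (c0 z, z \in N).
(* The first list gives q, q - r a, q - r b the colour of h r; the second makes r / q, a r / q and b
   r / q small, so that x = q / r is large. *)
have [||q [r [qF rF [q0 r0] small mono]]] := @brauer _ O F t valO tF t0 tm
    [:: 0; - a; - b] [:: 1; a; b] h _ c _ _ w2F h0.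
- by move=> x; rewrite !inE => /or3P[]/eqP->; mem_closed.
- by move=> x; rewrite !inE => /or3P[]/eqP->; mem_closed.
have ratio e : e \in [:: 0; - a; - b] -> exists u, [/\ q + r * e != 0,
    q + r * e = h * r * u ^+ 2 & (q + r * e) * (h * r) \in N].
  move=> eE; have eF : e \in F.
    by move: eE; rewrite !inE => /or3P[]/eqP->; mem_closed.
  have em : e * (r / q) \in m.
    move: eE; rewrite !inE => /or3P[]/eqP->.
    - by rewrite mul0r maximal_ideal0.
    - by rewrite mulNr maximal_idealN // small // !inE eqxx orbT.
    - by rewrite mulNr maximal_idealN // small // !inE eqxx !orbT.
  have nz : q + r * e != 0.
    rewrite (_ : _ + _ = q * (1 + e * (r / q))); last by field.
    rewrite mulf_neq0 //.
    by have [] := unit_of_notin_maximal_ideal (add_one_notin_maximal_ideal valO em).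
  have hr0 : h * r != 0 by rewrite mulf_neq0.
  have /pair_equal_spec[e1 e2] := mono e eE.
  have [u _ uE] := hc _ _ isT isT nz hr0 e1.
  by exists u; split=> //; apply: NN => //; mem_closed.
have [u1 [n1 e1 N1]] := ratio 0 (mem_head _ _).
have ain : - a \in [:: 0; - a; - b] by rewrite !inE eqxx orbT.
have [u2 [n2 e2 N2]] := ratio _ ain.
have bin : - b \in [:: 0; - a; - b] by rewrite !inE eqxx !orbT.
have [u3 [n3 e3 N3]] := ratio _ bin.
(* Multiplying the three ratios gives f(x) = h^3 (u1 u2 u3)^2, and h = w^2. *)
pose x := q / r; pose y := h * w * u1 * u2 * u3.
have xF : x \in F by rewrite rpred_div.
have x0 : x != 0 by rewrite mulf_neq0 ?invr_neq0.
(* By the first colouring, f(x) is a square in K; by the second one it is not a square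
   in F, as it lies in h N modulo squares. *)
have fx : lg_cubic E x = (q + r * 0) * (q + r * - a) * (q + r * - b) / r ^+ 3.
  by rewrite lg_cubicE /x; field.
have xy : y ^+ 2 = lg_cubic E x.
  by rewrite fx e1 e2 e3 /y /h; field.
have y0 : y != 0.
  apply: contraNneq n1 => y0; move/eqP: xy; rewrite y0 expr0n eq_sym fx.
  by rewrite !mulf_eq0 invr_eq0 expf_eq0 (negPf r0) (negPf n2) (negPf n3) /= !orbF.
have xyW : on_curve (lg_weierstrass E) (Some (x, y)) by apply/on_lgP.
exists (exist _ (Some (x, y)) xyW), x, y; split=> //.
- apply: contra hN => yF.
  have := MN _ _ (MN _ _ N1 N2) N3.
  have -> : (q + r * 0) * (h * r) * ((q + r * - a) * (h * r)) * ((q + r * - b) * (h * r))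
      = (y * r ^+ 3 * h) ^+ 2 * h.
    transitivity (lg_cubic E x * r ^+ 6 * h ^+ 3); first by rewrite fx; field.
    by rewrite -xy; ring.
  have vF : y * r ^+ 3 * h \in F by mem_closed.
  have v0 : y * r ^+ 3 * h != 0 by apply: mulf_neq0 => //; apply: mulf_neq0 => //; exact: expf_neq0.
  move=> hN'; have := MN _ _ hN' (sqN (y * r ^+ 3 * h)^-1 _ _).
  rewrite rpredV vF invr_eq0 v0 => /(_ isT isT).
  by rewrite exprVn mulrAC divff ?mul1r // expf_neq0.
have am : a * (r / q) \in m by rewrite small // !inE eqxx orbT.
have bm : b * (r / q) \in m by rewrite small // !inE eqxx !orbT.
split.
  have -> : lg_A E / x = - (a * (r / q) + b * (r / q)).
    by rewrite /lg_A /x; field; rewrite q0 r0.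
  by rewrite maximal_idealN // maximal_idealD.
have -> : lg_B E / x ^+ 2 = (a * (r / q)) * (b * (r / q)).
  by rewrite /lg_B /x; field; rewrite q0 r0.
by rewrite maximal_idealMr // maximal_ideal_sub.
Qed.

Lemma exists_independent_point : exists (P : lpoint E) (x y : K), [/\ val P = Some (x, y),
  x \in F, y \notin F & forall k, rational_over F (P *+ k) -> k = 0].
Proof.
have [P [x [y [PE xF yF x0 [Am Bm]]]]] := exists_new_point.
exists P, x, y; split=> // k kP; apply: contrapT => /eqP k0.
have y2F : y ^+ 2 \in F.
  have -> : y ^+ 2 = lg_cubic E x by exact: lpoint_eqn PE.
  by rewrite lg_cubicE; mem_closed.
have twP n : twisted_over F y (val (P *+ n)).
  apply: twisted_over_mulrn => //; rewrite PE; split=> //.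
  by exists 1; rewrite ?rpred1 ?mulr1.
have P2 n : rational_over F (P *+ n) -> P *+ n *+ 2 = 0.
  by move=> nP; exact: rational_twisted yF nP (twP n).
have [n [n_gt0 nP min]] : exists n, [/\ (0 < n)%N, P *+ n = 0 &
    forall i, (0 < i)%N -> P *+ i = 0 -> (n <= i)%N].
  have ex : exists n, (0 < n)%N && (P *+ n == 0).
    by exists (k * 2)%N; rewrite muln_gt0 lt0n k0 mulrnA P2.
  exists (ex_minn ex); case: ex_minnP => n /andP[n_gt0 /eqP nP] min; split=> // i i0 iP.
  by apply: min; rewrite i0 iP eqxx.
have nm : n%:R \in m by exact: mulrn_eq0_near_origin PE x0 Am Bm nP.
(* Otherwise 1 is an integral combination of n and p, both in the maximal ideal. *)
have pn : (p %| n)%N.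
  apply: contraT => pn; have cop : coprime p n by rewrite prime_coprime.
  have [u v uv _] := egcdnP n (prime_gt0 p_prime).
  have e : u%:R * p%:R = v%:R * n%:R + 1 :> K by rewrite -!natrM uv (eqP cop) natrD.
  case/negP: (maximal_ideal1 O); rewrite (_ : 1 = u%:R * p%:R - v%:R * n%:R).
    by apply: maximal_idealB => //; apply: maximal_idealM => //; exact: rpred_nat.
  by rewrite e; ring.
pose i := (n %/ p)%N; have ni : n = (i * p)%N by rewrite divnK.
have i_gt0 : (0 < i)%N by rewrite divn_gt0 ?prime_gt0 // dvdn_leq.
have iP0 : P *+ i *+ p = 0 by rewrite -mulrnA -ni.
have iP2 := P2 _ (torsF iP0).
(* The point i P is killed by p and by 2, hence is 0; but i = n / p is smaller than the order n. *)
have : P *+ i = 0.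
  rewrite -[RHS]iP0 -(odd_double_half p) p_odd -mul2n mulrnDr mulr1n.
  by rewrite [_ *+ (2 * _)]mulrnA iP2 mul0rn addr0.
move/(min _ i_gt0); rewrite ni leqNgt.
by rewrite -[X in (X < _)%N]muln1 ltn_pmul2l // prime_gt1.
Qed.

End IndependentPoint.

(** * The base field *)

Section FiniteSubfields.
Variable K : fieldType.

Definition enumerates (l : seq K) (F : {pred K}) := {subset F <= l}.

Lemma finite_subring_inv (A : subringClosed K) (l : seq K) x :
  enumerates l A -> x \in A -> x^-1 \in A.
Proof.
move=> lA xA; have [->|x0] := eqVneq x 0; first by rewrite invr0 rpred0.
have : ~~ uniq [seq x ^+ i | i <- iota 0 (size l).+1].
  apply/negP => u; suff /(uniq_leq_size u) : {subset [seq x ^+ i | i <- iota 0 (size l).+1] <= l}.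
    by rewrite size_map size_iota ltnn.
  by move=> _ /mapP[i _ ->]; apply: lA; exact: rpredX.
case/(uniqPn 0) => i [j [ij]]; rewrite size_map size_iota => jl.
rewrite !(nth_map 0%N) ?size_iota //; last exact: ltn_trans jl.
rewrite !nth_iota //; last exact: ltn_trans jl.
rewrite !add0n => e.
have -> : x^-1 = x ^+ (j - i).-1; last exact: rpredX.
apply: (mulfI x0); rewrite divff // -exprS prednK ?subn_gt0 //.
apply: (mulfI (expf_neq0 i x0)); rewrite mulr1 -exprD subnKC //; exact: ltnW.
Qed.

Lemma finite_adjoin (F : divringClosed K) (l : seq K) (m : {poly K}) x :
  enumerates l F -> m \is a polyOver F -> m != 0 -> root m x ->
  exists (M : divringClosed K) (l' : seq K),
    [/\ enumerates l' M, {subset F <= M} & x \in M].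
Proof.
move=> lF mF m0 mx.
pose A : {pred K} := fun z => `[< exists r : {poly K}, r \is a polyOver F /\ r.[x] = z >].
have AP z : reflect (exists r : {poly K}, r \is a polyOver F /\ r.[x] = z) (z \in A).
  exact: asboolP.
have A_closed : GRing.subring_closed A.
  split=> [|_ _ /AP[r [rF <-]] /AP[s [sF <-]]|_ _ /AP[r [rF <-]] /AP[s [sF <-]]]; apply/AP.
  - by exists 1; rewrite rpred1 hornerC.
  - by exists (r - s); rewrite rpredB // !hornerE.
  - by exists (r * s); rewrite rpredM // !hornerE.
pose d := size m.
pose ev (f : {ffun 'I_d -> 'I_(size l)}) := \sum_(i < d) nth 0 l (f i) * x ^+ i.
have lA : enumerates (codom ev) A.
  move=> _ /AP[r [rF <-]]; have [s [sF sd <-]] := reduce_modulo mF m0 mx rF.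
  have idx (i : 'I_d) : (index (s`_i)%R l < size l)%N.
    by rewrite index_mem; apply: lF; exact: (polyOverP sF).
  apply/codomP; exists [ffun i => Ordinal (idx i)].
  rewrite (horner_coef_wide _ (ltnW sd)); apply: eq_bigr => i _.
  by rewrite ffunE /= nth_index //; apply: lF; exact: (polyOverP sF).
pose A' := mk_subring A_closed.
have A'_closed : GRing.divring_closed A.
  have [A1 AB AM] := A_closed; split=> // y z yA zA; apply: (AM) => //.
  by have /(_ zA) := @finite_subring_inv A' _ z lA.
exists (mk_subfield A'_closed), (codom ev); split=> //.
- by move=> z zF; apply/AP; exists z%:P; rewrite polyOverC hornerC.
- by apply/AP; exists 'X; rewrite polyOverX hornerX.
Qed.

Lemma prime_field_pchar (p : nat) : p \in [pchar K] ->
  enumerates [seq i%:R | i <- iota 0 p] (prime_field K).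
Proof.
move=> cp; have p_prime := pcharf_prime cp; have p_gt0 := prime_gt0 p_prime.
have p0 : p%:R = 0 :> K by exact: pcharf0.
pose A : {pred K} := fun z => `[< exists n : nat, z = n%:R >].
have AP z : reflect (exists n : nat, z = n%:R) (z \in A) by exact: asboolP.
have A_closed : GRing.subring_closed A.
  split=> [|_ _ /AP[i ->] /AP[j ->]|_ _ /AP[i ->] /AP[j ->]]; apply/AP.
  - by exists 1%N.
  - exists (i + p.-1 * j)%N; rewrite natrD natrM -subn1 natrB // p0; ring.
  - by exists (i * j)%N; rewrite natrM.
pose A' := mk_subring A_closed.
have lA : enumerates [seq i%:R | i <- iota 0 p] A'.
  move=> _ /AP[n ->]; rewrite -(GRing.natr_mod_pchar cp); apply: map_f.
  by rewrite mem_iota /= ltn_mod.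
move=> _ /prime_field_predP[a [b [_ ->]]]; apply: (lA).
by rewrite rpredM ?rpred_int // (finite_subring_inv lA) // rpred_int.
Qed.

Lemma locally_finite_of_algebraic (p : nat) : p \in [pchar K] ->
  (forall x : K, exists m : {poly K},
     [/\ m \is a polyOver (prime_field K), m != 0 & root m x]) ->
  locally_finite K.
Proof.
move=> cp alg s.
suff [F [l [lF sF]]] : exists (F : divringClosed K) (l : seq K),
    [/\ enumerates l F & {subset s <= F}].
  apply: (@sub_finite_set _ _ [set` l]); last exact: finite_seq.
  move=> x /(_ [set z | z \in F]) h; apply: lF; apply: h; split; last by move=> z /sF.
  split; first by rewrite mem_setE rpred1.
    by move=> y z; rewrite !mem_setE; exact: rpredB.
  by move=> y z; rewrite !mem_setE; exact: rpred_div.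
suff [F [l [lF _ sF]]] : exists (F : divringClosed K) (l : seq K),
    [/\ enumerates l F, {subset prime_field K <= F} & {subset s <= F}].
  by exists F, l.
elim: s => [|x s [F [l [lF PF sF]]]].
  by exists (prime_field K), [seq i%:R | i <- iota 0 p]; split=> //; exact: prime_field_pchar.
have [m [mP m0 mx]] := alg x.
have mF : m \is a polyOver F by exact: polyOverS mP.
have [M [l' [lM FM xM]]] := finite_adjoin lF mF m0 mx.
exists M, l'; split=> // [y /PF/FM //|y].
by rewrite inE => /predU1P[->|/sF/FM].
Qed.

End FiniteSubfields.

(* The prime p is 3 in characteristic 0 and the characteristic otherwise. *)
Theorem exists_base_field (K L : fieldType) (iota : {rmorphism K -> L}) :
  separably_closed L -> 2 != 0 :> K -> ~ locally_finite K ->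
  exists (O : subringClosed K) (t : K) (p : nat) (F : divringClosed K),
    [/\ valuation_ring O, t != 0 /\ t \in maximal_ideal O,
      [/\ prime p, odd p & p%:R \in maximal_ideal O],
      t \in F & ~ finite_square_classes F].
Proof.
move=> closed char2 nlf.
have val_t (O : subringClosed K) (t : K) : t != 0 -> t^-1 \notin O -> t \in maximal_ideal O.
  by move=> t0 tO; rewrite maximal_idealE tO orbT.
have [char0|/existsNP[n /negP]] := pselect (forall n, n.+1%:R != 0 :> K).
  (* In characteristic 0 the starting ring is the image of the integers, where 3 is not
     invertible. *)
  pose S_pred : {pred K} := fun x => `[< exists a : int, x = a%:~R >].
  have SP x : reflect (exists a : int, x = a%:~R) (x \in S_pred) by exact: asboolP.
  have S_closed : GRing.subring_closed S_pred.
    split=> [|_ _ /SP[a ->] /SP[b ->]|_ _ /SP[a ->] /SP[b ->]]; apply/SP.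
    - by exists 1.
    - by exists (a - b); rewrite rmorphB.
    - by exists (a * b); rewrite rmorphM.
  have t0 : 3 != 0 :> K by exact: char0.
  have tS : 3 \in mk_subring S_closed by apply/SP; exists 3.
  have tVS : 3^-1 \notin mk_subring S_closed.
    apply/negP => /SP[a e].
    have int0 (z : int) : (z%:~R == 0 :> K) = (z == 0).
      case: z => [[|k]|k]; rewrite ?eqxx // ?(negPf (char0 _)) //.
      by rewrite NegzE rmorphN /= oppr_eq0 (negPf (char0 _)).
    have : (3 * a - 1)%:~R == 0 :> K by rewrite rmorphB rmorphM /= -e divff // subrr.
    by rewrite int0 subr_eq0 => /eqP; lia.
  have [O [SO valO tO]] := chevalley t0 tS tVS.
  exists O, 3, 3%N, (prime_field K); split=> //.
  - by split=> //; exact: val_t.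
  - by split=> //; exact: val_t.
  - exact: rpred_nat.
  - exact: prime_field_infinite_square_classes.
rewrite negbK => n0.
have [p cp] := natf0_pchar (ltn0Sn n) n0.
have p_prime := pcharf_prime cp.
have p_odd : odd p.
  have [p2|//] := even_prime p_prime.
  by move: char2; rewrite -p2 (pcharf0 cp) eqxx.
have [t trs] : exists t : K, forall m : {poly K}, m \is a polyOver (prime_field K) ->
    root m t -> m = 0.
  apply: contrapT => no; apply: nlf; apply: (locally_finite_of_algebraic cp) => x.
  apply: contrapT => nx; apply: no; exists x => m mP mx; apply: contrapT => /eqP m0.
  by apply: nx; exists m.
(* In positive characteristic the starting ring is the polynomial ring in [t] over the prime field,
   where [t] is not invertible. *)
pose S_pred : {pred K} := fun x => `[< exists q : {poly K},
  q \is a polyOver (prime_field K) /\ x = q.[t] >].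
have SP x : reflect (exists q : {poly K}, q \is a polyOver (prime_field K) /\ x = q.[t])
  (x \in S_pred) by exact: asboolP.
have S_closed : GRing.subring_closed S_pred.
  split=> [|_ _ /SP[a [aP ->]] /SP[b [bP ->]]|_ _ /SP[a [aP ->]] /SP[b [bP ->]]]; apply/SP.
  - by exists 1; rewrite rpred1 hornerC.
  - by exists (a - b); rewrite rpredB // !hornerE.
  - by exists (a * b); rewrite rpredM // !hornerE.
have t0 : t != 0.
  apply/eqP => t0; have := trs 'X (polyOverX _).
  by rewrite t0 rootX eqxx => /(_ isT)/eqP; rewrite polyX_eq0.
have tS : t \in mk_subring S_closed by apply/SP; exists 'X; rewrite polyOverX hornerX.
have tVS : t^-1 \notin mk_subring S_closed.
  apply/negP => /SP[q [qP e]].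
  have h : 'X * q - 1 = 0.
    apply: trs; first by rewrite rpredB ?rpred1 // rpredM // polyOverX.
    by rewrite /root !hornerE -e divff // subrr.
  have := congr1 (horner^~ 0) h; rewrite !hornerE => /eqP.
  by rewrite oppr_eq0 oner_eq0.
have [O [SO valO tO]] := chevalley t0 tS tVS.
exists O, t, p, (adjoin (prime_field K) t); split=> //.
- by split=> //; exact: val_t.
- by split=> //; rewrite (pcharf0 cp) maximal_ideal0.
- exact: adjoin_gen.
- exact: (transcendental_infinite_square_classes iota closed trs).
Qed.


(** * Reduction to Legendre form *)

Section LegendreForm.
Variables (K : fieldType) (W : weierstrass K).
Hypothesis char2 : 2 != 0 :> K.
Local Notation a1 := (w_a1 W).
Local Notation a2 := (w_a2 W).
Local Notation a3 := (w_a3 W).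
Local Notation a4 := (w_a4 W).
Local Notation a6 := (w_a6 W).

(** This is 4 x^3 + b2 x^2 + 2 b4 x + b6, equal to (2 y + a1 x + a3)^2 on the curve. *)
Definition two_division_cubic (x : K) :=
  4 * x ^+ 3 + (a1 ^+ 2 + 4 * a2) * x ^+ 2 + (2 * a1 * a3 + 4 * a4) * x + a3 ^+ 2 + 4 * a6.

Lemma two_torsion_coord x y : on_curve W (Some (x, y)) ->
  coord_add W (Some (x, y)) (Some (x, y)) = None ->
  2 * y + a1 * x + a3 = 0 /\ two_division_cubic x = 0.
Proof.
move=> /eqP c; rewrite /coord_add eqxx /=; case: ifP => // /eqP[yE] _.
have e : 2 * y + a1 * x + a3 = 0.
  by transitivity (y - (- y - a1 * x - a3)); [ring|rewrite -yE subrr].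
split=> //; rewrite /two_division_cubic.
transitivity (4 * (x ^+ 3 + a2 * x ^+ 2 + a4 * x + a6) + (a1 * x + a3) ^+ 2); first by ring.
rewrite -c; transitivity ((2 * y + a1 * x + a3) ^+ 2); first by ring.
by rewrite e expr0n.
Qed.

Variables (E : legendre K) (e : K).
Local Notation A := (lg_A E).
Local Notation B := (lg_B E).
Hypotheses (e2 : a1 ^+ 2 + 4 * a2 = 4 * (A - 3 * e))
  (e4 : 2 * a1 * a3 + 4 * a4 = 4 * (3 * e ^+ 2 - 2 * A * e + B))
  (e6 : a3 ^+ 2 + 4 * a6 = 4 * (- e ^+ 3 + A * e ^+ 2 - B * e)).

(** The square is completed and a root [e] is moved to 0; [e2], [e4], [e6] say that the two-division
    cubic at x is 4 f(x - e). *)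
Definition to_legendre (P : option (K * K)) : option (K * K) :=
  if P is Some (x, y) then Some (x - e, y + (a1 * x + a3) / 2) else None.

Definition of_legendre (P : option (K * K)) : option (K * K) :=
  if P is Some (x, y) then Some (x + e, y - (a1 * (x + e) + a3) / 2) else None.

Lemma to_legendreK : cancel to_legendre of_legendre.
Proof. by case=> [[x y]|] //=; congr (Some (_, _)); ring. Qed.

Lemma of_legendreK : cancel of_legendre to_legendre.
Proof. by case=> [[x y]|] //=; congr (Some (_, _)); ring. Qed.

Lemma four_neq0 : 4 != 0 :> K.
Proof. by rewrite (_ : 4 = 2 * 2) ?mulf_neq0 //; ring. Qed.

Lemma a2E : a2 = A - 3 * e - a1 ^+ 2 / 4.
Proof.
have c4 := four_neq0.
by apply: (mulfI c4); rewrite mulrBr -e2; field.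
Qed.

Lemma a4E : a4 = 3 * e ^+ 2 - 2 * A * e + B - a1 * a3 / 2.
Proof.
have c4 := four_neq0.
by apply: (mulfI c4); rewrite mulrBr -e4; field.
Qed.

Lemma a6E : a6 = - e ^+ 3 + A * e ^+ 2 - B * e - a3 ^+ 2 / 4.
Proof.
have c4 := four_neq0.
by apply: (mulfI c4); rewrite mulrBr -e6; field.
Qed.

Lemma on_curve_to_legendre P :
  on_curve (lg_weierstrass E) (to_legendre P) = on_curve W P.
Proof.
case: P => [[x y]|] //=; rewrite a2E a4E a6E.
rewrite -[LHS]subr_eq0 -[RHS]subr_eq0; congr (_ == 0); field.
by rewrite four_neq0 char2.
Qed.

(** The change of coordinates is affine and carries a line of slope l to one of slope l + a1 / 2. *)
Lemma to_legendre_add P Q : on_curve W P -> on_curve W Q ->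
  to_legendre (coord_add W P Q) =
  coord_add (lg_weierstrass E) (to_legendre P) (to_legendre Q).
Proof.
case: P Q => [[x1 y1]|] [[x2 y2]|] // c1 c2.
have lineE l : to_legendre (coord_line W l x1 y1 x2) =
    lg_line E (l + a1 / 2) (x1 - e) (y1 + (a1 * x1 + a3) / 2) (x2 - e).
  by rewrite /= /lg_line a2E; congr (Some (_, _)); field; rewrite ?four_neq0 ?char2.
have [x12|/negPn/eqP x12] := boolP (x1 != x2).
  have x12' : x1 - e != x2 - e by rewrite (inj_eq (addIr _)).
  have d : x2 - x1 != 0 by rewrite subr_eq0 eq_sym.
  rewrite {1}/coord_add x12 lineE [RHS]lg_add_chord //.
  congr (lg_line E _ _ _ _); field; rewrite char2 andbT.
  by rewrite (_ : x2 - e - (x1 - e) = x2 - x1) //; ring.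
subst x2.
have /on_lgP c1' : on_curve (lg_weierstrass E) (to_legendre (Some (x1, y1))).
  by rewrite on_curve_to_legendre.
have /on_lgP c2' : on_curve (lg_weierstrass E) (to_legendre (Some (x1, y2))).
  by rewrite on_curve_to_legendre.
rewrite {1}/coord_add eqxx; case: ifPn => [/eqP[->]|nopp].
  have yE : - y2 - a1 * x1 - a3 + (a1 * x1 + a3) / 2 = - (y2 + (a1 * x1 + a3) / 2).
    by field.
  have := lg_add_opp E (x1 - e) (- (y2 + (a1 * x1 + a3) / 2)).
  by rewrite opprK /to_legendre yE => ->.
have /eqP : (y1 + (a1 * x1 + a3) / 2) ^+ 2 = (y2 + (a1 * x1 + a3) / 2) ^+ 2.
  by rewrite c1' c2'.
rewrite eqf_sqr => /orP[/eqP/addIr y12|/eqP y12]; last first.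
  case/eqP: nopp; congr (Some (_, _)).
  by apply: (addIr ((a1 * x1 + a3) / 2)); rewrite y12; field.
subst y2.
have y0 : 2 * y1 + a1 * x1 + a3 != 0.
  apply: contra nopp => /eqP h; apply/eqP; congr (Some (_, _)).
  by apply/eqP; rewrite -subr_eq0 -h; apply/eqP; ring.
have Y0 : y1 + (a1 * x1 + a3) / 2 != 0.
  apply: contra_neq y0 => h; transitivity (2 * (y1 + (a1 * x1 + a3) / 2)); first by field.
  by rewrite h mulr0.
rewrite lineE [RHS]lg_add_double //; congr (lg_line E _ _ _ _).
rewrite a2E a4E; field.
rewrite four_neq0 char2 andbT /=.
by rewrite (_ : _ + _ = 2 * y1 + a1 * x1 + a3) //; ring.
Qed.

End LegendreForm.

Lemma two_division_roots (K : fieldType) (c2 c4 c6 e1 e2 e3 : K) :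
  4 != 0 :> K -> e1 != e2 -> e1 != e3 -> e2 != e3 ->
  4 * e1 ^+ 3 + c2 * e1 ^+ 2 + c4 * e1 + c6 = 0 ->
  4 * e2 ^+ 3 + c2 * e2 ^+ 2 + c4 * e2 + c6 = 0 ->
  4 * e3 ^+ 3 + c2 * e3 ^+ 2 + c4 * e3 + c6 = 0 ->
  [/\ c2 = - 4 * (e1 + e2 + e3), c4 = 4 * (e1 * e2 + e1 * e3 + e2 * e3) &
    c6 = - 4 * (e1 * e2 * e3)].
Proof.
move=> c40 e12 e13 e23 h1 h2 h3.
have d12 : e1 - e2 != 0 by rewrite subr_eq0.
have d13 : e1 - e3 != 0 by rewrite subr_eq0.
have d23 : e2 - e3 != 0 by rewrite subr_eq0.
have q12 : 4 * (e1 ^+ 2 + e1 * e2 + e2 ^+ 2) + c2 * (e1 + e2) + c4 = 0.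
  apply: (mulfI d12); rewrite mulr0 -[RHS](subrr 0) -{1}h1 -h2; ring.
have q13 : 4 * (e1 ^+ 2 + e1 * e3 + e3 ^+ 2) + c2 * (e1 + e3) + c4 = 0.
  apply: (mulfI d13); rewrite mulr0 -[RHS](subrr 0) -{1}h1 -h3; ring.
have c2E : c2 = - 4 * (e1 + e2 + e3).
  apply: (mulfI d23); apply/eqP; rewrite -subr_eq0; apply/eqP.
  rewrite -[RHS](subrr 0) -{1}q12 -q13; ring.
have c4E : c4 = 4 * (e1 * e2 + e1 * e3 + e2 * e3).
  by apply/eqP; rewrite -subr_eq0; apply/eqP; rewrite -q12 c2E; ring.
split=> //; apply/eqP; rewrite -subr_eq0; apply/eqP; rewrite -h1 c2E c4E; ring.
Qed.

Theorem legendre_form (K : fieldType) (E0 : elliptic_curve K) :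
  2 != 0 :> K -> has_full_two_torsion E0 ->
  exists (E : legendre K) (phi : ec_point E0 -> lpoint E) (psi : lpoint E -> ec_point E0),
    [/\ cancel phi psi, cancel psi phi, phi 0 = 0 &
      forall P Q, phi (P + Q) = phi P + phi Q].
Proof.
move=> char2 [f [f_inj f_range]].
have tors u : u != 0 -> exists x y, [/\ val (f u) = Some (x, y),
    2 * y + w_a1 E0 * x + w_a3 E0 = 0 & two_division_cubic E0 x = 0].
  move=> u0; have fu2 : f u *+ 2 = 0.
    have : range f (f u) by exists u.
    by rewrite f_range.
  have fu0 : f u != 0 by apply: contra_neq u0 => e; apply: f_inj; rewrite e raddf0.
  case fuE : (val (f u)) => [[x y]|]; last first.
    by case/eqP: fu0; apply: val_inj.
  exists x, y; have c := valP (f u); rewrite fuE in c.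
  have /(congr1 val) /= := fu2; rewrite fuE => e.
  by have [] := two_torsion_coord c e.
(* An affine point killed by 2 is determined by its abscissa, so the three nonzero elements yield
   three distinct roots of the cubic. *)
have inj_x u v x y y' : val (f u) = Some (x, y) -> val (f v) = Some (x, y') ->
    2 * y + w_a1 E0 * x + w_a3 E0 = 0 -> 2 * y' + w_a1 E0 * x + w_a3 E0 = 0 -> u = v.
  move=> fu fv e e'; apply: f_inj; apply: val_inj; rewrite fu fv; congr (Some (_, _)).
  apply: (mulfI char2); apply: (addIr (w_a1 E0 * x)); apply: (addIr (w_a3 E0)).
  by rewrite e e'.
have [x1 [y1 [f1 l1 c1]]] : _ := tors (1, 0) isT.
have [x2 [y2 [f2 l2 c2]]] : _ := tors (0, 1) isT.
have [x3 [y3 [f3 l3 c3]]] : _ := tors (1, 1) isT.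
have x12 : x1 != x2.
  by apply/eqP => x12; rewrite -x12 in f2 l2; have := inj_x _ _ _ _ _ f1 f2 l1 l2.
have x13 : x1 != x3.
  by apply/eqP => x13; rewrite -x13 in f3 l3; have := inj_x _ _ _ _ _ f1 f3 l1 l3.
have x23 : x2 != x3.
  by apply/eqP => x23; rewrite -x23 in f3 l3; have := inj_x _ _ _ _ _ f2 f3 l2 l3.
rewrite /two_division_cubic in c1 c2 c3.
have [||| e2 e4 e6] := two_division_roots (four_neq0 char2) x12 x13 x23
  (c2 := w_a1 E0 ^+ 2 + 4 * w_a2 E0) (c4 := 2 * w_a1 E0 * w_a3 E0 + 4 * w_a4 E0)
  (c6 := w_a3 E0 ^+ 2 + 4 * w_a6 E0).
- by rewrite -[RHS]c1; ring.
- by rewrite -[RHS]c2; ring.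
- by rewrite -[RHS]c3; ring.
have a0 : x2 - x1 != 0 by rewrite subr_eq0 eq_sym.
have b0 : x3 - x1 != 0 by rewrite subr_eq0 eq_sym.
have ab : x2 - x1 != x3 - x1 by rewrite (inj_eq (addIr _)).
pose E := Legendre char2 a0 b0 ab.
have h2 : w_a1 E0 ^+ 2 + 4 * w_a2 E0 = 4 * (lg_A E - 3 * x1).
  by rewrite e2 /lg_A /=; ring.
have h4 : 2 * w_a1 E0 * w_a3 E0 + 4 * w_a4 E0 =
    4 * (3 * x1 ^+ 2 - 2 * lg_A E * x1 + lg_B E).
  by rewrite e4 /lg_A /lg_B /=; ring.
have h6 : w_a3 E0 ^+ 2 + 4 * w_a6 E0 =
    4 * (- x1 ^+ 3 + lg_A E * x1 ^+ 2 - lg_B E * x1).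
  by rewrite e6 /lg_A /lg_B /=; ring.
have phi_on (P : ec_point E0) : on_curve (lg_weierstrass E) (to_legendre E0 x1 (val P)).
  by rewrite (on_curve_to_legendre char2 h2 h4 h6) (valP P).
have psi_on (Q : lpoint E) : on_curve E0 (of_legendre E0 x1 (val Q)).
  by rewrite -(on_curve_to_legendre char2 h2 h4 h6) of_legendreK (valP Q).
pose phi P : lpoint E := Sub (to_legendre E0 x1 (val P)) (phi_on P).
pose psi Q : ec_point E0 := Sub (of_legendre E0 x1 (val Q)) (psi_on Q).
exists E, phi, psi; split.
- by move=> P; apply: val_inj; rewrite /= to_legendreK.
- by move=> Q; apply: val_inj; rewrite /= of_legendreK.
- exact: val_inj.
- move=> P Q; apply: val_inj.
  exact: (to_legendre_add char2 h2 h4 h6 (valP P) (valP Q)).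
Qed.

(** * Tensor product with the rationals *)

(** The index n encodes the denominator n + 1, whence the shift. *)
Definition mul_denominators (m n : nat) : nat := (m.+1 * n.+1).-1.
Arguments mul_denominators : simpl never.

Lemma mul_denominatorsE m n : (mul_denominators m n).+1 = (m.+1 * n.+1)%N.
Proof. by []. Qed.

Section Localization.
Local Open Scope quotient_scope.
Variable A : zmodType.
Implicit Types (p q r : A * nat) (a b : A).

(* The pair (a, n) stands for a / (n + 1). *)
Definition loc_equiv p q : bool :=
  `[< exists k, (p.1 *+ q.2.+1 - q.1 *+ p.2.+1) *+ k.+1 = 0 >].

Lemma loc_equivP p q :
  reflect (exists k, (p.1 *+ q.2.+1 - q.1 *+ p.2.+1) *+ k.+1 = 0) (loc_equiv p q).
Proof. exact: asboolP. Qed.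

Fact loc_equiv_refl : reflexive loc_equiv.
Proof. by move=> p; apply/loc_equivP; exists 0%N; rewrite subrr. Qed.

Fact loc_equiv_sym : symmetric loc_equiv.
Proof.
by move=> p q; apply/loc_equivP/loc_equivP => -[k e]; exists k;
  rewrite -opprB mulNrn e oppr0.
Qed.

Fact loc_equiv_trans : transitive loc_equiv.
Proof.
move=> q p r /loc_equivP[k e] /loc_equivP[l e'].
apply/loc_equivP; exists (mul_denominators q.2 (mul_denominators k l)).
rewrite !mul_denominatorsE.
have -> : (p.1 *+ r.2.+1 - r.1 *+ p.2.+1) *+ (q.2.+1 * (k.+1 * l.+1)) =
    (p.1 *+ q.2.+1 - q.1 *+ p.2.+1) *+ k.+1 *+ (r.2.+1 * l.+1)
    + (q.1 *+ r.2.+1 - r.1 *+ q.2.+1) *+ l.+1 *+ (p.2.+1 * k.+1).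
  rewrite !mulrnBl -!mulrnA.
  set u := p.1; set v := q.1; set w := r.1.
  have E1 : (r.2.+1 * (q.2.+1 * (k.+1 * l.+1)) = q.2.+1 * (k.+1 * (r.2.+1 * l.+1)))%N by ring.
  have E2 : (p.2.+1 * (q.2.+1 * (k.+1 * l.+1)) = q.2.+1 * (l.+1 * (p.2.+1 * k.+1)))%N by ring.
  have E3 : (p.2.+1 * (k.+1 * (r.2.+1 * l.+1)) = r.2.+1 * (l.+1 * (p.2.+1 * k.+1)))%N by ring.
  by rewrite E1 E2 E3 addrA subrK.
by rewrite e e' !mul0rn addr0.
Qed.

Canonical loc_equiv_rel := EquivRel loc_equiv loc_equiv_refl loc_equiv_sym loc_equiv_trans.

Definition localization : Type := {eq_quot loc_equiv_rel}.
HB.instance Definition _ := Choice.on localization.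
HB.instance Definition _ := EqQuotient.on localization.

Lemma loc_eq p q : (\pi_localization p == \pi_localization q) = loc_equiv p q.
Proof. by rewrite eqmodE. Qed.

Lemma loc_repr p : loc_equiv (repr (\pi_localization p)) p.
Proof. by rewrite -loc_eq reprK. Qed.

Definition loc_add (v w : localization) : localization :=
  let p := repr v in let q := repr w in
  \pi_localization (p.1 *+ q.2.+1 + q.1 *+ p.2.+1, mul_denominators p.2 q.2).
Definition loc_opp (v : localization) : localization :=
  \pi_localization (- (repr v).1, (repr v).2).
Definition loc_zero : localization := \pi_localization (0, 0%N).

Lemma loc_addE p q : loc_add (\pi_localization p) (\pi_localization q) =
  \pi_localization (p.1 *+ q.2.+1 + q.1 *+ p.2.+1, mul_denominators p.2 q.2).
Proof.
rewrite /loc_add; move: (loc_repr p) (loc_repr q).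
move: (repr (\pi_localization p)) (repr (\pi_localization q)) => p' q'.
move=> /loc_equivP[k e] /loc_equivP[l e'].
apply/eqP; rewrite loc_eq; apply/loc_equivP => /=.
exists (mul_denominators k l).
rewrite -[((k.+1 * l.+1).-1.+1)%N]/((k.+1 * l.+1)%N).
rewrite -[((p'.2.+1 * q'.2.+1).-1.+1)%N]/((p'.2.+1 * q'.2.+1)%N).
rewrite -[((p.2.+1 * q.2.+1).-1.+1)%N]/((p.2.+1 * q.2.+1)%N).
transitivity ((p'.1 *+ p.2.+1 - p.1 *+ p'.2.+1) *+ k.+1 *+ (q'.2.+1 * q.2.+1 * l.+1)
    + (q'.1 *+ q.2.+1 - q.1 *+ q'.2.+1) *+ l.+1 *+ (p'.2.+1 * p.2.+1 * k.+1)); last first.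
  by rewrite e e' !mul0rn addr0.
rewrite !(mulrnDl, mulNrn, opprD) -!mulrnA [RHS]addrACA.
congr ((_ *+ _ + _ *+ _) + (- (_ *+ _) - _ *+ _)); ring.
Qed.

Lemma loc_oppE p : loc_opp (\pi_localization p) = \pi_localization (- p.1, p.2).
Proof.
rewrite /loc_opp; move: (loc_repr p); move: (repr _) => p' /loc_equivP[k e].
apply/eqP; rewrite loc_eq; apply/loc_equivP => /=; exists k.
by rewrite !mulNrn -opprD mulNrn e oppr0.
Qed.

Lemma loc_ind (P : localization -> Prop) :
  (forall p, P (\pi_localization p)) -> forall v, P v.
Proof. by move=> h v; rewrite -[v]reprK. Qed.

Lemma loc_pi_eq p q : p.1 *+ q.2.+1 = q.1 *+ p.2.+1 ->
  \pi_localization p = \pi_localization q.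
Proof.
by move=> e; apply/eqP; rewrite loc_eq; apply/loc_equivP; exists 0%N; rewrite e subrr.
Qed.

Fact loc_addA : associative loc_add.
Proof.
elim/loc_ind => p; elim/loc_ind => q; elim/loc_ind => r; rewrite !loc_addE.
apply: loc_pi_eq => /=.
rewrite !mul_denominatorsE.
rewrite !mulrnDl -!mulrnA !addrA; congr (_ *+ _ + _ *+ _ + _ *+ _); ring.
Qed.

Fact loc_addC : commutative loc_add.
Proof.
elim/loc_ind => p; elim/loc_ind => q; rewrite !loc_addE.
by apply: loc_pi_eq; rewrite /= addrC !mul_denominatorsE mulnC.
Qed.

Fact loc_add0 : left_id loc_zero loc_add.
Proof.
elim/loc_ind => p; rewrite /loc_zero loc_addE; apply: loc_pi_eq => /=.
by rewrite mul0rn add0r mulr1n mul_denominatorsE mul1n.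
Qed.

Fact loc_addN : left_inverse loc_zero loc_opp loc_add.
Proof.
elim/loc_ind => p; rewrite loc_oppE loc_addE; apply: loc_pi_eq => /=.
by rewrite mulNrn addNr !mul0rn.
Qed.

HB.instance Definition _ := GRing.isZmodule.Build localization
  loc_addA loc_addC loc_add0 loc_addN.

Definition loc_tau a : localization := \pi_localization (a, 0%N).

Fact loc_tau_zmod : zmod_morphism loc_tau.
Proof.
move=> a b; rewrite /loc_tau -[RHS]/(loc_add (\pi_localization (a, 0%N)) (loc_opp (\pi_localization (b, 0%N)))).
by rewrite loc_oppE loc_addE; apply: loc_pi_eq; rewrite /= !mulr1n.
Qed.
HB.instance Definition _ := GRing.isZmodMorphism.Build A localization loc_tau loc_tau_zmod.

Lemma loc_mulrn p n : \pi_localization p *+ n = \pi_localization (p.1 *+ n, p.2).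
Proof.
elim: n => [|n IHn].
  by rewrite mulr0n; apply: loc_pi_eq; rewrite /= !mul0rn.
rewrite mulrS IHn -[LHS]/(loc_add (\pi_localization p) (\pi_localization (p.1 *+ n, p.2))).
rewrite loc_addE; apply: loc_pi_eq => /=.
by rewrite mul_denominatorsE mulrnDl -!mulrnA -mulrnDr; congr (_ *+ _); ring.
Qed.

Lemma loc_torsion_free (v : localization) n : v *+ n.+1 = 0 -> v = 0.
Proof.
elim/loc_ind: v => p; rewrite loc_mulrn => /eqP.
rewrite -[X in _ == X]/(\pi_localization (0, 0%N)) loc_eq => /loc_equivP[k] /=.
rewrite mulr1n mul0rn subr0 -mulrnA => e.
apply/eqP; rewrite -[X in _ == X]/(\pi_localization (0, 0%N)) loc_eq.
apply/loc_equivP; exists (mul_denominators n k).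
by rewrite mul_denominatorsE /= mulr1n mul0rn subr0.
Qed.

Lemma loc_tau_eq0 a : loc_tau a = 0 -> exists k, a *+ k.+1 = 0.
Proof.
move/eqP; rewrite -[X in _ == X]/(\pi_localization (0, 0%N)) loc_eq => /loc_equivP[k] /=.
by rewrite mulr1n mul0rn subr0; exists k.
Qed.

Lemma loc_fraction (v : localization) : exists a n, v *+ n.+1 = loc_tau a.
Proof.
elim/loc_ind: v => -[a n]; exists a, n; rewrite loc_mulrn; apply: loc_pi_eq => /=.
by rewrite mulr1n.
Qed.

Lemma loc_divide (v : localization) n : exists w, w *+ n.+1 = v.
Proof.
elim/loc_ind: v => -[a m]; exists (\pi_localization (a, mul_denominators m n)).
rewrite loc_mulrn; apply: loc_pi_eq => /=.
by rewrite mul_denominatorsE -mulrnA mulnC.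
Qed.

Lemma loc_torsion_freez (v w : localization) (d : int) :
  d != 0 -> v *~ d = w *~ d -> v = w.
Proof.
move=> d0 e; apply/eqP; rewrite -subr_eq0; apply/eqP.
have : (v - w) *~ d = 0 by rewrite mulrzBl e subrr.
case: d d0 {e} => [[//|n] _|n _]; first exact: loc_torsion_free.
by rewrite NegzE mulrNz => /eqP; rewrite oppr_eq0 => /eqP; exact: loc_torsion_free.
Qed.

(** Existence is divisibility of the localization; the solution is unique by [loc_torsion_freez],
    and from this the module axioms follow. *)
Lemma loc_scale_subproof (x : rat) (v : localization) :
  exists w, w *~ denq x = v *~ numq x.
Proof.
have [n dE] : exists n : nat, denq x = n.+1%:Z.
  by have := denq_gt0 x; case: (denq x) => [[|n]|n] // _; exists n.
by rewrite dE; have [w we] := loc_divide (v *~ numq x) n; exists w.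
Qed.

Definition loc_scale (x : rat) (v : localization) : localization :=
  sval (cid (loc_scale_subproof x v)).

Lemma fraction_cross (x : rat) (n d : int) :
  d != 0 -> x = n%:Q / d%:Q -> n * denq x = numq x * d.
Proof.
move=> d0 xE; have dq0 : d%:Q != 0 by rewrite intr_eq0.
by apply: (@intr_inj rat); rewrite !rmorphM /= numqE {2}xE; field.
Qed.

Lemma loc_scaleP (x : rat) (v : localization) (n d : int) :
  d != 0 -> x = n%:Q / d%:Q -> loc_scale x v *~ d = v *~ n.
Proof.
move=> d0 xE; have := svalP (cid (loc_scale_subproof x v)).
rewrite -/(loc_scale x v) => se; apply: (loc_torsion_freez (d := denq x)).
  exact: denq_neq0.
by rewrite -!mulrzA (fraction_cross d0 xE) [d * _]mulrC [LHS]mulrzA se -mulrzA.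
Qed.

Lemma loc_scale_eq (x : rat) (v w : localization) (n d : int) :
  d != 0 -> x = n%:Q / d%:Q -> w *~ d = v *~ n -> w = loc_scale x v.
Proof.
move=> d0 xE we; apply: (loc_torsion_freez d0).
by rewrite we (loc_scaleP _ d0 xE).
Qed.

Lemma loc_scaleE (x : rat) (v : localization) :
  loc_scale x v *~ denq x = v *~ numq x.
Proof. by apply: loc_scaleP; rewrite ?denq_neq0 // divq_num_den. Qed.

Fact loc_scaleA x y v : loc_scale x (loc_scale y v) = loc_scale (x * y) v.
Proof.
apply: (@loc_scale_eq _ _ _ (numq x * numq y) (denq x * denq y)).
- by rewrite mulf_neq0 ?denq_neq0.
- rewrite !rmorphM /= -{1}[x]divq_num_den -{1}[y]divq_num_den; field.
  by rewrite !intr_eq0 !denq_neq0.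
by rewrite mulrzA loc_scaleE mulrzAC loc_scaleE -!mulrzA mulrC.
Qed.

Fact loc_scale1 : left_id 1 loc_scale.
Proof. by move=> v; apply/esym/(@loc_scale_eq _ _ _ 1 1). Qed.

Fact loc_scaleDr : right_distributive loc_scale +%R.
Proof.
move=> x v w; apply/esym/(@loc_scale_eq _ _ _ (numq x) (denq x)).
- exact: denq_neq0.
- by rewrite divq_num_den.
- by rewrite !mulrzDl !loc_scaleE.
Qed.

Fact loc_scaleDl v x y : loc_scale (x + y) v = loc_scale x v + loc_scale y v.
Proof.
apply/esym/(@loc_scale_eq _ _ _ (numq x * denq y + numq y * denq x) (denq x * denq y)).
- by rewrite mulf_neq0 ?denq_neq0.
- rewrite rmorphD !rmorphM /= -{1}[x]divq_num_den -{1}[y]divq_num_den; field.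
  by rewrite !intr_eq0 !denq_neq0.
rewrite mulrzDl mulrzA loc_scaleE [denq x * _]mulrC mulrzA loc_scaleE.
by rewrite mulrzDr !mulrzA.
Qed.

HB.instance Definition _ := GRing.Zmodule_isLmodule.Build rat localization
  loc_scaleA loc_scale1 loc_scaleDr loc_scaleDl.

Section UniversalProperty.
Variables (W : lmodType rat) (f : A -> W).
Hypotheses (f0 : f 0 = 0) (fD : forall a b, f (a + b) = f a + f b).

Lemma rat_mulrn_inj (u v : W) n : u *+ n.+1 = v *+ n.+1 -> u = v.
Proof.
rewrite -!scaler_nat => /(congr1 (fun w => n.+1%:R^-1 *: w)).
by rewrite !scalerA mulVf ?pnatr_eq0 // !scale1r.
Qed.

Lemma additive_mulrn a n : f (a *+ n) = f a *+ n.
Proof. by elim: n => [|n IHn]; rewrite ?mulr0n // !mulrS fD IHn. Qed.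

Lemma additive_opp a : f (- a) = - f a.
Proof. by apply: (addrI (f a)); rewrite -fD !subrr. Qed.

(** Independent of the representative because a rational vector space has no torsion, see
    [loc_liftE]. *)
Definition loc_lift (v : localization) : W :=
  (repr v).2.+1%:R^-1 *: f (repr v).1.

Lemma loc_liftE p : loc_lift (\pi_localization p) = p.2.+1%:R^-1 *: f p.1.
Proof.
rewrite /loc_lift; move: (loc_repr p); move: (repr _) => q /loc_equivP[k e].
have : (f q.1 *+ p.2.+1 - f p.1 *+ q.2.+1) *+ k.+1 = 0 *+ k.+1.
  by rewrite mul0rn -f0 -e additive_mulrn fD additive_opp !additive_mulrn.
move/rat_mulrn_inj/subr0_eq; rewrite -!scaler_nat => h.
apply: (@rat_mulrn_inj _ _ q.2); apply: (@rat_mulrn_inj _ _ p.2).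
rewrite -!scaler_nat !scalerA -[p.2.+1%:R * q.2.+1%:R / _]mulrA divff ?pnatr_eq0 // mulr1 h.
by rewrite mulrAC divff ?pnatr_eq0 // mul1r.
Qed.

Lemma loc_lift_tau a : loc_lift (loc_tau a) = f a.
Proof. by rewrite loc_liftE /= invr1 scale1r. Qed.

Fact loc_lift_add v w : loc_lift (v + w) = loc_lift v + loc_lift w.
Proof.
move: v w; elim/loc_ind => p; elim/loc_ind => q.
rewrite -[_ + _ in LHS]/(loc_add (\pi_localization p) (\pi_localization q)) loc_addE.
rewrite !loc_liftE /= mul_denominatorsE fD !additive_mulrn -!scaler_nat.
have nz n : n.+1%:R != 0 :> rat by rewrite pnatr_eq0.
rewrite scalerDr !scalerA natrM; move: (nz p.2) (nz q.2).
move: (p.2.+1%:R) (q.2.+1%:R) => a b a0 b0.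
by congr (_ *: _ + _ *: _); field; rewrite a0 b0.
Qed.

End UniversalProperty.

Lemma rat_additive_scale (V W : lmodType rat) (g : V -> W) :
  (forall u v, g (u + v) = g u + g v) -> forall (x : rat) v, g (x *: v) = x *: g v.
Proof.
move=> gD; have g0 : g 0 = 0 by apply: (addrI (g 0)); rewrite -gD !addr0.
have gN u : g (- u) = - g u by apply: (addrI (g u)); rewrite -gD !subrr.
have gn u n : g (u *+ n) = g u *+ n.
  by elim: n => [|n IHn]; rewrite ?mulr0n // !mulrS gD IHn.
have gz u (n : int) : g (u *~ n) = g u *~ n.
  by case: n => n; rewrite ?NegzE ?mulrNz ?gN -?pmulrn ?gn.
move=> x v; have d0 : (denq x)%:Q != 0 by rewrite intr_eq0 denq_neq0.
have : (denq x)%:Q *: g (x *: v) = (denq x)%:Q *: (x *: g v).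
  rewrite scaler_int -gz -scaler_int !scalerA mulrC -numqE.
  by rewrite !scaler_int gz.
by move/(congr1 (fun w => (denq x)%:Q^-1 *: w)) => /=; rewrite ![_^-1 *: (_ *: _)]scalerA mulVf // !scale1r.
Qed.

End Localization.

(** * Independent families and infinite rank *)

Section Independence.
Variable A : zmodType.

(** The generated subgroup as an intersection, so that it lies at once in any group of rational
    points that contains [s]. *)
Definition z_span (s : seq A) (Q : A) : Prop := forall H : A -> Prop,
  H 0 -> (forall x y, H x -> H y -> H (x - y)) -> {in s, forall x, H x} -> H Q.

(** A triangular form of independence, suited to a construction that adds one point at a time. *)
Fixpoint z_independent (s : seq A) : Prop :=
  if s is P :: s' then
    z_independent s' /\ (forall k, z_span s' (P *+ k) -> k = 0%N)
  else True.

Lemma z_span0 s : z_span s 0.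
Proof. by move=> H H0. Qed.

Lemma z_spanB s x y : z_span s x -> z_span s y -> z_span s (x - y).
Proof. by move=> sx sy H H0 HB Hs; apply: (HB); [exact: sx|exact: sy]. Qed.

Lemma z_spanN s x : z_span s x -> z_span s (- x).
Proof. by move=> sx; rewrite -sub0r; apply: z_spanB => //; exact: z_span0. Qed.

Lemma z_spanD s x y : z_span s x -> z_span s y -> z_span s (x + y).
Proof. by move=> sx sy; rewrite -[y]opprK; apply: z_spanB => //; exact: z_spanN. Qed.

Lemma z_spanMn s x n : z_span s x -> z_span s (x *+ n).
Proof.
by move=> sx; elim: n => [|n IHn]; rewrite ?mulr0n ?mulrS; [exact: z_span0|exact: z_spanD].
Qed.

Lemma z_spanMz s x (n : int) : z_span s x -> z_span s (x *~ n).
Proof.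
move=> sx; case: n => n; first exact: z_spanMn.
by rewrite NegzE mulrNz; apply: z_spanN; exact: z_spanMn.
Qed.

Lemma z_span_mem s x : x \in s -> z_span s x.
Proof. by move=> xs H _ _; apply. Qed.

(** Clearing denominators turns a rational dependence into an integral one modulo torsion; a further
    multiple kills the torsion and contradicts independence. *)
Lemma z_independent_free (n : nat) (g : {linear localization A -> 'rV[rat]_n})
    (s : seq A) : injective g -> z_independent s ->
  free [seq g (loc_tau P) | P <- s].
Proof.
move=> g_inj; elim: s => [|P s IHs]; first by rewrite nil_free.
rewrite map_cons => -[/IHs fs indep]; rewrite free_cons fs andbT; apply/negP => Ps.
pose X := [seq g (loc_tau P) | P <- s].
pose clear w := exists D Q, z_span s Q /\ w *+ D.+1 = g (loc_tau Q).
have [D [Q [sQ DQ]]] : clear (g (loc_tau P)).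
  rewrite (coord_span (X := in_tuple X) Ps).
  elim/big_ind: _ => [|u v [D [Q [sQ uD]]] [D' [Q' [sQ' vD]]]|i _].
  - by exists 0%N, 0; split; [exact: z_span0|rewrite !raddf0].
  - exists (mul_denominators D D'), (Q *+ D'.+1 + Q' *+ D.+1); split.
      by apply: z_spanD; exact: z_spanMn.
    rewrite mul_denominatorsE mulrnDl !raddfD /= !raddfMn /= -uD -vD -!mulrnA.
    by rewrite [(D'.+1 * _)%N]mulnC.
  set q := coord _ _ _; have [d dE] : exists d : nat, denq q = d.+1%:Z.
    by have := denq_gt0 q; case: (denq q) => [[|d]|d] // _; exists d.
  have si : (i < size s)%N by rewrite -(size_map (fun P => g (loc_tau P)) s) ltn_ord.
  exists d, (s`_i *~ numq q); split; first by apply: z_spanMz; apply: z_span_mem; exact: mem_nth.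
  rewrite !raddfMz /= (nth_map 0) //.
  by rewrite -scaler_nat scalerA pmulrn -dE mulrC -numqE scaler_int.
have : loc_tau (P *+ D.+1 - Q) = 0.
  by apply: g_inj; rewrite raddf0 !raddfB /= !raddfMn /= DQ subrr.
case/loc_tau_eq0 => k; rewrite mulrnBl -mulrnA => /subr0_eq e.
by have := indep (D.+1 * k.+1)%N; rewrite e => /(_ (z_spanMn _ sQ)).
Qed.

Lemma localization_infinite_dimensional :
  (forall n, exists s : seq A, size s = n /\ z_independent s) ->
  ~ finite_dimensional (localization A).
Proof.
move=> indep [n [g [g' gK _]]]; have [s [sn si]] := indep n.+1.
have fs := z_independent_free (can_inj gK) si.
have := dimvS (subvf <<[seq g (loc_tau P) | P <- s]>>%VS).
by move: fs; rewrite /free => /eqP->; rewrite size_map sn dimvf /= /dim /= mul1n ltnn.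
Qed.

(** The localization is built from the group [A] and composed with the bijection [phi]; as [phi] and
    [psi] respect addition and zero, the universal property passes to [M]. *)
Lemma infinite_rank_of_independent (M : baseAddUMagmaType) (phi : M -> A) (psi : A -> M) :
  cancel phi psi -> cancel psi phi -> phi 0 = 0 ->
  (forall P Q, phi (P + Q) = phi P + phi Q) ->
  (forall n, exists s : seq A, size s = n /\ z_independent s) ->
  infinite_rank M.
Proof.
move=> phiK psiK phi0 phiD indep.
pose tau (P : M) := loc_tau (phi P).
have tau_morph : nmod_morphism tau.
  by split=> [|P Q]; rewrite /tau ?phi0 ?raddf0 // phiD raddfD.
pose taum : {additive M -> localization A} :=
  HB.pack tau (GRing.isNmodMorphism.Build M (localization A) tau tau_morph).
exists (localization A), taum; split; last exact: localization_infinite_dimensional.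
move=> W f.
have psi0 : psi 0 = 0 by rewrite -phi0 phiK.
have psiD a b : psi (a + b) = psi a + psi b by apply: (can_inj phiK); rewrite phiD !psiK.
have f0 : f (psi 0) = 0 by rewrite psi0 raddf0.
have fD a b : f (psi (a + b)) = f (psi a) + f (psi b) by rewrite psiD raddfD.
have liftD := loc_lift_add f0 fD.
have liftZ := rat_additive_scale liftD.
pose g := loc_lift (f \o psi).
have g_zmod : zmod_morphism g.
  by move=> u v; apply: (addIr (g v)); rewrite -liftD !subrK.
have g_scale : scalable g by move=> x v; exact: liftZ.
pose gl : {linear localization A -> W} := HB.pack g
  (GRing.isZmodMorphism.Build (localization A) W g g_zmod)
  (GRing.isScalable.Build rat (localization A) W _ g g_scale).
exists gl; split=> [P|h htau v] /=.
  by rewrite /g /tau (loc_lift_tau f0 fD) /= phiK.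
have [a [n an]] := loc_fraction v.
apply: (@rat_mulrn_inj _ _ _ n).
rewrite -raddfMn /= an -[RHS](raddfMn gl) an /=.
by have := htau (psi a); rewrite /= /tau psiK => ->; rewrite /g (loc_lift_tau f0 fD).
Qed.

End Independence.

(** * Enlarging the base field and iterating the new point *)

Lemma exists_extension_infinite_square_classes (K L : fieldType)
    (iota : {rmorphism K -> L}) (F : divringClosed K) (s : seq K) :
  separably_closed L -> 2 != 0 :> K -> ~ finite_square_classes F ->
  exists M : divringClosed K,
    [/\ {subset F <= M}, {subset s <= M} & ~ finite_square_classes M].
Proof.
move=> closed char2 infF; elim: s => [|x s [M [FM sM infM]]]; first by exists F; split.
exists (adjoin M x); split.
- by move=> z /FM; exact: adjoin_sub.
- by move=> z; rewrite inE => /predU1P[->|/sM]; [exact: adjoin_gen|exact: adjoin_sub].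
have [[m [mM mx m0]]|no] := pselect (exists m : {poly K},
    [/\ m \is a polyOver M, root m x & m != 0]).
  exact: algebraic_infinite_square_classes mM m0 mx infM.
apply: (transcendental_infinite_square_classes iota closed) => m mM mx.
by apply: contrapT => /eqP m0; apply: no; exists m.
Qed.

Lemma rational_over_sub (K : fieldType) (E : legendre K) (F M : divringClosed K)
    (P : lpoint E) : {subset F <= M} -> rational_over F P -> rational_over M P.
Proof.
move=> FM; rewrite /rational_over; case: (val P) => [[x y]|//].
by move=> [/FM xM [d /FM dM ->]]; split=> //; exists d.
Qed.

Theorem corollary9 (K Ksep : fieldType) (iota : {rmorphism K -> Ksep})
  (hKsep : is_separable_closure iota)
  (hlf : ~ locally_finite K)
  (hchar : 2%N \notin [pchar K])
  (hG : topologically_finitely_generated iota)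
  (E : elliptic_curve K)
  (hE : has_full_two_torsion E) :
  infinite_rank (ec_point E).
Proof.
have char2 : 2 != 0 :> K by apply: contra hchar => K2; rewrite inE /= K2.
have finK := finitely_generated_finite_square_classes hKsep char2 hG.
have [E' [phi [psi [phiK psiK phi0 phiD]]]] := legendre_form char2 hE.
apply: (infinite_rank_of_independent phiK psiK phi0 phiD).
have [O [t [p [F0 [valO [t0 tm] [p_prime p_odd pm] tF0 infF0]]]]] :=
  exists_base_field iota hKsep.2 char2 hlf.
have [l torsl] := finite_odd_torsion E' p_odd.
(* The curve coefficients and all points of order p over K are adjoined once; they stay rational
   over every larger field of the induction. *)
pose coords := flatten [seq if val P is Some (x, y) then [:: x; y] else [::] | P <- l].
have [F [F0F abF infF]] := exists_extension_infinite_square_classes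
  iota [:: lg_a E', lg_b E' & coords] hKsep.2 char2 infF0.
have torsF (Q : lpoint E') : Q *+ p = 0 -> rational_over F Q.
  move=> Q0; have Ql := torsl _ Q0; case QE : (val Q) => [[x y]|]; last by rewrite /rational_over QE.
  have inF z : z \in [:: x; y] -> z \in F.
    move=> zxy; apply: abF; rewrite !inE; apply/orP; right; apply/orP; right.
    by apply/flatten_mapP; exists Q => //; rewrite QE.
  by apply/(rational_overP F QE); split; apply: inF; rewrite !inE eqxx ?orbT.
have aF : lg_a E' \in F by rewrite abF ?mem_head.
have bF : lg_b E' \in F by rewrite abF // !inE eqxx orbT.
(* The field [M] contains the coordinates of the points found so far and keeps infinitely many
   square classes; a new point enlarges it to M(y). *)
move=> n; suff [M [s [_ sn si _ _]]] : exists (M : divringClosed K) (s : seq (lpoint E')),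
    [/\ {subset F <= M}, size s = n, z_independent s, {in s, forall P, rational_over M P}
      & ~ finite_square_classes M] by exists s.
elim: n => [|n [M [s [FM sn si sM infM]]]]; first by exists F, [::]; split.
have [|P [x [y [PE xM yM indP]]]] := exists_independent_point valO t0 tm
    p_prime p_odd pm finK infM (FM _ (F0F _ tF0)) (FM _ aF) (FM _ bF).
  by move=> Q /torsF; exact: rational_over_sub.
have y2M : y ^+ 2 \in M.
  by rewrite (lpoint_eqn PE) lg_cubicE; mem_closed; rewrite FM.
have subM := quadratic_sub yM y2M.
exists (quadratic yM y2M), (P :: s); split.
- by move=> z /FM; exact: subM.
- by rewrite /= sn.
(* The span of [s] consists of points rational over [M], so no positive multiple of the new point
   lies in it. *)
- split=> // k spk; apply: indP; apply: (spk) => [|Q Q' MQ MQ'|//].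
    exact: rational_over0.
  apply: rational_overD; rewrite ?FM //; exact: rational_overN.
- move=> Q; rewrite inE => /predU1P[->|/sM]; last exact: rational_over_sub.
  by apply/(rational_overP _ PE); rewrite subM // quadratic_gen.
- exact: quadratic_infinite_square_classes.
Qed.
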